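(* Assume that $\Gamma_\mu$ is proximal and strongly irreducible, that $\mu$ admits a finite exponential moment, and that the first Lyapunov exponent $\lambda_\mu$ is zero. Then, for any non-negative Borel measurable function $h$ on $\mathbb P(\mathbb V)\times\mathbb R$, $$\int_{\mathbb P(\mathbb V)\times\mathbb R}h(x,t)\,\rho(dx,dt)=\int_{\mathbb P(\mathbb V)\times[0,\infty)}\mathbb E\big(h(g_1x,\,t+\sigma(g_1,x))\big)\,\rho(dx,dt),$$ $$\int_{\mathbb P(\mathbb V)\times\mathbb R}h(x,t)\,\check\rho(dx,dt)=\int_{\mathbb P(\mathbb V)\times[0,\infty)}\mathbb E\big(h(g_1x,\,t-\sigma(g_1,x))\big)\,\check\rho(dx,dt).$$
   Context: $\mathbb V$ is a finite-dimensional real vector space with a Euclidean norm $\|\cdot\|$, $\mathbb G=\mathrm{GL}(\mathbb V)$ acts on the projective space $\mathbb P(\mathbb V)$ by $g(\mathbb Rv)=\mathbb R(gv)$, and $\|g\|$ denotes the operator norm. $\mu$ is a Borel probability measure on $\mathbb G$, and $\Gamma_\mu$ is the closed subsemigroup of $\mathbb G$ spanned by the support of $\mu$. $\Gamma_\mu$ is proximal if it contains an element $g$ whose characteristic polynomial has a unique root of maximal modulus, this root being simple. $\Gamma_\mu$ is strongly irreducible if no finite union of proper non-zero subspaces of $\mathbb V$ is $\Gamma_\mu$-invariant. $\mu$ admits a finite exponential moment if $\int_{\mathbb G}\max\{\|g\|,\|g^{-1}\|\}^\alpha\mu(dg)<\infty$ for some constant $\alpha>0$. For $g\in\mathbb G$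 and $x=\mathbb Rv\in\mathbb P(\mathbb V)$, $\sigma(g,x)=\log\frac{\|gv\|}{\|v\|}$. $g_1,g_2,\dots$ are i.i.d. random elements of $\mathbb G$ with law $\mu$. The first Lyapunov exponent $\lambda_\mu$ is the real number such that for every $x\in\mathbb P(\mathbb V)$, almost surely, $\frac1n\sigma(g_n\cdots g_1,x)\to\lambda_\mu$. For $x\in\mathbb P(\mathbb V)$ and $t\in\mathbb R$: $\tau_{x,t}=\min\{k\ge1:\ t+\sigma(g_k\cdots g_1,x)<0\}$ and $\check\tau_{x,t}=\min\{k\ge1:\ t-\sigma(g_k\cdots g_1,x)<0\}$, with $\min\emptyset=\infty$. $\mathbb E(X;B)=\mathbb E(X\mathbf 1_B)$. Definition of $\rho,\check\rho$ (target harmonic measures): they are the Radon measures on $\mathbb P(\mathbb V)\times\mathbb R$ characterized by the following: for every continuous compactly supported $h$ on $\mathbb P(\mathbb V)\times\mathbb R$ and every $x\in\mathbb P(\mathbb V)$ (uniformly in $x$), $\int h\,d\rho=\lim_{n\to\infty}\int_0^\infty t\,\mathbb E\big(h(g_n\cdots g_1x,t+\sigma(g_n\cdots g_1,x));\tau_{x,t}>n-1\big)dt$ and $\int h\,d\check\rho=\lim_{n\to\infty}\int_0^\infty t\,\mathbb E\big(h(g_n\cdots g_1x,t-\sigma(g_n\cdots g_1,x));\check\tau_{x,t}>n-1\big)dt$. The existence of these limits and measures under the stated hypotheses is taken as given. *)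

(* Defs.v *)
From HB Require Import structures.
From mathcomp Require Import all_boot all_order all_algebra.
From mathcomp Require Import finmap.
From mathcomp Require Import all_classical all_reals all_analysis.
From mathcomp Require Import complex.

Set Implicit Arguments.
Unset Strict Implicit.
Unset Printing Implicit Defensive.

Import Order.TTheory GRing.Theory Num.Theory.
Import numFieldNormedType.Exports.

Local Open Scope classical_set_scope.
Local Open Scope ring_scope.

(* A finite-dimensional real inner product space. It is required to be nonzero
   because its projective space has to be a pointed type; the zero space has no
   proximal semigroup of automorphisms anyway. *)
HB.mixin Record isEuclidean (R : realType) V of Vector R V := {
  inner : {dot V for (@idfun R)} ;
  dimv_gt0 : (0 < \dim (@fullv R V))%N
}.

#[short(type="euclideanType")]
HB.structure Definition Euclidean (R : realType) :=
  { V of Vector R V & isEuclidean R V }.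

Section Norm.
Context {R : realType} {V : euclideanType R}.

Definition enorm (v : V) : R := Num.sqrt (inner (s := V) v v).

Lemma enormZ (k : R) v : enorm (k *: v) = `|k| * enorm v.
Proof.
rewrite /enorm linearZl_LR linearZ /= mulrA -expr2.
by rewrite sqrtrM ?sqr_ge0// sqrtr_sqr.
Qed.

Definition opnorm (f : 'End(V)) : R :=
  sup [set enorm (f v) | v in [set v | enorm v <= 1]].

Definition vopen (A : set V) : Prop :=
  forall v, A v -> exists2 e : R, 0 < e & forall w, enorm (w - v) < e -> A w.

Lemma vopenT : vopen setT.
Proof. by move=> v _; exists 1. Qed.

Lemma vopenI : setI_closed vopen.
Proof.
move=> A B oA oB v [/oA[d d0 dA] /oB[e e0 eB]].
by exists (Num.min d e) => [|w]; rewrite lt_min ?d0// => /andP[/dA ? /eB].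
Qed.

Lemma vopen_bigU (I : Type) (F : I -> set V) :
  (forall i, vopen (F i)) -> vopen (\bigcup_i F i).
Proof.
move=> oF v [i _ /oF[e e0 eF]].
by exists e => // w /eF Fw; exists i.
Qed.

End Norm.

Section GL.
Context {R : realType}.

Record GL (V : euclideanType R) : Type := MkGL {
  GLfun :> 'End(V) ;
  GL_ker0 : lker GLfun == 0%VS }.

HB.instance Definition _ (V : euclideanType R) := [isSub for @GLfun V].
HB.instance Definition _ (V : euclideanType R) := [Choice of GL V by <:].

Context {V : euclideanType R}.
Implicit Types f g : GL V.

Lemma GL1_subproof : lker (\1%VF : 'End(V)) == 0%VS.
Proof. by apply/lker0P => u v; rewrite !id_lfunE. Qed.
Definition GL1 : GL V := MkGL GL1_subproof.

Lemma GLmul_subproof f g : lker (f \o g)%VF == 0%VS.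
Proof.
apply/lker0P => u v; rewrite !comp_lfunE.
by move=> /(lker0P (GL_ker0 f)) /(lker0P (GL_ker0 g)).
Qed.
Definition GLmul f g : GL V := MkGL (GLmul_subproof f g).

HB.instance Definition _ := isPointed.Build (GL V) GL1.

Definition GLopen (A : set (GL V)) : Prop :=
  forall f, A f ->
    exists2 e : R, 0 < e & forall g, opnorm (GLfun g - GLfun f) < e -> A g.

Lemma GLopenT : GLopen setT.
Proof. by move=> v _; exists 1. Qed.

Lemma GLopenI : setI_closed GLopen.
Proof.
move=> A B oA oB v [/oA[d d0 dA] /oB[e e0 eB]].
by exists (Num.min d e) => [|w]; rewrite lt_min ?d0// => /andP[/dA ? /eB].
Qed.

Lemma GLopen_bigU (I : Type) (F : I -> set (GL V)) :
  (forall i, GLopen (F i)) -> GLopen (\bigcup_i F i).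
Proof.
move=> oF v [i _ /oF[e e0 eF]].
by exists e => // w /eF Fw; exists i.
Qed.

HB.instance Definition _ :=
  isOpenTopological.Build (GL V) GLopenT GLopenI GLopen_bigU.

End GL.

Section Projective.
Context {R : realType}.

Record projective (V : euclideanType R) : Type := MkProj {
  line :> {vspace V} ;
  dim_line : \dim line == 1%N }.

HB.instance Definition _ (V : euclideanType R) := [isSub for @line V].
HB.instance Definition _ (V : euclideanType R) := [Choice of projective V by <:].

Context {V : euclideanType R}.
Implicit Types (g : GL V) (x : projective V).

Lemma proj_point_subproof : \dim <[vpick (@fullv R V)]>%VS == 1%N.
Proof.
by rewrite dim_vline eqb1 vpick0 -dimv_eq0 -lt0n dimv_gt0.
Qed.

HB.instance Definition _ :=
  isPointed.Build (projective V) (MkProj proj_point_subproof).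

(* projective V carries the quotient topology: cone A is the preimage of A by
   the projection v |-> <[v]> of V \ {0} onto projective V. *)
Definition cone (A : set (projective V)) : set V :=
  [set v | exists2 x, A x & line x = <[v]>%VS].

Definition proj_open (A : set (projective V)) : Prop := vopen (cone A).

Lemma line_inj : injective (@line V).
Proof. exact: val_inj. Qed.

Lemma proj_openT : proj_open setT.
Proof.
move=> v [x _ xv].
have v0 : v != 0 by have := dim_line x; rewrite xv dim_vline eqb1.
exists (enorm v) => [|w wv].
  by rewrite sqrtr_gt0 neq0_dnorm_gt0.
have w0 : w != 0.
  apply: contraTneq wv => ->; rewrite -leNgt sub0r /enorm.
  by rewrite linearNl linearN opprK.
have wl : \dim <[w]>%VS == 1%N by rewrite dim_vline w0.
by exists (MkProj wl).
Qed.

Lemma proj_openI : setI_closed proj_open.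
Proof.
move=> A B oA oB; rewrite /proj_open.
suff -> : cone (A `&` B) = cone A `&` cone B by exact: vopenI.
apply/seteqP; split=> v [].
  by move=> x [Ax Bx] xv; split; exists x.
move=> [x Ax xv] [y By yv]; exists x => //; split => //.
by rewrite (_ : x = y)//; apply: line_inj; rewrite xv yv.
Qed.

Lemma proj_open_bigU (I : Type) (F : I -> set (projective V)) :
  (forall i, proj_open (F i)) -> proj_open (\bigcup_i F i).
Proof.
move=> oF; rewrite /proj_open.
suff -> : cone (\bigcup_i F i) = \bigcup_i cone (F i) by exact: vopen_bigU.
apply/seteqP; split=> v.
  by move=> [x [i _ Fx] xv]; exists i => //; exists x.
by move=> [i _ [x Fx xv]]; exists x => //; exists i.
Qed.

HB.instance Definition _ :=
  isOpenTopological.Build (projective V) proj_openT proj_openI proj_open_bigU.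

Lemma act_subproof g x : \dim (GLfun g @: line x)%VS == 1%N.
Proof.
by rewrite limg_dim_eq ?dim_line//; rewrite (eqP (GL_ker0 g)) capv0.
Qed.
Definition act g x : projective V := MkProj (act_subproof g x).

Definition cocycle g x : R :=
  let v := vpick (line x) in ln (enorm (GLfun g v) / enorm v).

Lemma cocycleE g x (v : V) : line x = <[v]>%VS ->
  cocycle g x = ln (enorm (GLfun g v) / enorm v).
Proof.
move=> xv; rewrite /cocycle.
have : vpick (line x) \in <[v]>%VS by rewrite -xv memv_pick.
have : vpick (line x) != 0.
  by rewrite vpick0 -dimv_eq0 (eqP (dim_line x)).
move=> /[swap] /vlineP[k ->]; rewrite scaler_eq0 negb_or => /andP[k0 v0].
by rewrite linearZ !enormZ -mulf_div divff ?mul1r// normr_eq0.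
Qed.

End Projective.

HB.instance Definition _ (T U : ptopologicalType) :=
  Topological.on (T * U)%type.

Definition borel (T : ptopologicalType) := g_sigma_algebraType (@open T).

Section Semigroup.
Context {R : realType} {V : euclideanType R}.
Implicit Types (S : set (GL V)) (g : GL V).

Definition supp (mu : probability (borel (GL V)) R) : set (GL V) :=
  [set g | forall U : set (GL V), open U -> U g -> (0 < mu U)%E].

Definition closed_semigroup S : Prop :=
  closed S /\ (forall f g, S f -> S g -> S (GLmul f g)).

Definition Gamma (mu : probability (borel (GL V)) R) : set (GL V) :=
  smallest closed_semigroup (supp mu).

Definition complex_char_poly g : {poly R[i]} :=
  let b := vbasis (@fullv R V) in
  map_poly (real_complex R) (char_poly (passmx.mxof b b (GLfun g))).

Definition proximal S : Prop :=
  exists2 g, S g &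
    exists2 z : R[i], mup z (complex_char_poly g) = 1%N &
      forall w, root (complex_char_poly g) w -> w != z -> `|w| < `|z|.

(* The list is required to be nonempty: an empty union is always invariant. *)
Definition strongly_irreducible S : Prop :=
  forall W : seq {vspace V}, W != [::] ->
    (forall U, U \in W -> U != 0%VS /\ U != fullv) ->
    let D := [set v : V | exists2 U, U \in W & v \in U] in
    ~ (forall g, S g -> GLfun g @` D `<=` D).

Definition finite_exponential_moment (mu : probability (borel (GL V)) R) :
    Prop :=
  exists2 alpha : R, 0 < alpha &
    (\int[mu]_g ((Num.max (opnorm (GLfun g)) (opnorm (GLfun g)^-1%VF))
                   `^ alpha)%:E < +oo)%E.

End Semigroup.

Section Walk.
Context {R : realType} {V : euclideanType R}.
Context {d : measure_display} {Omega : measurableType d}.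
Variable P : probability Omega R.
Implicit Types (g : nat -> {RV P >-> borel (GL V)}) (x : projective V) (t : R).

Definition mutually_independent {d' : measure_display} {T : measurableType d'}
    (X : nat -> {RV P >-> T}) : Prop :=
  forall (J : {fset nat}) (A : nat -> set T), (forall i, measurable (A i)) ->
    P (\bigcap_(i in [set` J]) (X i @^-1` A i)) =
    (\prod_(i <- J) P (X i @^-1` A i))%E.

Definition iid (mu : probability (borel (GL V)) R) g : Prop :=
  mutually_independent g /\
  (forall i A, measurable A -> distribution P (g i) A = mu A).

(* The sequence g_1, g_2, ... is indexed from 0: g i stands for g_(i+1), so
   that walk g n w = g_n(w) ... g_1(w). *)
Fixpoint walk g (n : nat) (w : Omega) : GL V :=
  if n is m.+1 then GLmul (g m w) (walk g m w) else GL1.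

Definition is_first_lyapunov_exponent g (lambda : R) : Prop :=
  forall x, {ae P, forall w,
    (n%:R^-1 * cocycle (walk g n w) x : R) @[n --> \oo] --> lambda}.

(* min {k >= 1 : s_k < 0}, with value +oo if there is no such k. *)
Definition first_negative (s : nat -> R) : \bar R :=
  ereal_inf [set k%:R%:E | k in [set k : nat | (1 <= k)%N /\ s k < 0]].

Definition tau g x t (w : Omega) : \bar R :=
  first_negative (fun k => t + cocycle (walk g k w) x).

Definition tau_check g x t (w : Omega) : \bar R :=
  first_negative (fun k => t - cocycle (walk g k w) x).

Definition harmonic_approx g (h : projective V * R -> R) (n : nat) x : \bar R :=
  (\int[lebesgue_measure]_(t in `[0%R, +oo[)
    (t%:E * \int[P]_(w in [set w | (n%:R - 1)%:E < tau g x t w])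
      (h (act (walk g n w) x, t + cocycle (walk g n w) x)%R)%:E))%E.

Definition harmonic_approx_check g (h : projective V * R -> R) (n : nat) x : \bar R :=
  (\int[lebesgue_measure]_(t in `[0%R, +oo[)
    (t%:E * \int[P]_(w in [set w | (n%:R - 1)%:E < tau_check g x t w])
      (h (act (walk g n w) x, t - cocycle (walk g n w) x)%R)%:E))%E.

End Walk.

Section Harmonic.
Context {R : realType} {V : euclideanType R}.

(* On the locally compact second countable space projective V * R, a Borel measure is
   Radon as soon as it is finite on compact sets. *)
Definition radon (rho : {measure set (borel (projective V * R)%type) -> \bar R}) :
    Prop :=
  forall K : set (projective V * R), compact K -> (rho K < +oo)%E.

(* As the integral of h against rho is finite, the bound forces approx h n x to
   be finite for large n. *)
Definition is_uniform_vague_limit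
    (approx : (projective V * R -> R) -> nat -> projective V -> \bar R)
    (rho : {measure set (borel (projective V * R)%type) -> \bar R}) : Prop :=
  radon rho /\
  forall h : projective V * R -> R,
    continuous h -> compact (closure [set z | h z != 0]) ->
    forall eps : R, 0 < eps -> \forall n \near \oo, forall x : projective V,
      (`|approx h n x - \int[rho]_z (h z)%:E| <= eps%:E)%E.

Context {d : measure_display} {Omega : measurableType d}.
Variable P : probability Omega R.
Variable g : nat -> {RV P >-> borel (GL V)}.

Definition is_target_harmonic_measure :=
  is_uniform_vague_limit (harmonic_approx g).

Definition is_target_harmonic_measure_check :=
  is_uniform_vague_limit (harmonic_approx_check g).

End Harmonic.

(* Main.v *)
Require Import Defs.
From HB Require Import structures.
From mathcomp Require Import all_boot all_order all_algebra.
From mathcomp Require Import all_classical all_reals all_analysis.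
From mathcomp Require Import measurable_realfun ring lra zify.

(** Write [Q] for the transition operator of the chain [(g_n .. g_1 x, t + S_n)],
[Qp] for [Q] killed below level 0, and [H n f x] for the integral of
[max t 0 * (Qp^n f) (x, t)] in [t], so that [rho] is the vague limit of [H n]. Since
[H (n + 1) f = H n (Qp f)], the identity follows by passing to the limit on both
sides. The function [Qp f] is neither compactly supported nor continuous at level 0.
The discontinuity does no harm because [H n] does not decrease under upward
translations, so [rho] is translation-monotone and does not charge level 0. For the
mass at high levels, a path ending in a window [S, S + 1[ descends below 0
within a bounded time with uniformly positive probability, unless some starting
points never exit; an optional-stopping estimate on the weight of the paths from
high levels then bounds [H n] of the window by [D r^-(3 S)] for every [r < 1], at
a suitable point [x], and the exponential moment absorbs this growth. *)

Set Implicit Arguments.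
Unset Strict Implicit.
Unset Printing Implicit Defensive.

Import Order.TTheory GRing.Theory Num.Theory.
Import numFieldNormedType.Exports.

Local Open Scope classical_set_scope.
Local Open Scope ring_scope.

(** * Killed transition operators *)

(** The exponential moment may be arbitrarily weak, so the loss r^-(3 S) must be available with r as
    close to 1 as needed: exit probabilities from level L may decay only subexponentially in L. The
    bound is extracted from the vague limit itself. If [rho] charges the support of the test
    function, [H n (win T)] stays above some c0 > 0 for all large n and all x. The contributions of
    starting levels below about L, summed over all times, stay bounded, since visits to the window
    lead to exits. So at some n most of the mass starts higher and descends by L; as the weight left
    after the descent is about C + 2 L, the descent has probability at least of order c0 / (C + 2
    L). This is polynomial in 1 / L, and iterating it in blocks of one large height L costs only a
    factor r^2 per unit of level. When exits are not uniform, the estimate is obtained at one x for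
    each n, and the uniformity of the limit in x makes that enough. The two identities are the cases
    s = 1 and s = -1 of one statement for the cocycle multiplied by s; Borel functions are reached
    by comparing two measures on open sets. *)

Section Integration.
Context {R : realType}.
Local Open Scope ereal_scope.

Definition nnm d (T : measurableType d) (f : T -> \bar R) :=
  measurable_fun setT f /\ forall x, 0 <= f x.

(** The integral of a nonnegative function is a supremum over the simple functions below it, so
    pointwise domination suffices. *)
Lemma le_ge0_integral d (T : measurableType d)
    (mu : {measure set T -> \bar R}) (D : set T) (f g : T -> \bar R) :
  (forall x, D x -> 0 <= f x) -> (forall x, D x -> f x <= g x) ->
  \int[mu]_(x in D) f x <= \int[mu]_(x in D) g x.
Proof.
move=> f0 fg; rewrite integral_mkcond [leRHS]integral_mkcond.
have p0 x : 0 <= (f \_ D) x by rewrite patchE; case: ifPn => // /set_mem/f0.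
have pg x : (f \_ D) x <= (g \_ D) x.
  by rewrite !patchE; case: ifPn => // /set_mem/fg.
rewrite !ge0_integralTE//; last by move=> x; exact: le_trans (p0 x) (pg x).
apply: le_ereal_sup => _ [s hs <-]; exists s => //= x.
by apply: le_trans (hs x) (pg x).
Qed.

(** The image of Lebesgue measure under a translation gives half-open intervals their length, hence
    is Lebesgue measure. *)
Lemma integral_add_r (f : R -> \bar R) (s : R) : nnm f ->
  \int[lebesgue_measure]_t f (t + s)%R = \int[lebesgue_measure]_t f t.
Proof.
move=> [mf f0].
pose phi : R -> R := fun t => (t + s)%R.
have mphi : measurable_fun setT (phi : R -> measurableTypeR R).
  by apply: measurable_funD.
transitivity (\int[pushforward lebesgue_measure (phi : R -> measurableTypeR R)]_t f t).
  by rewrite ge0_integral_pushforward.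
apply: eq_measure_integral => A mA _; apply/esym/lebesgue_measure_unique => //.
move=> _ [[x y] _ <-].
change (lebesgue_measure (`]x, y]%classic : set R) =
  lebesgue_measure (phi @^-1` `]x, y]%classic)).
have -> : (phi @^-1` `]x, y]%classic) = `](x - s)%R, (y - s)%R]%classic.
  by apply/seteqP; split => t /=; rewrite !in_itv/= /phi ltrBlDr lerBrDr.
rewrite !lebesgue_measure_itv/= !lte_fin ltrD2r; case: ifPn => // _.
by rewrite -!EFinB; congr EFin; ring.
Qed.

End Integration.

Section NonnegativeMeasurable.
Context {R : realType} {d} {T : measurableType d}.
Local Open Scope ereal_scope.
Implicit Types (f h : T -> \bar R).

Lemma nnm_cst (k : \bar R) : 0 <= k -> nnm (cst k : T -> \bar R).
Proof. by move=> k0; split => //; exact: measurable_cst. Qed.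

Lemma nnm_add f h : nnm f -> nnm h -> nnm (fun x => f x + h x).
Proof.
move=> [mf f0] [mh h0]; split; last by move=> x; exact: adde_ge0.
exact: emeasurable_funD.
Qed.

Lemma nnm_mul f h : nnm f -> nnm h -> nnm (fun x => f x * h x).
Proof.
move=> [mf f0] [mh h0]; split; last by move=> x; exact: mule_ge0.
exact: emeasurable_funM.
Qed.

Lemma nnm_if (b : T -> bool) f h : measurable_fun setT b -> nnm f -> nnm h ->
  nnm (fun x => if b x then f x else h x).
Proof.
move=> mb [mf f0] [mh h0]; split; last by move=> x; case: ifP.
exact: measurable_fun_ifT.
Qed.

Lemma nnm_EFin (w : T -> R) : measurable_fun setT w ->
  (forall x, 0 <= w x)%R -> nnm (fun x => (w x)%:E).
Proof. by move=> mw w0; split => //; exact/measurable_EFinP. Qed.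

Lemma nnm_sum (I : Type) (r : seq I) (F : I -> T -> \bar R) :
  (forall i, nnm (F i)) -> nnm (fun x => \sum_(i <- r) F i x).
Proof.
move=> nF; split; last by move=> x; apply: sume_ge0 => i _; exact: (nF i).2.
by apply: emeasurable_sum => i; exact: (nF i).1.
Qed.

Lemma nnm_comp d' (T' : measurableType d') (u : T' -> T) f :
  measurable_fun setT u -> nnm f -> nnm (f \o u).
Proof.
by move=> mu [mf f0]; split; [exact: measurableT_comp|move=> x; exact: f0].
Qed.

End NonnegativeMeasurable.

Section Kernel.
Context {R : realType} {dE dG : measure_display}.
Context {E : measurableType dE} {G : measurableType dG}.
Variable mu : probability G R.
Variables (a : E * G -> E) (c : E * G -> R).
Hypothesis (ma : measurable_fun setT a) (mc : measurable_fun setT c).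
Local Open Scope ereal_scope.
Local Notation Z := (E * R)%type.
Implicit Types (f h : Z -> \bar R) (z : Z) (x : E) (n : nat).

Definition step z (u : G) : Z := (a (z.1, u), z.2 + c (z.1, u))%R.

Definition Q f z := \int[mu]_u f (step z u).

(** The sign test bears on the level before the step: [iter n Qp f (x, t)] constrains the levels at
    times 0, ..., n - 1 and leaves the terminal one free, as the event tau > n - 1 does for t >=
    0. *)
Definition Qp f z := if (0 <= z.2)%R then Q f z else 0.

(** The half-line integral of t is written over the whole line with weight max t 0, so that it can
    be translated by values of the cocycle. *)
Definition H n f x :=
  \int[lebesgue_measure]_t ((Num.max t 0)%:E * iter n Qp f (x, t)).

Lemma measurable_step2 : measurable_fun setT (fun zu : Z * G => step zu.1 zu.2).
Proof.
have m1 : measurable_fun setT (fun zu : Z * G => (zu.1.1, zu.2)).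
  apply/measurable_fun_pair => //.
  by apply: measurableT_comp.
apply/measurable_fun_pair => /=.
  exact: (measurableT_comp ma m1).
apply: measurable_funD; first by apply: measurableT_comp.
exact: (measurableT_comp mc m1).
Qed.

Lemma measurable_step z : measurable_fun setT (step z).
Proof.
have m : measurable_fun setT (fun u : G => (z, u)) by exact/measurable_fun_pair.
exact: (measurableT_comp measurable_step2 m).
Qed.

Lemma measurable_stept x : measurable_fun setT (fun ut : G * R => step (x, ut.2) ut.1).
Proof.
have m : measurable_fun setT (fun ut : G * R => ((x, ut.2), ut.1)).
  by apply/measurable_fun_pair => //; exact/measurable_fun_pair.
exact: (measurableT_comp measurable_step2 m).
Qed.

Lemma nnm_step f z : nnm f -> nnm (fun u => f (step z u)).
Proof. by move=> nf; apply: nnm_comp nf; exact: measurable_step. Qed.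

Lemma nnm_Q f : nnm f -> nnm (Q f).
Proof.
move=> [mf f0]; split; last by move=> z; exact: integral_ge0.
apply: (@measurable_fun_fubini_tonelli_F _ _ _ _ _ mu
  (fun zu : Z * G => f (step zu.1 zu.2))) => //.
exact: (measurableT_comp mf measurable_step2).
Qed.

Lemma measurable_ge0_snd : measurable_fun setT (fun z : Z => (0 <= z.2)%R).
Proof. exact: measurable_fun_ler. Qed.

Lemma nnm_Qp f : nnm f -> nnm (Qp f).
Proof.
move=> nf; apply: nnm_if measurable_ge0_snd (nnm_Q nf) _.
exact: nnm_cst.
Qed.

Lemma nnm_iter n f : nnm f -> nnm (iter n Qp f).
Proof. by move=> nf; elim: n => //= n ih; exact: nnm_Qp. Qed.

Lemma le_Q f h z : (forall z, 0 <= f z) -> (forall z, f z <= h z) -> Q f z <= Q h z.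
Proof. by move=> f0 fh; apply: le_ge0_integral. Qed.

Lemma le_Qp f h z : (forall z, 0 <= f z) -> (forall z, f z <= h z) -> Qp f z <= Qp h z.
Proof. by move=> f0 fh; rewrite /Qp; case: ifP => // _; exact: le_Q. Qed.

Lemma Q_ge0 f z : (forall z, 0 <= f z) -> 0 <= Q f z.
Proof. by move=> f0; exact: integral_ge0. Qed.

Lemma Qp_ge0 f z : (forall z, 0 <= f z) -> 0 <= Qp f z.
Proof. by move=> f0; rewrite /Qp; case: ifP => // _; exact: integral_ge0. Qed.

Lemma iter_ge0 n f z : (forall z, 0 <= f z) -> 0 <= iter n Qp f z.
Proof. by move=> f0; elim: n z => //= n ih z; exact: Qp_ge0. Qed.

Lemma le_iter n f h z : (forall z, 0 <= f z) -> (forall z, f z <= h z) ->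
  iter n Qp f z <= iter n Qp h z.
Proof.
move=> f0 fh; elim: n z => //= n ih z; apply: le_Qp => // ?.
exact: iter_ge0.
Qed.

Lemma Q_add f h z : nnm f -> nnm h -> Q (fun z => f z + h z) z = Q f z + Q h z.
Proof.
move=> nf nh; rewrite /Q ge0_integralD//.
- by move=> x _; exact: (nnm_step _ nf).2.
- exact: (nnm_step _ nf).1.
- by move=> x _; exact: (nnm_step _ nh).2.
- exact: (nnm_step _ nh).1.
Qed.

Lemma Q_scale (k : \bar R) f z : 0 <= k -> nnm f -> Q (fun z => k * f z) z = k * Q f z.
Proof.
move=> k0 nf; rewrite /Q ge0_integralZl//.
- exact: (nnm_step _ nf).1.
- by move=> x _; exact: (nnm_step _ nf).2.
Qed.

Lemma Q_cst (k : \bar R) z : 0 <= k -> Q (cst k) z = k.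
Proof.
by move=> k0; rewrite /Q /cst/= integral_cst// [X in k * X]probability_setT mule1.
Qed.

Lemma Qp_add f h z : nnm f -> nnm h -> Qp (fun z => f z + h z) z = Qp f z + Qp h z.
Proof. by move=> nf nh; rewrite /Qp Q_add//; case: ifP; rewrite ?adde0. Qed.

Lemma Qp_scale (k : \bar R) f z : 0 <= k -> nnm f ->
  Qp (fun z => k * f z) z = k * Qp f z.
Proof. by move=> k0 nf; rewrite /Qp Q_scale//; case: ifP; rewrite ?mule0. Qed.

Lemma iter_add n f h z : nnm f -> nnm h ->
  iter n Qp (fun z => f z + h z) z = iter n Qp f z + iter n Qp h z.
Proof.
move=> nf nh; elim: n z => //= n ih z.
have -> : iter n Qp (fun z => f z + h z) = (fun z => iter n Qp f z + iter n Qp h z).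
  by apply/funext => ?; rewrite ih.
by rewrite Qp_add//; exact: nnm_iter.
Qed.

Lemma iter_scale n (k : \bar R) f z : 0 <= k -> nnm f ->
  iter n Qp (fun z => k * f z) z = k * iter n Qp f z.
Proof.
move=> k0 nf; elim: n z => //= n ih z.
have -> : iter n Qp (fun z => k * f z) = (fun z => k * iter n Qp f z).
  by apply/funext => ?; rewrite ih.
by rewrite Qp_scale//; exact: nnm_iter.
Qed.

Lemma nnm_section f x : nnm f -> nnm (fun t : R => f (x, t)).
Proof.
move=> nf; apply: (nnm_comp (u := fun t : R => (x, t))) nf.
exact/measurable_fun_pair.
Qed.

Lemma nnm_max0 : nnm (fun t : R => (Num.max t 0)%:E).
Proof.
apply: nnm_EFin; first exact: measurable_maxr.
by move=> t; rewrite le_max lexx orbT.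
Qed.

Lemma nnm_H_integrand n f x : nnm f ->
  nnm (fun t : R => (Num.max t 0)%:E * iter n Qp f (x, t)).
Proof.
by move=> nf; apply: nnm_mul nnm_max0 _; exact/nnm_section/nnm_iter.
Qed.

Lemma H_ge0 n f x : (forall z, 0 <= f z) -> 0 <= H n f x.
Proof.
move=> f0; apply: integral_ge0 => t _; apply: mule_ge0; last exact: iter_ge0.
by rewrite lee_fin le_max lexx orbT.
Qed.

Lemma le_H n f h x : (forall z, 0 <= f z) -> (forall z, f z <= h z) ->
  H n f x <= H n h x.
Proof.
have t0 (t : R) : 0 <= (Num.max t 0)%:E by rewrite lee_fin le_max lexx orbT.
move=> f0 fh; apply: le_ge0_integral => t _; last by apply: lee_pmul => //;
  [exact: iter_ge0|exact: le_iter].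
by apply: mule_ge0 => //; exact: iter_ge0.
Qed.

Lemma H_add n f h x : nnm f -> nnm h -> H n (fun z => f z + h z) x = H n f x + H n h x.
Proof.
move=> nf nh; have [mf f0] := nnm_H_integrand n x nf.
have [mh h0] := nnm_H_integrand n x nh.
rewrite /H -ge0_integralD//; apply: eq_integral => t _.
by rewrite iter_add// ge0_muleDr//; apply: iter_ge0; [exact: nf.2|exact: nh.2].
Qed.

Lemma H_scale n (k : \bar R) f x : 0 <= k -> nnm f ->
  H n (fun z => k * f z) x = k * H n f x.
Proof.
move=> k0 nf; have [mf f0] := nnm_H_integrand n x nf.
rewrite /H -ge0_integralZl//; apply: eq_integral => t _.
by rewrite iter_scale// muleCA.
Qed.

Lemma H_sum n (I : Type) (r : seq I) (F : I -> Z -> \bar R) x :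
  (forall i, nnm (F i)) ->
  H n (fun z => \sum_(i <- r) F i z) x = \sum_(i <- r) H n (F i) x.
Proof.
move=> nF; elim: r => [|i r ih].
  rewrite big_nil -[RHS](mul0e (H n (cst 0) x)) -(@H_scale n 0 (cst 0))//.
  by congr H; apply/funext => z; rewrite big_nil mul0e.
rewrite big_cons -ih -H_add//; last exact: nnm_sum.
by congr H; apply/funext => z; rewrite big_cons.
Qed.

Lemma H_addn n m f x : H (n + m) f x = H n (iter m Qp f) x.
Proof. by rewrite /H; apply: eq_integral => t _; rewrite iterD. Qed.

(* Fubini, then translation of the Lebesgue integral by the cocycle *)
Lemma integral_Q (w : R -> R) f x : measurable_fun setT w -> (forall t, 0 <= w t)%R ->
  nnm f ->
  \int[lebesgue_measure]_t ((w t)%:E * Q f (x, t)) =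
  \int[mu]_u \int[lebesgue_measure]_s
    ((w (s - c (x, u))%R)%:E * f (a (x, u), s)).
Proof.
move=> mw w0 nf.
have nw : nnm (fun t : R => (w t)%:E) by exact: nnm_EFin.
pose F (ut : G * R) := (w ut.2)%:E * f (step (x, ut.2) ut.1).
have [mF F0] : nnm F.
  apply: nnm_mul; first by apply: (nnm_comp (u := snd)) nw.
  exact: nnm_comp (measurable_stept x) nf.
transitivity (\int[lebesgue_measure]_t \int[mu]_u F (u, t)).
  apply: eq_integral => t _.
  rewrite /F /= ge0_integralZl//; first exact: (nnm_step _ nf).1.
    by move=> u _; exact: (nnm_step _ nf).2.
  by rewrite lee_fin.
transitivity (\int[mu]_u \int[lebesgue_measure]_t F (u, t)).
  by rewrite fubini_tonelli.
apply: eq_integral => u _.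
rewrite -[RHS](@integral_add_r _ _ (c (x, u))); last first.
  apply: nnm_mul; last exact: nnm_section.
  apply: (nnm_comp (u := fun s : R => (s - c (x, u))%R)) nw.
  exact: measurable_funB.
by apply: eq_integral => t _; rewrite /F /step/= addrK.
Qed.

End Kernel.

(** * Passage below level 0 *)

Section Indicator.
Context {R : realType}.
Local Open Scope ereal_scope.

Definition ind (b : bool) : \bar R := (b%:R)%:E.

Lemma ind_ge0 b : 0 <= ind b :> \bar R. Proof. by rewrite lee_fin. Qed.

Lemma ind_le1 b : ind b <= 1 :> \bar R. Proof. by rewrite lee_fin lern1 leq_b1. Qed.

Lemma nnm_ind d (T : measurableType d) (b : T -> bool) :
  measurable_fun setT b -> nnm (fun x => ind (b x) : \bar R).
Proof.
move=> mb; have -> : (fun x => ind (b x) : \bar R) = (fun x => if b x then 1 else 0).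
  by apply/funext => x; rewrite /ind; case: (b x).
by apply: nnm_if => //; exact: nnm_cst.
Qed.

Lemma measurable_mem d (T : measurableType d) (A : set T) : measurable A ->
  measurable_fun setT (fun x => x \in A).
Proof.
move=> mA; apply: (measurable_fun_bool true).
rewrite setTI; have -> // : (fun x => x \in A) @^-1` [set true] = A.
by apply/seteqP; split => x /=; [move/set_mem|move/mem_set].
Qed.

Lemma measurable_boolset d (T : measurableType d) (b : T -> bool) :
  measurable_fun setT b -> measurable [set x | b x].
Proof.
move=> mb; rewrite -(setTI [set x | b x]).
have mt : measurable [set true] by [].
exact: (mb measurableT _ mt).
Qed.

Lemma measurable_window (s r : R) :
  measurable_fun setT (fun t : R => (s <= t)%R && (t < r)%R).
Proof.
by apply: measurable_and; [exact: measurable_fun_ler|exact: measurable_fun_ltr].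
Qed.

End Indicator.

Section Walk.
Context {R : realType} {dE dG : measure_display}.
Context {E : measurableType dE} {G : measurableType dG}.
Variable mu : probability G R.
Variables (a : E * G -> E) (c : E * G -> R).
Hypothesis (ma : measurable_fun setT a) (mc : measurable_fun setT c).
Local Open Scope ereal_scope.
Local Notation Z := (E * R)%type.
Local Notation step := (step a c).
Local Notation Q := (Q mu a c).
Local Notation Qp := (Qp mu a c).
Local Notation H := (H mu a c).
Implicit Types (f h : Z -> \bar R) (z : Z) (x : E) (n : nat).

Definition win (s : R) z : \bar R := ind ((s <= z.2)%R && (z.2 < s + 1)%R).

Lemma nnm_win s : nnm (win s).
Proof.
apply: nnm_ind; apply: (measurableT_comp (measurable_window s (s + 1)%R)).
exact: measurable_snd.
Qed.

Lemma integral_window (s r : R) : (s <= r)%R ->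
  \int[lebesgue_measure]_t (ind ((s <= t)%R && (t < r)%R) : \bar R) = (r - s)%:E.
Proof.
move=> sr.
transitivity (\int[lebesgue_measure]_x (\1_(`[s, r[%classic : set R) x)%:E).
  by apply: eq_integral => t _; rewrite indicE mem_setE in_itv.
transitivity (lebesgue_measure (`[s, r[%classic : set R)).
  by rewrite -[in RHS](setIT `[s, r[%classic); exact: integral_indic.
rewrite lebesgue_measure_itv/= lte_fin.
by case: ltgtP sr => // -> _; rewrite subrr.
Qed.

Definition shift (k : R) f : Z -> \bar R := fun z => f (z.1, (z.2 - k)%R).

Lemma shift_win k s : shift k (win s) = win (s + k).
Proof.
apply/funext => z; rewrite /shift /win/=; congr (ind (_ && _)).
  by rewrite lerBrDr.
by rewrite ltrBlDr addrAC.
Qed.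

Lemma nnm_shift k f : nnm f -> nnm (shift k f).
Proof.
move=> nf; apply: nnm_comp nf; apply/measurable_fun_pair => //.
by apply: measurable_funB.
Qed.

(** Raising a path by k >= 0 keeps its steps and can only relax the killing. *)
Lemma le_iter_shift n k f x t : (0 <= k)%R -> (forall z, 0 <= f z) ->
  iter n Qp f (x, t) <= iter n Qp (shift k f) (x, t + k)%R.
Proof.
move=> k0 f0; elim: n x t => [|n ih] x t; first by rewrite /shift/= addrK.
rewrite !iterS /Qp /=; case: ifPn => [t0|_].
  rewrite addr_ge0//; apply: le_ge0_integral => u _; first exact: iter_ge0.
  by have := ih (a (x, u)) (t + c (x, u))%R; rewrite /step/= addrAC.
by case: ifPn => // _; apply: integral_ge0 => u _; apply: iter_ge0 => ?; exact: f0.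
Qed.

(** After the substitution of t + k for t the integrands compare pointwise: the iterates by
    [le_iter_shift], the weights because max t 0 is nondecreasing. *)
Lemma le_H_shift n k f x : (0 <= k)%R -> nnm f -> H n f x <= H n (shift k f) x.
Proof.
move=> k0 nf; rewrite {2}/H -(@integral_add_r _ _ k); last first.
  by apply: nnm_H_integrand => //; exact: nnm_shift.
have f0 := nf.2.
apply: le_ge0_integral => t _; first apply: mule_ge0.
- by rewrite lee_fin le_max lexx orbT.
- exact: iter_ge0.
- apply: lee_pmul; first by rewrite lee_fin le_max lexx orbT.
  + exact: iter_ge0.
  + by rewrite lee_fin ge_max !le_max lexx orbT andbT lerDl k0.
  + exact: le_iter_shift.
Qed.

Lemma nnm_iter_section n f x : nnm f -> nnm (fun t : R => iter n Qp f (x, t)).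
Proof. by move=> nf; exact/nnm_section/nnm_iter. Qed.

(** Without the killing, a step followed by integration in the level is, for each fixed u, a
    translation of the Lebesgue integral, so a bound uniform in x is preserved; the killing only
    decreases it. *)
Lemma integral_iter_le n f (K : \bar R) : nnm f ->
  (forall x, \int[lebesgue_measure]_t f (x, t) <= K) ->
  forall x, \int[lebesgue_measure]_t iter n Qp f (x, t) <= K.
Proof.
move=> nf fK; elim: n => [|n ih] x//.
have nI := nnm_iter mu ma mc n nf.
apply: (@le_trans _ _ (\int[lebesgue_measure]_t (1%:E * Q (iter n Qp f) (x, t)))).
  apply: le_ge0_integral => t _; first by apply: iter_ge0; exact: nf.2.
  rewrite iterS mul1e /Qp; case: ifPn => // _.
  by apply: Q_ge0 => ?; exact: nI.2.
rewrite (integral_Q mu ma mc (w := cst 1%R))//.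
have K0 : 0 <= K by apply: le_trans (fK x); apply: integral_ge0 => t _; exact: nf.2.
apply: (@le_trans _ _ (\int[mu]_u K)); last first.
  by rewrite integral_cst// [X in K * X]probability_setT mule1.
apply: le_ge0_integral => u _.
  by apply: integral_ge0 => t _; rewrite mul1e; exact: nI.2.
by apply: le_trans (ih (a (x, u))); under eq_integral do rewrite mul1e.
Qed.

Lemma integral_iter_win n s x : \int[lebesgue_measure]_t iter n Qp (win s) (x, t) <= 1.
Proof.
apply: integral_iter_le; first exact: nnm_win.
by move=> y; rewrite integral_window ?lerDl// (addrC s) addrK.
Qed.

Variable l : G -> R.
Hypotheses (ml : measurable_fun setT l) (l0 : forall u, (0 <= l u)%R).
Hypothesis cl : forall x u, (`|c (x, u)| <= l u)%R.

Let nl : nnm (fun u => (l u)%:E). Proof. exact: nnm_EFin. Qed.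


(** Translating the level by the first increment changes the weight max t 0 by at most [l u], and
    the paths ending in a unit window have total mass at most 1 in t. *)
Lemma H_succ_le n s x : (H n.+1 (win s) x <=
  \int[mu]_u (H n (win s) (a (x, u)) + (l u)%:E)).
Proof.
have ng := nnm_iter mu ma mc n (nnm_win s).
set g := iter n Qp (win s) in ng *.
have mw : measurable_fun setT (fun t : R => Num.max t 0%R) by exact: measurable_maxr.
have w0 (t : R) : (0 <= Num.max t 0)%R by rewrite le_max lexx orbT.
apply: (@le_trans _ _ (\int[lebesgue_measure]_t ((Num.max t 0)%:E * Q g (x, t)))).
  apply: le_ge0_integral => t _.
    by apply: mule_ge0; [rewrite lee_fin|apply: iter_ge0; exact: (nnm_win s).2].
  rewrite iterS; apply: lee_pmul => //; first by rewrite lee_fin.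
    by apply: Qp_ge0; exact: ng.2.
  by rewrite /Qp; case: ifPn => // _; apply: Q_ge0; exact: ng.2.
rewrite (integral_Q mu ma mc)//.
apply: le_ge0_integral => u _.
  by apply: integral_ge0 => t _; apply: mule_ge0; [rewrite lee_fin|exact: ng.2].
have [mh h0] := nnm_section (a (x, u)) ng.
have [mk k0] := nnm_mul (nnm_max0 (R := R)) (conj mh h0).
apply: (@le_trans _ _ (\int[lebesgue_measure]_t
   ((Num.max t 0)%:E * g (a (x, u), t) + (l u)%:E * g (a (x, u), t)))).
  apply: le_ge0_integral => t _; first by apply: mule_ge0; [rewrite lee_fin|exact: ng.2].
  rewrite -ge0_muleDl ?lee_fin//; apply: lee_pmul => //; rewrite ?lee_fin//.
  rewrite ge_max addr_ge0// andbT.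
  have := cl x u; rewrite ler_norml => /andP[c1 _].
  have : (t <= Num.max t 0)%R by rewrite le_max lexx.
  lra.
rewrite ge0_integralD//; last 2 first.
- by move=> t _; rewrite mule_ge0// lee_fin.
- by apply: emeasurable_funM.
apply: leeD => //; rewrite ge0_integralZl// ?lee_fin//.
rewrite -[leRHS]mule1; apply: lee_pmul => //; rewrite ?lee_fin//.
  exact: integral_ge0.
exact: integral_iter_win.
Qed.

(** A crude bound, linear in n. It serves for finitely many times, and for a fixed time whose size
    is compensated by the choice of the starting point. *)
Lemma H_win_le n s x : H n (win s) x <=
  (Num.max (s + 1) 0)%:E + n%:R%:E * \int[mu]_u (l u)%:E.
Proof.
have w0 (t : R) : (0 <= Num.max t 0)%R by rewrite le_max lexx orbT.
have I0 : 0 <= \int[mu]_u (l u)%:E by apply: integral_ge0 => u _; rewrite lee_fin.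
elim: n x => [|n ih] x.
  rewrite mul0e adde0 /H/=.
  apply: (@le_trans _ _ (\int[lebesgue_measure]_t
      ((Num.max (s + 1) 0)%:E * win s (x, t)))).
    apply: le_ge0_integral => t _; rewrite /win/=.
      by apply: mule_ge0; [rewrite lee_fin|exact: ind_ge0].
    case: (boolP (_ && _)) => [/andP[_ ts]|_]; last by rewrite !mule0.
    rewrite !mule1 lee_fin ge_max !le_max lexx orbT/= andbT.
    by rewrite (ltW ts).
  have [mS S0] := nnm_section x (nnm_win s).
  rewrite ge0_integralZl ?lee_fin//.
  rewrite -[leRHS]mule1; apply: lee_pmul => //; rewrite ?lee_fin//.
    exact: integral_ge0.
  exact: (@integral_iter_win 0).
apply: (le_trans (H_succ_le n s x)).
apply: (@le_trans _ _ (\int[mu]_u ((Num.max (s + 1) 0)%:E +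
    n%:R%:E * \int[mu]_u (l u)%:E + (l u)%:E))).
  apply: le_ge0_integral => u _; last exact: leeD.
  apply: adde_ge0; last by rewrite lee_fin.
  by apply: H_ge0; exact: (nnm_win s).2.
rewrite ge0_integralD//; last 3 first.
- by move=> u _; rewrite adde_ge0 ?mule_ge0 ?lee_fin.
- by move=> u _; rewrite lee_fin.
- exact: nl.1.
rewrite integral_cst// [X in _ * X + _]probability_setT mule1 -addeA leeD2l//.
by rewrite -natr1 EFinD ge0_muleDl ?lee_fin// mul1e.
Qed.

(* Probability of a negative level within n steps, all steps being in A *)
Fixpoint hit (A : set G) n z : \bar R :=
  if (z.2 < 0)%R then 1 else
  if n is m.+1 then \int[mu]_(u in A) hit A m (step z u) else 0.

Section Hit.
Variables (A : set G) (mA : measurable A).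

Lemma hit_neg n z : (z.2 < 0)%R -> hit A n z = 1.
Proof. by case: n => [|n] /= ->. Qed.

Lemma hit_pos n z : (0 <= z.2)%R ->
  hit A n.+1 z = \int[mu]_(u in A) hit A n (step z u).
Proof. by move=> z0 /=; rewrite ltNge z0. Qed.

Lemma hit_ge0 n z : 0 <= hit A n z.
Proof.
elim: n z => [|n ih] z /=; case: ifP => // _.
by apply: integral_ge0 => u _; exact: ih.
Qed.

Lemma nnm_hit n : nnm (hit A n).
Proof.
split; last exact: hit_ge0.
have mn : measurable_fun setT (fun z : Z => (z.2 < 0)%R) by exact: measurable_fun_ltr.
elim: n => [|n ih]; apply: measurable_fun_ifT => //.
under eq_fun do rewrite integral_mkcond.
have := (@measurable_fun_fubini_tonelli_F _ _ _ _ _ mu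
  (fun zu : Z * G => if zu.2 \in A then hit A n (step zu.1 zu.2) else 0)).
rewrite /fubini_F /= (_ : (fun z => \int[mu]_y (if y \in A then hit A n (step z y) else 0)) =
   (fun z => \int[mu]_x ((fun u => hit A n (step z u)) \_ A) x)); last first.
  by apply/funext => z; apply: eq_integral => u _; rewrite patchE.
apply; last by move=> zu; case: ifP => // _; exact: hit_ge0.
apply: measurable_fun_ifT => //.
  exact: (measurableT_comp (measurable_mem mA) (@measurable_snd _ _ Z G)).
exact: (measurableT_comp ih (measurable_step2 ma mc)).
Qed.

Lemma hit_le1 n z : hit A n z <= 1.
Proof.
elim: n z => [|n ih] z /=; case: ifP => // _.
apply: (@le_trans _ _ (\int[mu]_(u in A) 1)).
  by apply: le_ge0_integral => u _; [exact: hit_ge0|exact: ih].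
by rewrite integral_cst// mul1e probability_le1.
Qed.

Lemma hit_leS n z : hit A n z <= hit A n.+1 z.
Proof.
elim: n z => [|n ih] z.
  by rewrite /=; case: ifP => // _; apply: integral_ge0 => u _; case: ifP.
have [z0|z0] := ltP z.2 0%R; first by rewrite !hit_neg.
rewrite !hit_pos//; apply: le_ge0_integral => u _; [exact: hit_ge0|exact: ih].
Qed.

Lemma hit_le n m z : (n <= m)%N -> hit A n z <= hit A m z.
Proof.
move=> nm; rewrite -(subnKC nm); elim: (m - n)%N => [|k ih]; first by rewrite addn0.
by rewrite addnS; apply: (le_trans ih); exact: hit_leS.
Qed.

Lemma hit_antitone n x (t t' : R) : (t <= t')%R -> hit A n (x, t') <= hit A n (x, t).
Proof.
elim: n x t t' => [|n ih] x t t' tt'; have [t0|t0] := ltP t 0%R.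
- by rewrite (@hit_neg _ (x, t))//; exact: hit_le1.
- by rewrite /= !ltNge (le_trans t0 tt') t0.
- by rewrite (@hit_neg _ (x, t))//; exact: hit_le1.
- rewrite !hit_pos//=; last exact: le_trans tt'.
  apply: le_ge0_integral => u _; first exact: hit_ge0.
  by apply: ih => /=; rewrite lerD2r.
Qed.

(* Strong Markov property at the time when the level s is crossed from above *)
Lemma hit_add n m x (s t : R) (p : \bar R) : 0 <= p -> (0 <= s)%R ->
  (forall y, p <= hit A m (y, s)) ->
  p * hit A n (x, t) <= hit A (n + m) (x, t + s)%R.
Proof.
move=> p0 s0 ps.
(* Once the level r is negative, r + s lies below s, where the hypothesis on [p] applies by
   monotonicity in the level. *)
have neg k y r : (r < 0)%R -> p * hit A k (y, r) <= hit A (k + m) (y, r + s)%R.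
  move=> r0; rewrite hit_neg//= mule1; apply: (le_trans (ps y)).
  apply: (@le_trans _ _ (hit A m (y, r + s)%R)).
    by apply: hit_antitone; rewrite gerDr ltW.
  by apply: hit_le; rewrite leq_addl.
elim: n x t => [|n ih] x t; have [t0|t0] := ltP t 0%R; try exact: neg.
  by rewrite /= ltNge t0/= mule0; exact: hit_ge0.
rewrite addSn !hit_pos//=; last exact: addr_ge0.
rewrite -ge0_integralZl//; last 2 first.
- have [mh h0] := nnm_hit n.
  by apply: measurable_funTS; exact: (measurableT_comp mh (measurable_step ma mc _)).
- by move=> u _; exact: hit_ge0.
apply: le_ge0_integral => u _; first by apply: mule_ge0 => //; exact: hit_ge0.
by have := ih (a (x, u)) (t + c (x, u))%R; rewrite /step/= addrAC.
Qed.

(** A descent through k + 1 blocks of height s, each within n steps. Every block restarts from an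
    unknown direction, which is why the bound [p] is uniform in y. *)
Lemma hit_iter k n x (s p : R) : (0 <= p)%R -> (0 <= s)%R ->
  (forall y, p%:E <= hit A n (y, s)) ->
  (p ^+ k.+1)%:E <= hit A (k.+1 * n) (x, k.+1%:R * s)%R.
Proof.
move=> p0 s0 ps; elim: k x => [|k ih] x; first by rewrite mul1n mul1r expr1.
rewrite mulSn -[k.+2%:R%R]natr1 mulrDl mul1r addnC.
apply: le_trans (hit_add (k.+1 * n) x (k.+1%:R * s) _ s0 ps); last by rewrite lee_fin.
by rewrite exprS EFinM; apply: lee_pmul => //; rewrite lee_fin// exprn_ge0.
Qed.

End Hit.

Lemma hitT_le (A : set G) n z : measurable A -> hit setT n z <= hit A n z + n%:R%:E * mu (~` A).
Proof.
move=> mA; elim: n z => [|n ih] z.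
  by rewrite mul0e adde0 /=.
have [z0|z0] := ltP z.2 0%R.
  rewrite !hit_neg// leeDl// mule_ge0// lee_fin//.
rewrite !hit_pos//.
have mH := (nnm_hit mA n).1.
have mAb : measurable_fun setT (fun u => u \in A) by exact: measurable_mem.
have nP : nnm (fun u => if u \in A then hit A n (step z u) else 0).
  apply: nnm_if => //.
  by apply: nnm_step => //; exact: (nnm_hit mA).
have nI : nnm (fun u => ind (u \notin A) : \bar R).
  by apply: nnm_ind; exact: measurable_neg.
apply: (@le_trans _ _ (\int[mu]_u ((if u \in A then hit A n (step z u) else 0) +
    (n%:R%:E * mu (~` A) + ind (u \notin A))))).
  apply: le_ge0_integral => u _; first exact: hit_ge0.
  have m0 : 0 <= n%:R%:E * mu (~` A) by rewrite mule_ge0// lee_fin.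
  case: ifPn => uA; first by rewrite /ind adde0; exact: ih.
  by rewrite add0e (le_trans (hit_le1 measurableT _ _))// /ind leeDr.
rewrite ge0_integralD//; last 4 first.
- by move=> u _; exact: nP.2.
- exact: nP.1.
- by move=> u _; rewrite adde_ge0 ?ind_ge0// mule_ge0// lee_fin.
- by apply: emeasurable_funD => //; exact: nI.1.
apply: leeD.
  rewrite [leRHS]integral_mkcond; apply: le_ge0_integral => u _; first exact: nP.2.
  by rewrite patchE.
rewrite ge0_integralD//; last 3 first.
- by move=> u _; rewrite mule_ge0// lee_fin.
- by move=> u _; exact: ind_ge0.
- exact: nI.1.
rewrite integral_cst// [X in _ * X + _]probability_setT mule1.
have -> : \int[mu]_u ind (u \notin A) = mu (~` A).
  rewrite -[in RHS](setIT (~` A)) -integral_indic//; last exact: measurableC.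
  by apply: eq_integral => u _; rewrite indicE in_setC.
by rewrite -natr1 EFinD ge0_muleDl ?lee_fin// mul1e.
Qed.



End Walk.

(** * Time spent in a window, and weight of the paths that descend to it *)

Section Estimates.
Context {R : realType} {dE dG : measure_display}.
Context {E : measurableType dE} {G : measurableType dG}.
Variable mu : probability G R.
Variables (a : E * G -> E) (c : E * G -> R).
Hypothesis (ma : measurable_fun setT a) (mc : measurable_fun setT c).
Variable l : G -> R.
Hypotheses (ml : measurable_fun setT l) (l0 : forall u, (0 <= l u)%R).
Hypothesis cl : forall x u, (`|c (x, u)| <= l u)%R.
Local Open Scope ereal_scope.
Local Notation Z := (E * R)%type.
Local Notation step := (step a c).
Local Notation Q := (Q mu a c).
Local Notation Qp := (Qp mu a c).
Local Notation H := (H mu a c).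
Local Notation hit := (hit mu a c).
Implicit Types (f h : Z -> \bar R) (z : Z) (x : E) (n : nat).

Let neg : Z -> \bar R := fun z => ind (z.2 < 0)%R.

Let nnm_neg : nnm neg.
Proof. by apply: nnm_ind; exact: measurable_fun_ltr. Qed.

Lemma Qp_sum (I : Type) (r : seq I) (F : I -> Z -> \bar R) z :
  (forall i, nnm (F i)) ->
  Qp (fun z => \sum_(i <- r) F i z) z = \sum_(i <- r) Qp (F i) z.
Proof.
move=> nF; elim: r => [|i r ih].
  rewrite big_nil (_ : (fun _ => _) = cst 0); last first.
    by apply/funext => ?; rewrite big_nil.
  by rewrite /Qp Q_cst//; case: ifP.
rewrite big_cons -ih -Qp_add//; last exact: nnm_sum.
by congr (Qp _ z); apply/funext => ?; rewrite big_cons.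
Qed.

Lemma iter_sum n (I : Type) (r : seq I) (F : I -> Z -> \bar R) z :
  (forall i, nnm (F i)) ->
  iter n Qp (fun z => \sum_(i <- r) F i z) z = \sum_(i <- r) iter n Qp (F i) z.
Proof.
move=> nF; elim: n z => //= n ih z.
have -> : iter n Qp (fun z => \sum_(i <- r) F i z) =
    (fun z => \sum_(i <- r) iter n Qp (F i) z) by apply/funext => ?; exact: ih.
by rewrite Qp_sum// => i; exact: nnm_iter.
Qed.

(* Decomposition of the hitting probability according to the hitting time *)
Lemma hitE n z : hit setT n z = \sum_(0 <= j < n.+1) iter j Qp neg z.
Proof.
elim: n z => [|n ih] z.
  by rewrite big_nat1 /= /neg /ind; case: (z.2 < 0)%R.
rewrite big_nat_recl//=.
under eq_bigr do rewrite -/(iter _.+1 Qp neg z) iterS.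
rewrite -Qp_sum; last by move=> i; exact: nnm_iter.
rewrite -(_ : hit setT n = (fun z => \sum_(0 <= i < n.+1) iter i Qp neg z)); last first.
  by apply/funext.
rewrite /Qp /neg /ind ltNge.
by case: (0 <= z.2)%R; rewrite /= ?add0e ?adde0.
Qed.

(* Each visit of the window is followed by an exit with probability at least q *)
Lemma green_le (S q : R) m N z : (0 <= S)%R -> (0 <= q)%R ->
  (forall y, q%:E <= hit setT m (y, S + 1)%R) ->
  q%:E * \sum_(0 <= k < N) iter k Qp (win S) z <= m%:R%:E.
Proof.
move=> S0 q0 hq.
pose D z := \sum_(1 <= j < m.+1) iter j Qp neg z.
have nD : nnm D by apply: nnm_sum => j; exact: nnm_iter.
have qw y : q%:E * win S y <= D y.
  rewrite /win; case: (boolP (_ && _)) => [/andP[Sy yS]|_]; last first.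
    by rewrite mule0; exact: nD.2.
  rewrite mule1; apply: (le_trans (hq y.1)).
  apply: (@le_trans _ _ (hit setT m y)).
    by case: y Sy yS => y1 y2 /= _ yS; apply: hit_antitone => //; exact: ltW.
  rewrite hitE big_ltn//= /neg /ind ltNge (le_trans S0 Sy)/= add0e.
  exact: lexx.
have i0 j y : 0 <= iter j Qp neg y by apply: iter_ge0; exact: nnm_neg.2.
rewrite ge0_sume_distrr; last by move=> k _; apply: iter_ge0; exact: (nnm_win S).2.
apply: (@le_trans _ _ (\sum_(0 <= k < N) \sum_(1 <= j < m.+1) iter (k + j) Qp neg z)).
  apply: lee_sum => k _; rewrite -iter_scale//; last exact: nnm_win.
  apply: (@le_trans _ _ (iter k Qp D z)).
    by apply: le_iter => // y; rewrite mule_ge0 ?lee_fin//; exact: (nnm_win S).2.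
  rewrite iter_sum//; last by move=> j; exact: nnm_iter.
  by apply: lee_sum => j _; rewrite iterD.
rewrite exchange_big/=.
apply: (@le_trans _ _ (\sum_(1 <= j < m.+1) (1 : \bar R))); last first.
  by rewrite sumEFin sumr_const_nat subSS subn0.
apply: lee_sum => j _.
apply: le_trans (hit_le1 mu a c measurableT (N + j) z).
rewrite hitE [leRHS](@big_cat_nat _ _ _ j)//=; last by rewrite ltnW ?ltnS ?leq_addl.
rewrite [X in _ <= (_ + X)%R]big_nat_recr ?leq_addl//= addeA; apply: lee_paddr; first exact: i0.
apply: lee_paddl; first by apply: sume_ge0 => i _; exact: i0.
by rewrite -{2}(add0n j) big_addn addnK.
Qed.

(** r is the descent still to be made, initially L. A step moves the level t and r by the same
    amount, so t + L - r keeps recording the level at the start. *)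
Definition weight (S L r t : R) : R :=
  (if r + S + 1 <= t then Num.max (t + L - r) 0 else 0)%R.

Lemma nnm_weight (S L r : R) : (0 <= L)%R -> nnm (fun t : R =>
  (weight S L r t)%:E).
Proof.
move=> L0; apply: nnm_EFin.
  apply: measurable_fun_ifT => //; first exact: measurable_fun_ler.
  by apply: measurable_maxr => //; apply: measurable_funB => //; exact: measurable_funD.
by move=> t; rewrite /weight; case: ifP => // _; rewrite le_max lexx orbT.
Qed.

(* Mass, weighted by the starting level t + L - r, of the paths from level t
   which end in the window and have to descend by r before *)
Definition descent (S L : R) n y (r : R) := \int[lebesgue_measure]_t
  ((weight S L r t)%:E *
   iter n Qp (win S) (y, t)).

(** The killing is dropped and the Lebesgue integral translated by the increment, which turns r into
    r + c and leaves the weight unchanged. *)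
Lemma descent_succ (S L : R) n y r : (0 <= L)%R ->
  descent S L n.+1 y r <= \int[mu]_u descent S L n (a (y, u)) (r + c (y, u)).
Proof.
move=> L0; have [mw w0] := nnm_weight S r L0.
have ng := nnm_iter mu ma mc n (nnm_win S).
set g := iter n Qp (win S) in ng *.
apply: (@le_trans _ _ (\int[lebesgue_measure]_t
  ((weight S L r t)%:E * Q g (y, t)))).
  apply: le_ge0_integral => t _.
    by apply: mule_ge0; [exact: w0|apply: iter_ge0; exact: (nnm_win S).2].
  rewrite iterS; apply: lee_wpmul2l; first exact: w0.
  by rewrite /Qp; case: ifPn => // _; apply: Q_ge0; exact: ng.2.
have mW : measurable_fun setT (weight S L r) by exact/measurable_EFinP.
rewrite (@integral_Q _ _ _ _ _ mu _ _ ma mc _ _ y mW w0 ng).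
apply: le_ge0_integral => u _.
  by apply: integral_ge0 => t _; apply: mule_ge0; [exact: (w0 (t - c (y, u))%R)|exact: ng.2].
rewrite /descent le_eqVlt; apply/orP; left; apply/eqP; apply: eq_integral => t _.
congr ((_ : R)%:E * _); rewrite /weight.
have -> : (r + S + 1 <= t - c (y, u))%R = (r + c (y, u) + S + 1 <= t)%R.
  by apply/idP/idP; lra.
by case: ifP => // _; congr (Num.max _ _); ring.
Qed.

(* On levels below the window, the weight is dominated by the starting level *)
Lemma descent_le_H (S L : R) n y r (C : \bar R) : (0 <= L)%R ->
  H n (win S) y <= C -> descent S L n y r <= C + (Num.max (L - r) 0)%:E.
Proof.
move=> L0 HC.
have ng := nnm_iter mu ma mc n (nnm_win S).
set g := iter n Qp (win S) in ng *.
have [mh h0] := nnm_section y ng.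
have [mk k0] := nnm_mul (nnm_max0 (R := R)) (conj mh h0).
have w0 (t : R) : (0 <= Num.max t 0)%R by rewrite le_max lexx orbT.
have [_ wd0] := nnm_weight S r L0.
apply: (@le_trans _ _ (\int[lebesgue_measure]_t
   ((Num.max t 0)%:E * g (y, t) + (Num.max (L - r) 0)%:E * g (y, t)))).
  apply: le_ge0_integral => t _; first by apply: mule_ge0; [exact: wd0|exact: ng.2].
  rewrite -ge0_muleDl ?lee_fin//; apply: lee_wpmul2r; first exact: ng.2.
  rewrite lee_fin /weight; case: ifP => _; last exact: addr_ge0.
  rewrite ge_max addr_ge0// andbT -addrA lerD// le_max lexx//.
rewrite ge0_integralD//; last 2 first.
- by move=> t _; rewrite mule_ge0// lee_fin.
- by apply: emeasurable_funM.
apply: leeD => //; rewrite ge0_integralZl// ?lee_fin//.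
rewrite -[leRHS]mule1; apply: lee_pmul => //; rewrite ?lee_fin//.
  exact: integral_ge0.
exact: integral_iter_win.
Qed.

(* Bounds the mean overshoot of one downward step *)
Definition excess (B : R) := \int[mu]_u ((l u)%:E * ind (B < l u)%R).

Lemma nnm_excess (B : R) : nnm (fun u => (l u)%:E * ind (B < l u)%R).
Proof.
apply: nnm_mul; first exact: nnm_EFin.
by apply: nnm_ind; exact: measurable_fun_ltr.
Qed.

(** Optional stopping when the remaining descent r first becomes negative. There [descent_le_H]
    bounds the weight by C + L plus the overshoot. The overshoot is at most [l u] and is split at B:
    the bounded part is charged to the hitting probability, the rest to [excess B], once per
    step. *)
Lemma descent_le_hit (S L B C : R) n y r :
  (0 <= L)%R -> (0 <= B)%R -> (0 <= C)%R -> (0 <= r)%R ->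
  (forall j x, (j <= n)%N -> H j (win S) x <= C%:E) ->
  descent S L n y r <= (C + L + B)%:E * hit setT n (y, r) + n%:R%:E * excess B.
Proof.
move=> L0 B0 C0; have K0 : (0 <= C + L + B)%R by rewrite !addr_ge0.
have e0 : 0 <= excess B by apply: integral_ge0 => u _; exact: (nnm_excess B).2.
elim: n y r => [|n ih] y r r0 HC.
  rewrite [leLHS](_ : _ = 0) ?adde_ge0 ?mule_ge0 ?lee_fin ?hit_ge0//.
  (* With r >= 0 and no step left, the weight requires t >= r + S + 1, which lies above the
     window. *)
  apply: integral0_eq => t _; rewrite /win/= /weight; case: ifPn => [tr|]; last by rewrite mul0e.
  rewrite (_ : (t < S + 1)%R = false) ?andbF ?mule0//.
  by apply/negbTE; rewrite -leNgt; apply: le_trans tr; rewrite -addrA lerDr.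
apply: (le_trans (descent_succ S n y r L0)).
have nh := nnm_hit mu ma mc measurableT n.
have nhs : nnm (fun u => hit setT n (step (y, r) u)) by exact: nnm_step.
apply: (@le_trans _ _ (\int[mu]_u ((C + L + B)%:E * hit setT n (step (y, r) u) +
   (n%:R%:E * excess B + (l u)%:E * ind (B < l u)%R)))).
  apply: le_ge0_integral => u _.
    apply: integral_ge0 => t _; apply: mule_ge0; first exact: (nnm_weight S _ L0).2.
    by apply: iter_ge0; exact: (nnm_win S).2.
  have [rc|rc] := ltP (r + c (y, u))%R 0%R; last first.
    apply: (le_trans (ih _ _ rc _)); first by move=> j x jn; apply: HC; exact: leqW.
    by rewrite leeD2l// leeDl//; exact: (nnm_excess B).2.
  have h1 := descent_le_H (r + c (y, u)) L0 (HC n (a (y, u)) (leqnSn n)).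
  apply: (le_trans h1).
  rewrite hit_neg//= mule1 addeA.
  have lc : (- c (y, u) <= l u)%R.
    by have := cl y u; rewrite ler_norml lerNl => /andP[].
  have m1 : (Num.max (L - (r + c (y, u))) 0 <= L + l u)%R.
    by rewrite ge_max addr_ge0// andbT; lra.
  apply: (@le_trans _ _ ((C + (L + l u))%:E)); first by rewrite EFinD leeD2l// lee_fin.
  apply: (@le_trans _ _ ((C + L + B)%:E + (l u)%:E * ind (B < l u)%R)); last first.
    by rewrite leeD2r// leeDl// mule_ge0// lee_fin.
  rewrite /ind; case: ltP => Bl; rewrite ?mule1 ?mule0 ?adde0 -?EFinD lee_fin; lra.
rewrite ge0_integralD//; last 4 first.
- by move=> u _; apply: mule_ge0; [rewrite lee_fin|exact: nhs.2].
- by apply: emeasurable_funM => //; exact: nhs.1.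
- by move=> u _; rewrite adde_ge0 ?mule_ge0 ?lee_fin ?ind_ge0.
- by apply: emeasurable_funD => //; exact: (nnm_excess B).1.
rewrite ge0_integralZl//; last 2 first.
- exact: nhs.1.
- by move=> u _; exact: nhs.2.
rewrite ge0_integralD//; last 3 first.
- by move=> u _; rewrite mule_ge0// lee_fin.
- by move=> u _; exact: (nnm_excess B).2.
- exact: (nnm_excess B).1.
rewrite integral_cst// [X in _ + (_ * X + _)]probability_setT mule1 -/(excess B).
by rewrite hit_pos// leeD2l// -natr1 EFinD ge0_muleDl ?lee_fin// mul1e.
Qed.

(** The cut is at the starting level L + S + 1: below it the weight is at most this level, above it
    max t 0 is [weight S L L t]. *)
Lemma H_win_split (S L : R) n y : (0 <= L)%R -> (0 <= S)%R -> H n (win S) y <=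
  (L + S + 1)%:E * \int[lebesgue_measure]_t
    (ind ((0 <= t)%R && (t < L + S + 1)%R) * iter n Qp (win S) (y, t)) +
  descent S L n y L.
Proof.
move=> L0 S0.
have [mi i0] : nnm (fun t : R => ind ((0 <= t)%R && (t < L + S + 1)%R) *
    iter n Qp (win S) (y, t)).
  apply: nnm_mul; first by apply: nnm_ind; exact: measurable_window.
  by apply: nnm_iter_section => //; exact: nnm_win.
have nw := nnm_weight S L L0.
have ni : nnm (fun t : R => iter n Qp (win S) (y, t)).
  by apply: nnm_iter_section => //; exact: nnm_win.
have [md d0] := nnm_mul nw ni.
rewrite -ge0_integralZl//; last by rewrite lee_fin !addr_ge0.
rewrite -ge0_integralD//; last 2 first.
- by move=> t _; rewrite mule_ge0// lee_fin !addr_ge0.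
- by apply: emeasurable_funM.
apply: le_ge0_integral => t _.
  by apply: mule_ge0; [exact: (nnm_max0 (R := R)).2|exact: ni.2].
rewrite muleA -ge0_muleDl; last 2 first.
- by rewrite mule_ge0 ?ind_ge0// lee_fin !addr_ge0.
- exact: nw.2.
apply: lee_wpmul2r; first exact: ni.2.
rewrite /ind -EFinM -EFinD lee_fin /weight addrK.
have [t0|t0] := leP 0%R t; last first.
  by rewrite mulr0 add0r; case: ifP => _; rewrite ?le_max ?lexx// ge_max lexx ltW.
by case: leP => tL /=; rewrite ?mulr1 ?mulr0 ?addr0 ?add0r//; exact: ltW.
Qed.

End Estimates.

(** * Growth of the occupation measures *)

Lemma natr_geometric_le (R : realFieldType) (r : R) (n : nat) : 0 < r < 1 ->
  n%:R * r ^+ n <= (1 - r)^-1.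
Proof.
move=> /andP[r0 r1]; rewrite -[leRHS]mul1r ler_pdivlMr ?subr_gt0//.
(* This form is fit for induction: it says that n r^n is at most the geometric sum of the first n
   powers. *)
suff : n%:R * r ^+ n * (1 - r) <= 1 - r ^+ n.
  by move=> h; apply: (le_trans h); rewrite gerBl exprn_ge0// ltW.
elim: n => [|n ih]; first by rewrite !mul0r expr0 subrr.
have p0 : 0 <= r ^+ n by rewrite exprn_ge0// ltW.
have p1 : r ^+ n <= 1 by rewrite exprn_ile1// ltW.
rewrite -natr1 exprS; move: (r ^+ n) (n%:R) ih p0 p1 => e k ih p0 p1.
have h1 := ler_wpM2l (ltW r0) ih.
have re1 : r * e <= 1 by apply: mulr_ile1 => //; exact: ltW.
have h2 : 0 <= (1 - r) * (1 - r * e) by rewrite mulr_ge0// subr_ge0// ltW.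
lra.
Qed.

Section Tail.
Context {R : realType} {dE dG : measure_display}.
Context {E : measurableType dE} {G : measurableType dG}.
Variable mu : probability G R.
Variables (a : E * G -> E) (c : E * G -> R).
Hypothesis (ma : measurable_fun setT a) (mc : measurable_fun setT c).
Variable l : G -> R.
Hypotheses (ml : measurable_fun setT l) (l0 : forall u, (0 <= l u)%R).
Hypothesis cl : forall x u, (`|c (x, u)| <= l u)%R.
Variable K : R.
Hypothesis K0 : 0 <= K.
Hypothesis Kexc : forall B : R, (0 < B)%R -> (excess mu l B <= (K / B ^+ 3)%:E)%E.
Local Open Scope ereal_scope.
Local Notation Z := (E * R)%type.
Local Notation step := (step a c).
Local Notation Q := (Q mu a c).
Local Notation Qp := (Qp mu a c).
Local Notation H := (H mu a c).
Local Notation hit := (hit mu a c).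
Implicit Types (f h : Z -> \bar R) (z : Z) (x : E) (n : nat).

Lemma mean_l_le : \int[mu]_u (l u)%:E <= (1 + K)%:E.
Proof.
have [me e0] := nnm_excess ml l0 1%R.
apply: (@le_trans _ _ (\int[mu]_u (1 + (l u)%:E * ind (1 < l u)%R))).
  apply: le_ge0_integral => u _; first by rewrite lee_fin.
  rewrite /ind; case: ltP => h; last by rewrite mule0 adde0 lee_fin.
  by rewrite mule1 leeDr.
rewrite ge0_integralD// integral_cst// [X in _ * X + _]probability_setT mule1.
rewrite EFinD leeD2l//; apply: le_trans (Kexc ltr01) _.
by rewrite expr1n divr1.
Qed.

Lemma tail_l_le (B : R) : (1 <= B)%R -> mu (~` [set u | (l u <= B)%R]) <= (K / B)%:E.
Proof.
move=> B1; have B0 : (0 < B)%R by exact: lt_le_trans B1.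
apply: (@le_trans _ _ (excess mu l B)).
  have mA : measurable [set u | (l u <= B)%R].
    by apply: measurable_boolset; exact: measurable_fun_ler.
  rewrite -(setIT (~` _)) -integral_indic//; last exact: measurableC.
  apply: le_ge0_integral => u _; first by rewrite lee_fin.
  rewrite indicE in_setC.
  have -> : (u \in [set u | (l u <= B)%R]) = (l u <= B)%R by apply/idP/idP; rewrite inE.
  rewrite /ind -ltNge -EFinM lee_fin; case: ltP => h; rewrite ?mulr1 ?mulr0//.
  exact: le_trans B1 (ltW h).
apply: (le_trans (Kexc B0)); rewrite lee_fin ler_wpM2l// lef_pV2 ?posrE ?exprn_gt0//.
by rewrite -[leLHS]expr1 ler_weXn2l.
Qed.

Lemma H_win_le_linear (S : R) n x : (0 <= S)%R ->
  H n (win S) x <= (S + 1 + n%:R * (1 + K))%:E.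
Proof.
move=> S0; apply: (le_trans (H_win_le mu ma mc ml l0 cl n S x)).
rewrite max_l ?addr_ge0// [leRHS]EFinD leeD2l// EFinM lee_wpmul2l ?lee_fin//.
exact: mean_l_le.
Qed.

(** The Green bound integrated over starting levels in [0, L[. As it does not depend on N, some time
    in a long interval receives little mass from these levels. *)
Lemma integral_sum_window (S L q : R) m N y : (0 <= S)%R -> (0 <= L)%R -> (0 <= q)%R ->
  (forall y, q%:E <= hit setT m (y, S + 1)%R) ->
  q%:E * \sum_(0 <= k < N) \int[lebesgue_measure]_t
    (ind ((0 <= t)%R && (t < L)%R) * iter k Qp (win S) (y, t)) <= (m%:R * L)%:E.
Proof.
move=> S0 L0 q0 hq.
have nF k : nnm (fun t : R => ind ((0 <= t)%R && (t < L)%R) * iter k Qp (win S) (y, t)).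
  apply: nnm_mul; first by apply: nnm_ind; exact: measurable_window.
  by apply: nnm_iter_section => //; exact: nnm_win.
have nG : nnm (fun t : R => \sum_(0 <= k < N)
   (ind ((0 <= t)%R && (t < L)%R) * iter k Qp (win S) (y, t))) by exact: nnm_sum.
rewrite -ge0_integral_sum//; last 2 first.
- by move=> k; exact: (nF k).1.
- by move=> k t _; exact: (nF k).2.
rewrite -ge0_integralZl//; last 2 first.
- exact: nG.1.
- by move=> t _; exact: nG.2.
apply: (@le_trans _ _ (\int[lebesgue_measure]_t (m%:R%:E * ind ((0 <= t)%R && (t < L)%R)))).
  apply: le_ge0_integral => t _; first by rewrite mule_ge0 ?lee_fin//; exact: nG.2.
  rewrite -ge0_sume_distrr; last first.
    by move=> k _; apply: iter_ge0; exact: (nnm_win S).2.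
  rewrite muleCA muleC; apply: lee_wpmul2r; first exact: ind_ge0.
  exact: green_le.
have [mi i0] : nnm (fun t : R => ind ((0 <= t)%R && (t < L)%R) : \bar R).
  by apply: nnm_ind; exact: measurable_window.
by rewrite ge0_integralZl ?lee_fin// integral_window// subr0 EFinM.
Qed.

(** The mass c0 in the window at a well chosen time n splits into at most c0 / 4 from starting
    levels below L + T + 1, at most c0 / 4 from large overshoots, and the remainder, which is
    bounded by the probability of descending by L. The factor C + 2 L is C + L + B of
    [descent_le_hit] with B = L. *)
Lemma hit_lower (T L q c0 C : R) (m n0 N : nat) y :
  (0 <= T)%R -> (0 < L)%R -> (0 < q)%R -> (0 < c0)%R -> (0 <= C)%R ->
  (forall y, q%:E <= hit setT m (y, T + 1)%R) ->
  (forall n x, H n (win T) x <= C%:E) ->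
  (forall n x, (n0 <= n)%N -> c0%:E <= H n (win T) x) ->
  (4 * (L + T + 1) ^+ 2 * m%:R / (q * c0) < N%:R)%R ->
  ((n0 + N)%:R * (K / L ^+ 3) <= c0 / 4)%R ->
  (c0 / 2)%:E <= (C + 2 * L)%:E * hit setT (n0 + N) (y, L).
Proof.
move=> T0 L0 q0 c00 C0 hq HC Hc hN hK.
set M : R := (L + T + 1)%R in hN *.
have M0 : (0 < M)%R by rewrite /M; lra.
pose I k := \int[lebesgue_measure]_t
    (ind ((0 <= t)%R && (t < M)%R) * iter k Qp (win T) (y, t)).
have I0 k : 0 <= I k.
  apply: integral_ge0 => t _; rewrite mule_ge0 ?ind_ge0//.
  by apply: iter_ge0; exact: (nnm_win T).2.
(* Pigeonhole: if every n in [n0, n0 + N[ failed, the sum of the [I n] would exceed the Green bound,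
   by the choice of N in [hN]. *)
have [n /andP[n1 n2] In] : exists2 n, (n0 <= n < n0 + N)%N & I n <= (c0 / (4 * M))%:E.
  apply: contrapT => /forall2NP hI.
  have : q%:E * \sum_(n0 <= k < n0 + N) (c0 / (4 * M))%:E <= (m%:R * M)%:E.
    apply: le_trans (integral_sum_window (n0 + N) y T0 (ltW M0) (ltW q0) hq).
    apply: lee_wpmul2l; first by rewrite lee_fin ltW.
    rewrite [leRHS](@big_cat_nat _ _ _ n0)//= ?leq_addr//.
    apply: lee_paddl; first by apply: sume_ge0 => k _; exact: I0.
    rewrite big_nat_cond [leRHS]big_nat_cond; apply: lee_sum => k /andP[kn _].
    have [//|/negP] := hI k; rewrite -ltNge => h; exact: ltW.
  rewrite sumEFin sumr_const_nat addKn -EFinM lee_fin leNgt => /negP; apply.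
  rewrite -mulr_natr (_ : (q * _ = q * c0 * N%:R / (4 * M))%R); last by field; rewrite gt_eqF.
  move: hN; rewrite ltr_pdivrMr ?mulr_gt0// ltr_pdivlMr ?mulr_gt0//; lra.
have LB0 : (0 <= C + L + L)%R by lra.
apply: (@le_trans _ _ ((C + 2 * L)%:E * hit setT n (y, L))); last first.
  apply: lee_wpmul2l; first by rewrite lee_fin; lra.
  by apply: hit_le => //; exact: ltnW.
have := Hc n y n1.
have h1 := H_win_split mu ma mc n y (ltW L0) T0.
have h2 := descent_le_hit (S := T) ma mc ml l0 cl y (ltW L0) (ltW L0) C0 (ltW L0)
  (fun j x (_ : (j <= n)%N) => HC j x).
move=> /le_trans/(_ h1)/le_trans => h.
have {}h := h _ (leeD (lexx _) h2).
have e1 : M%:E * I n <= (c0 / 4)%:E.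
  apply: (@le_trans _ _ (M%:E * (c0 / (4 * M))%:E)).
    by apply: lee_wpmul2l In; rewrite lee_fin ltW.
  rewrite -EFinM lee_fin le_eqVlt; apply/orP; left; apply/eqP; field.
  by rewrite gt_eqF.
have e2 : n%:R%:E * excess mu l L <= (c0 / 4)%:E.
  apply: (@le_trans _ _ (n%:R%:E * (K / L ^+ 3)%:E)).
    by apply: lee_wpmul2l (Kexc L0); rewrite lee_fin.
  rewrite -EFinM lee_fin; apply: le_trans hK; apply: ler_wpM2r.
    by rewrite divr_ge0// exprn_ge0// ltW.
  by rewrite ler_nat ltnW.
have : c0%:E <= (c0 / 4)%:E + ((C + L + L)%:E * hit setT n (y, L) + (c0 / 4)%:E).
  by apply: (le_trans h); apply: leeD e1 (leeD (lexx _) e2).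
have : hit setT n (y, L) \is a fin_num.
  rewrite ge0_fin_numE ?hit_ge0//; apply: le_lt_trans (hit_le1 mu a c measurableT n _) _.
  exact: ltry.
move/fineK => <-; rewrite -!EFinM -!EFinD !lee_fin; lra.
Qed.

(* The powers r^(2L) beat the polynomial loss in L of the hitting estimate *)
Lemma hit_lower_uniform (T q c0 C r : R) (m n0 : nat) :
  (0 <= T)%R -> (0 < q)%R -> (0 < c0)%R -> (0 <= C)%R -> (0 < r < 1)%R ->
  (forall y, q%:E <= hit setT m (y, T + 1)%R) ->
  (forall n x, H n (win T) x <= C%:E) ->
  (forall n x, (n0 <= n)%N -> c0%:E <= H n (win T) x) ->
  exists L N : nat, (0 < L)%N /\
    forall y, (2 * (r ^+ 2) ^+ L)%:E <= hit setT N (y, L%:R).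
Proof.
move=> T0 q0 c00 C0 r01 hq HC Hc; have /andP[r0 r1] := r01.
pose A : R := (4 * (T + 2) ^+ 2 * m%:R / (q * c0))%R.
have A0 : (0 <= A)%R by rewrite divr_ge0 ?mulr_ge0 ?exprn_ge0 ?(ltW q0) ?(ltW c00)//; lra.
pose D : R := ((1 - r)^-1)%R.
have D0 : (0 < D)%R by rewrite invr_gt0 subr_gt0.
(* L >= X1 makes the total overshoot error at most c0 / 4, and L >= X2 makes 2 r^(2L) at most c0 /
   (2 (C + 2) L). *)
pose X1 : R := (4 * (n0%:R + 1 + A) * K / c0)%R.
pose X2 : R := (4 * (C + 2) * D ^+ 2 / c0)%R.
have X10 : (0 <= X1)%R by rewrite divr_ge0 ?mulr_ge0 ?(ltW c00)//; rewrite !addr_ge0.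
have X20 : (0 <= X2)%R by rewrite divr_ge0 ?mulr_ge0 ?exprn_ge0 ?(ltW c00) ?(ltW D0)//; lra.
pose L := (Num.truncn (X1 + X2)).+1.
have hL : (X1 + X2 < L%:R)%R by exact: truncnS_gt.
have L1 : (1 <= L%:R :> R)%R by rewrite ler1n.
have LR0 : (0 < L%:R :> R)%R by lra.
pose M : R := (4 * (L%:R + T + 1) ^+ 2 * m%:R / (q * c0))%R.
have M0 : (0 <= M)%R by rewrite divr_ge0 ?mulr_ge0 ?exprn_ge0 ?(ltW q0) ?(ltW c00)//; lra.
pose N := (Num.truncn M).+1.
have hN : (M < N%:R)%R by exact: truncnS_gt.
have hN1 : (N%:R <= M + 1)%R.
  by rewrite /N -natr1 lerD2r; move: (truncn_itv M0) => /andP[].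
exists L, (n0 + N)%N; split => // y.
have MA : (M <= A * L%:R ^+ 2)%R.
  rewrite /M /A ler_pdivrMr ?mulr_gt0//.
  rewrite (_ : (_ * _ * (q * c0) = 4 * ((T + 2) * L%:R) ^+ 2 * m%:R)%R); last first.
    by field; rewrite !gt_eqF.
  have hx : (0 <= L%:R + T + 1)%R by lra.
  have hy : (0 <= (T + 2) * L%:R)%R by rewrite mulr_ge0//; lra.
  have hxy : (L%:R + T + 1 <= (T + 2) * L%:R)%R by nra.
  by rewrite ler_wpM2r// ler_wpM2l// lerXn2r.
(* N is of order L^2 and the excess beyond L at most K / L^3, so the error is of order 1 / L. This
   is where the exponent 3 in [Kexc] comes from. *)
have hK : ((n0 + N)%:R * (K / L%:R ^+ 3) <= c0 / 4)%R.
  apply: (@le_trans _ _ ((n0%:R + 1 + A) * L%:R ^+ 2 * (K / L%:R ^+ 3))%R).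
    apply: ler_wpM2r; first by rewrite divr_ge0// exprn_ge0// ltW.
    rewrite natrD; have : (1 <= L%:R ^+ 2 :> R)%R by rewrite exprn_ege1.
    have : (0 <= n0%:R :> R)%R by [].
    move: (L%:R ^+ 2)%R MA => e; nra.
  rewrite (_ : (_ * _ = (n0%:R + 1 + A) * K / L%:R)%R); last first.
    by field; rewrite gt_eqF.
  rewrite ler_pdivrMr//.
  have : (X1 <= L%:R)%R by lra.
  rewrite /X1 ler_pdivrMr//; lra.
have h := @hit_lower T _ _ _ _ _ _ _ y T0 LR0 q0 c00 C0 hq HC Hc hN hK.
have hf : hit setT (n0 + N) (y, L%:R) \is a fin_num.
  rewrite ge0_fin_numE ?hit_ge0//; apply: le_lt_trans (hit_le1 mu a c measurableT _ _) _.
  exact: ltry.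
move: h; rewrite -(fineK hf) -EFinM !lee_fin; set w := fine _ => h.
have rL : (L%:R * r ^+ L <= D)%R by exact: natr_geometric_le.
have e0 : (0 <= r ^+ L)%R by rewrite exprn_ge0// ltW.
have h2 : (X2 <= L%:R)%R by lra.
have CL : (C + 2 * L%:R <= (C + 2) * L%:R)%R by nra.
have w0 : (0 <= w)%R by exact/fine_ge0/hit_ge0.
have h3 : (c0 / 2 <= (C + 2) * L%:R * w)%R by apply: (le_trans h); exact: ler_wpM2r.
rewrite exprAC.
have h4 : ((L%:R * r ^+ L) ^+ 2 <= D ^+ 2)%R.
  by rewrite lerXn2r ?nnegrE ?mulr_ge0// ltW.
have h5 : (4 * (C + 2) * (L%:R * r ^+ L) ^+ 2 <= c0 * L%:R)%R.
  move: h2; rewrite /X2 ler_pdivrMr// => h2.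
  rewrite (mulrC c0).
  apply: le_trans (_ : (4 * (C + 2) * D ^+ 2 <= _)%R); first by apply: ler_wpM2l => //; lra.
  exact: h2.
have C2 : (0 < (C + 2) * L%:R)%R by apply: mulr_gt0 => //; lra.
rewrite -(ler_pM2l C2) -(ler_pM2l LR0).
apply: (@le_trans _ _ (L%:R * (c0 / 2))%R); last by rewrite ler_pM2l.
move: h5; rewrite exprMn; move: (r ^+ L ^+ 2)%R => e; lra.
Qed.

(** With steps bounded by B the first negative level lies in [-B, 0[, a bounded target on which [H]
    can be controlled. *)
Lemma hit_le_sum (B : R) n z : (0 <= B)%R -> (- B <= z.2)%R ->
  hit [set u | (l u <= B)%R] n z <=
  \sum_(0 <= k < n.+1) iter k Qp (fun z => ind ((- B <= z.2)%R && (z.2 < 0)%R)) z.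
Proof.
move=> B0; set h := fun z : Z => _.
have nh : nnm h.
  apply: nnm_ind; apply: (measurableT_comp (measurable_window (- B) 0%R)).
  exact: measurable_snd.
elim: n z => [|n ih] z zB.
  by rewrite big_nat1 /= /h zB/=; case: ifP => // _; rewrite /ind.
rewrite big_nat_recl//=.
under eq_bigr do rewrite -/(iter _.+1 Qp h z) iterS.
rewrite -(Qp_sum mu ma mc); last by move=> i; exact: nnm_iter.
have [z0|z0] := ltP z.2 0%R.
  have -> : h z = 1 by rewrite /h zB z0.
  rewrite leeDl//; apply: Qp_ge0 => y.
  by apply: sume_ge0 => k _; apply: iter_ge0; exact: nh.2.
have -> : h z = 0 by rewrite /h zB ltNge z0.
rewrite add0e /Qp z0.
rewrite integral_mkcond; apply: le_ge0_integral => u _.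
  by rewrite patchE; case: ifP => // _; exact: hit_ge0.
rewrite patchE; case: ifPn => [/set_mem/= lB|_]; last first.
  by apply: sume_ge0 => k _; apply: iter_ge0; exact: nh.2.
apply: ih => /=; have := cl z.1 u; rewrite ler_norml => /andP[]; lra.
Qed.

(** The target is covered by B unit windows, each of which is raised to [win 0] by translation
    monotonicity. *)
Lemma H_below_le (B : nat) (C0 : R) n x : (forall x, H n (win 0) x <= C0%:E) ->
  H n (fun z => ind ((- B%:R <= z.2)%R && (z.2 < 0)%R)) x <= (B%:R * C0)%:E.
Proof.
move=> HC; have nw (j : nat) : nnm (win (- j.+1%:R)%R : Z -> \bar R) by exact: nnm_win.
apply: (@le_trans _ _ (H n (fun z => \sum_(0 <= j < B) win (- j.+1%:R) z) x)).
  apply: le_H => z; first exact: ind_ge0.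
  rewrite /ind; elim: (B) => [|k ih].
    by rewrite oppr0 big_nil; case: ltP => //=; rewrite ?andbF// leNgt => ->.
  rewrite big_nat_recr//=; have [zk|zk] := leP (- k%:R)%R z.2.
    apply: lee_paddr; first exact: ind_ge0.
    apply: le_trans ih; rewrite zk/= lee_fin ler_nat.
    by case: (_ < _)%R; rewrite ?andbF ?leq_b1.
  apply: lee_paddl; first by apply: sume_ge0 => j _; exact: ind_ge0.
  rewrite /win /ind lee_fin ler_nat -natr1 opprD subrK zk andbT.
  by case: (_ <= _)%R => //=; case: (_ < _)%R.
rewrite H_sum//.
apply: (@le_trans _ _ (\sum_(0 <= j < B) C0%:E)).
  apply: lee_sum => j _; apply: le_trans (HC x).
  have := @le_H_shift _ _ _ _ _ mu _ _ ma mc n j.+1%:R _ x (ler0n _ _) (nw j).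
  by rewrite shift_win addNr.
by rewrite sumEFin sumr_const_nat subn0 mulr_natl.
Qed.

(* Paths in the window [S, S+1) descend below 0 with probability at least of
   order p^S within a time of order S, and at most B below 0. *)
Lemma H_win_growth_of_hit (p C0 : R) (L N B n1 : nat) : (0 < p < 1)%R -> (0 < L)%N ->
  (forall y, (p ^+ L)%:E <= hit [set u | (l u <= B%:R)%R] N (y, L%:R)) ->
  (forall n x, (n1 <= n)%N -> H n (win 0) x <= C0%:E) ->
  exists D : R, (0 <= D)%R /\ forall n x (S : nat), (n1 <= n)%N ->
    H n (win S%:R) x <= (D * S.+1%:R / p ^+ S)%:E.
Proof.
move=> /andP[p0 p1] L0 hp HC.
set A := [set u | _] in hp.
have mA : measurable A by apply: measurable_boolset; exact: measurable_fun_ler.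
set h := fun z : Z => ind ((- B%:R <= z.2)%R && (z.2 < 0)%R) : \bar R.
have nh : nnm h.
  apply: nnm_ind; apply: (measurableT_comp (measurable_window (- B%:R) 0%R)).
  exact: measurable_snd.
have [CB CB0 Hh] : exists2 CB : R, (0 <= CB)%R &
    forall n x, (n1 <= n)%N -> H n h x <= CB%:E.
  exists (B%:R * Num.max C0 0)%R; first by rewrite mulr_ge0// le_max lexx orbT.
  move=> n x nn; apply: H_below_le => y; apply: (le_trans (HC n y nn)).
  by rewrite lee_fin le_max lexx.
exists (N.+1%:R * CB / p ^+ L)%R; split.
  by rewrite !mulr_ge0// invr_ge0 exprn_ge0// ltW.
move=> n x S nn.
(* k + 1 blocks of height L cover the level S + 1, and their total height is at most S + L, hence
   the power p^(S + L) below. *)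
pose k := (S %/ L)%N; pose M := (k.+1 * N)%N.
have SL : (S.+1 <= k.+1 * L)%N by exact: ltn_ceil.
have kL : (k * L <= S)%N by exact: leq_trunc_div.
(* [H n U] is the sum of the [H (n + j) h] for j <= M, each at most CB. The exit probability thus
   bounds the mass of the window by masses at later times. *)
pose U z := \sum_(0 <= j < M.+1) iter j Qp h z.
have U0 z : 0 <= U z by apply: sume_ge0 => j _; apply: iter_ge0; exact: nh.2.
have wU z : (p ^+ (S + L))%:E * win S%:R z <= U z.
  rewrite /win; case: (boolP (_ && _)) => [/andP[Sz zS]|_]; last by rewrite mule0.
  rewrite mule1; apply: (@le_trans _ _ ((p ^+ L) ^+ k.+1)%:E).
    rewrite -exprM lee_fin ler_wiXn2l ?ltW//.
    by rewrite mulnS addnC leq_add2r mulnC.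
  have pL0 : (0 <= p ^+ L)%R by rewrite exprn_ge0// ltW.
  apply: (le_trans (hit_iter ma mc mA k z.1 pL0 (ler0n _ L) hp)).
  - apply: (@le_trans _ _ (hit A M z)).
      case: z Sz zS => z1 z2 /= Sz zS; apply: hit_antitone => //.
      apply: (le_trans (ltW zS)); rewrite -natrM natr1 ler_nat//.
    apply: hit_le_sum => //; apply: le_trans Sz.
    by apply: (@le_trans _ _ 0%R) => //; rewrite oppr_le0.
have HU : H n U x <= (M.+1%:R * CB)%:E.
  rewrite H_sum//; last by move=> j; exact: nnm_iter.
  apply: (@le_trans _ _ (\sum_(0 <= j < M.+1) CB%:E)).
    apply: lee_sum => j _; rewrite -H_addn; apply: Hh.
    by rewrite (leq_trans nn)// leq_addr.
  by rewrite sumEFin sumr_const_nat subn0 mulr_natl.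
have pS0 : (0 < p ^+ (S + L))%R by rewrite exprn_gt0.
have : (p ^+ (S + L))%:E * H n (win S%:R) x <= (M.+1%:R * CB)%:E.
  rewrite -H_scale//; [|by rewrite lee_fin ltW|exact: nnm_win].
  apply: le_trans HU; apply: le_H => // z.
  by rewrite mule_ge0 ?lee_fin ?(ltW pS0)//; exact: (nnm_win _).2.
rewrite muleC -lee_pdivlMr//; move/le_trans; apply.
rewrite lee_fin exprD.
rewrite (_ : (N.+1%:R * CB / p ^+ L * S.+1%:R / p ^+ S =
    (N.+1 * S.+1)%:R * CB / (p ^+ S * p ^+ L))%R); last first.
  by rewrite natrM; field; rewrite !gt_eqF// exprn_gt0.
apply: ler_wpM2r; first by rewrite invr_ge0 mulr_ge0// exprn_ge0// ltW.
apply: ler_wpM2r => //; rewrite ler_nat /M.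
have kS : (k.+1 <= S.+1)%N by rewrite ltnS; exact: leq_div.
rewrite (mulSn N) (mulnC k.+1) addSn ltnS; apply: leq_trans (leq_addl _ _).
by rewrite leq_mul2l kS orbT.
Qed.

Lemma H_win_growth_nondegenerate (T q c0 C C0 r : R) (m n0 n1 : nat) :
  (0 <= T)%R -> (0 < q)%R -> (0 < c0)%R -> (0 <= C)%R -> (0 < r < 1)%R ->
  (forall y, q%:E <= hit setT m (y, T + 1)%R) ->
  (forall n x, H n (win T) x <= C%:E) ->
  (forall n x, (n0 <= n)%N -> c0%:E <= H n (win T) x) ->
  (forall n x, (n1 <= n)%N -> H n (win 0) x <= C0%:E) ->
  exists D : R, (0 <= D)%R /\ forall n x (S : nat), (n1 <= n)%N ->
    H n (win S%:R) x <= (D * S.+1%:R / (r ^+ 2) ^+ S)%:E.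
Proof.
move=> T0 q0 c00 C00 r01 hq HC Hc HC0; have /andP[r0 r1] := r01.
have [L [N [L0 hL]]] := hit_lower_uniform T0 q0 c00 C00 r01 hq HC Hc.
set p := (r ^+ 2)%R in hL *.
have p0 : (0 < p)%R by rewrite exprn_gt0.
have p1 : (p < 1)%R by rewrite exprn_ilt1// ltW.
have pL : (0 < p ^+ L)%R by rewrite exprn_gt0.
(* With this B some step among N exceeds B with probability at most p^L, so half of the lower bound
   2 p^L survives the restriction to bounded steps. *)
pose B := (Num.truncn (N%:R * K / p ^+ L)).+1.
have B1 : (1 <= B%:R :> R)%R by rewrite ler1n.
have hB : (N%:R * K / p ^+ L < B%:R)%R by exact: truncnS_gt.
apply: (@H_win_growth_of_hit p C0 L N B n1); rewrite ?p0//.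
move=> y; set A := [set u | _].
have mA : measurable A by apply: measurable_boolset; exact: measurable_fun_ler.
have h1 := le_trans (hL y) (hitT_le mu ma mc N (y, L%:R) mA).
have h2 : N%:R%:E * mu (~` A) <= (p ^+ L)%:E.
  apply: (@le_trans _ _ (N%:R%:E * (K / B%:R)%:E)).
    by apply: lee_wpmul2l; [rewrite lee_fin|exact: tail_l_le].
  rewrite -EFinM lee_fin mulrA ler_pdivrMr ?(lt_le_trans ltr01 B1)//.
  by move: hB; rewrite ltr_pdivrMr// (mulrC (p ^+ L)%R) => /ltW.
have {h1 h2} := le_trans h1 (leeD (lexx _) h2).
have hf : hit A N (y, L%:R) \is a fin_num.
  rewrite ge0_fin_numE ?hit_ge0//; apply: le_lt_trans (hit_le1 mu a c mA _ _) _.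
  exact: ltry.
rewrite -(fineK hf) -EFinD !lee_fin; lra.
Qed.

(* Without uniform exit, some starting point sees no exit for a long time, and
   from such a point the weight t is essentially conserved. *)
Lemma H_win_growth_degenerate (T : R) n : (0 <= T)%R ->
  (forall q : R, (0 < q)%R -> exists y, hit setT n (y, T + 1)%R < q%:E) ->
  exists x, forall S : R, (0 <= S)%R -> H n (win S) x <= (2 * S + T + 4)%:E.
Proof.
move=> T0 hq.
(* The final bound must be free of n, so n is absorbed by the choice of y. B brings the n excess
   terms below 1, and since C + L + B = S + 1 + X + B, a hitting probability below 1 / (1 + X + B)
   leaves at most S + 1. *)
pose X : R := (n%:R * (1 + K) + (T + 1))%R.
pose B : R := (n%:R * K + 1)%R.
have B1 : (1 <= B)%R by rewrite lerDr mulr_ge0.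
have X0 : (0 <= X)%R by rewrite addr_ge0 ?mulr_ge0 ?addr_ge0.
have q0 : (0 < (1 + X + B)^-1)%R by rewrite invr_gt0; lra.
have [y hy] := hq _ q0; exists y => S S0.
have L0 : (0 <= T + 1)%R by lra.
apply: (le_trans (H_win_split mu ma mc n y L0 S0)).
rewrite (_ : (2 * S + T + 4 = (T + 1 + S + 1) + ((S + 1) + 1))%R); last by ring.
rewrite [leRHS]EFinD; apply: leeD.
  rewrite -[leRHS]mule1; apply: lee_wpmul2l; first by rewrite lee_fin; lra.
  apply: le_trans (integral_iter_win mu ma mc n S y).
  have [mi i0] := nnm_iter_section mu ma mc n y (nnm_win S).
  apply: le_ge0_integral => t _; first by rewrite mule_ge0 ?ind_ge0//; exact: i0.
  rewrite -[leRHS]mul1e; apply: lee_wpmul2r; [exact: i0|exact: ind_le1].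
have C0 : (0 <= S + 1 + n%:R * (1 + K))%R by rewrite !addr_ge0// mulr_ge0// addr_ge0.
have HC j x : (j <= n)%N -> H j (win S) x <= (S + 1 + n%:R * (1 + K))%:E.
  move=> jn; apply: (le_trans (H_win_le_linear _ _ S0)).
  by rewrite lee_fin lerD2l ler_wpM2r ?addr_ge0// ler_nat.
have B0 : (0 <= B)%R by lra.
apply: (le_trans (descent_le_hit ma mc ml l0 cl y L0 B0 C0 L0 HC)).
rewrite [leRHS]EFinD; apply: leeD.
  apply: (@le_trans _ _ ((S + 1 + n%:R * (1 + K) + (T + 1) + B)%:E * ((1 + X + B)^-1)%:E)).
    by apply: lee_wpmul2l; [rewrite lee_fin addr_ge0// addr_ge0|exact: ltW].
  rewrite -EFinM lee_fin ler_pdivrMr; last by lra.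
  rewrite -(addrA (S + 1)%R) -/X -addrA.
  have XB : (0 <= X + B)%R by lra.
  have SXB : (0 <= S * (X + B))%R by exact: mulr_ge0.
  by lra.
apply: (@le_trans _ _ (n%:R%:E * (K / B ^+ 3)%:E)).
  by apply: lee_wpmul2l (Kexc _); [rewrite lee_fin|lra].
have B30 : (0 < B ^+ 3)%R by rewrite exprn_gt0//; lra.
rewrite -EFinM lee_fin mulrA ler_pdivrMr// mul1r.
apply: (@le_trans _ _ B); first by rewrite lerDl.
by rewrite -[leLHS]expr1 ler_weXn2l.
Qed.

(** Dichotomy on whether, for some horizon m, exits from level T + 1 have probability bounded below
    in y. If so the bound holds at every x. If not, the horizon m = n fails for every q, which
    provides a point x for each n. *)
Theorem H_win_growth (T c0 C C0 r : R) (n0 n1 : nat) :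
  (0 <= T)%R -> (0 < c0)%R -> (0 < r < 1)%R ->
  (forall n x, (n0 <= n)%N -> c0%:E <= H n (win T) x <= C%:E) ->
  (forall n x, (n1 <= n)%N -> H n (win 0) x <= C0%:E) ->
  exists D : R, (0 <= D)%R /\ forall n, (n1 <= n)%N -> exists x, forall S : nat,
    H n (win S%:R) x <= (D / (r ^+ 3) ^+ S)%:E.
Proof.
move=> T0 c00 r01 HT H0; have /andP[r0 r1] := r01.
(* The third power of r absorbs the factor S + 1, through S r^S <= 1 / (1 - r). *)
have poly (D : R) (S : nat) : (0 <= D)%R ->
    (D * S.+1%:R / (r ^+ 2) ^+ S <= D * (1 + (1 - r)^-1) / (r ^+ 3) ^+ S)%R.
  move=> D0; rewrite -!mulrA ler_wpM2l// ler_pdivlMr ?exprn_gt0//.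
  rewrite -!exprM mulrAC -mulrA (_ : (3 * S = 2 * S + S)%N); last by ring.
  rewrite exprD mulrAC divff ?mul1r ?expf_neq0 ?gt_eqF//.
  rewrite -natr1 mulrDl mul1r addrC lerD//; last exact: natr_geometric_le.
  by rewrite exprn_ile1// ltW.
pose C1 := Num.max C (T + 1 + n0%:R * (1 + K))%R.
have CT : (0 <= T + 1 + n0%:R * (1 + K))%R by rewrite !addr_ge0// mulr_ge0// addr_ge0.
have C10 : (0 <= C1)%R by rewrite le_max CT orbT.
have HC n x : H n (win T) x <= C1%:E.
  have [nn|nn] := leqP n0 n.
    have /andP[_ h] := HT n x nn; apply: (le_trans h).
    by rewrite lee_fin le_max lexx.
  apply: (le_trans (H_win_le_linear n x T0)).
  rewrite lee_fin le_max; apply/orP; right.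
  by rewrite lerD2l ler_wpM2r ?addr_ge0// ler_nat ltnW.
have [[m [q [q0 hq]]]|hq] := pselect (exists m (q : R), (0 < q)%R /\
    forall y, q%:E <= hit setT m (y, T + 1)%R).
  have Hc n x : (n0 <= n)%N -> c0%:E <= H n (win T) x by move=> /(HT n x)/andP[].
  have [D [D0 HD]] := H_win_growth_nondegenerate T0 q0 c00 C10 r01 hq HC Hc H0.
  exists (D * (1 + (1 - r)^-1))%R; split.
    by rewrite mulr_ge0// addr_ge0// invr_ge0 subr_ge0 ltW.
  move=> n nn; exists point => S; apply: (le_trans (HD n point S nn)).
  by rewrite lee_fin poly.
exists ((T + 4) * (1 + (1 - r)^-1))%R; split.
  by rewrite mulr_ge0// ?addr_ge0// invr_ge0 subr_ge0 ltW.
move=> n nn.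
have [|x hx] := @H_win_growth_degenerate T n T0.
  move=> q q0; apply: contrapT => hy; apply: hq; exists n, q; split => // y.
  by rewrite leNgt; apply/negP => h; apply: hy; exists y.
exists x => S; apply: (le_trans (hx S%:R (ler0n _ _))); rewrite lee_fin.
apply: le_trans (poly _ S _); last by rewrite addr_ge0.
rewrite ler_pdivlMr ?exprn_gt0//.
have e1 : ((r ^+ 2) ^+ S <= 1 :> R)%R.
  by rewrite exprn_ile1 ?exprn_ge0 ?ltW// exprn_ilt1// ltW.
have e0 : (0 <= (r ^+ 2) ^+ S :> R)%R by rewrite !exprn_ge0// ltW.
have S0 : (0 <= S%:R :> R)%R by [].
apply: (@le_trans _ _ (2 * S%:R + T + 4)%R).
  by rewrite -[leRHS]mulr1 ler_wpM2l// !addr_ge0// mulr_ge0.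
have TS : (0 <= T * S%:R)%R by exact: mulr_ge0.
rewrite -natr1; lra.
Qed.

End Tail.

(** * The limit identity *)

Section Trapezoid.
Context {R : realType}.
Implicit Types (p q e t : R).

(* Equal to 1 on [p, q] and to 0 outside ]p - e, q + e[ *)
Definition trap p q e t : R :=
  Num.max 0 (Num.min 1 (Num.min ((t - p) / e + 1) ((q - t) / e + 1))).

Lemma trap_ge0 p q e t : 0 <= trap p q e t.
Proof. by rewrite le_max lexx. Qed.

Lemma trap_le1 p q e t : trap p q e t <= 1.
Proof. by rewrite ge_max ler01 ge_min lexx. Qed.

Lemma trap1 p q e t : 0 < e -> p <= t <= q -> trap p q e t = 1.
Proof.
move=> e0 /andP[pt tq]; rewrite /trap min_l ?max_r//.
by rewrite le_min !lerDr !divr_ge0 ?subr_ge0// ltW.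
Qed.

Lemma trap0 p q e t : 0 < e -> (t <= p - e) || (q + e <= t) -> trap p q e t = 0.
Proof.
move=> e0 h; rewrite /trap max_l// !ge_min; apply/orP; right.
rewrite -!lerBrDr !sub0r !ler_pdivrMr//.
by case/orP: h => h; apply/orP; [left|right]; lra.
Qed.

Lemma trap_le_ind p q e t : 0 < e -> trap p q e t <= ((p - e <= t) && (t < q + e))%:R.
Proof.
move=> e0; case: (boolP (_ && _)) => h; first exact: trap_le1.
rewrite trap0//; move: h; rewrite negb_and -ltNge -leNgt => /orP[/ltW ->//|->].
by rewrite orbT.
Qed.

Lemma measurable_trap p q e : measurable_fun setT (trap p q e).
Proof.
apply: measurable_maxr => //; apply: measurable_minr => //.
by apply: measurable_minr; apply: measurable_funD => //;
  apply: measurable_funM => //; exact: measurable_funB.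
Qed.

End Trapezoid.

Lemma sume_const_nat (R : realType) (N : nat) (y : \bar R) : (0 <= y)%E ->
  (\sum_(0 <= j < N) y = N%:R%:E * y)%E.
Proof.
move=> y0; elim: N => [|N ih]; first by rewrite big_nil mul0e.
by rewrite big_nat_recr//= ih -natr1 EFinD ge0_muleDl ?lee_fin// mul1e.
Qed.

Section Limit.
Context {R : realType} {dE dG : measure_display}.
Context {E : measurableType dE} {G : measurableType dG}.
Variable mu : probability G R.
Variables (a : E * G -> E) (c : E * G -> R).
Hypothesis (ma : measurable_fun setT a) (mc : measurable_fun setT c).
Variable l : G -> R.
Hypotheses (ml : measurable_fun setT l) (l0 : forall u, (0 <= l u)%R).
Hypothesis cl : forall x u, (`|c (x, u)| <= l u)%R.
Local Open Scope ereal_scope.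
Local Notation Z := (E * R)%type.
Local Notation step := (step a c).
Local Notation Q := (Q mu a c).
Local Notation Qp := (Qp mu a c).
Local Notation H := (H mu a c).
Local Notation hit := (hit mu a c).
Implicit Types (f h : Z -> \bar R) (z : Z) (x : E) (n : nat).

Lemma Q_nneseries (F : nat -> Z -> \bar R) z : (forall k, nnm (F k)) ->
  Q (fun z => \sum_(k <oo) F k z) z = \sum_(k <oo) Q (F k) z.
Proof.
move=> nF; rewrite /Q integral_nneseries//.
  by move=> k; exact: (nnm_step ma mc z (nF k)).1.
by move=> k u _; exact: (nF k).2.
Qed.


Lemma iter_nneseries n (F : nat -> Z -> \bar R) z : (forall k, nnm (F k)) ->
  iter n Qp (fun z => \sum_(k <oo) F k z) z = \sum_(k <oo) iter n Qp (F k) z.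
Proof.
move=> nF; elim: n z => //= n ih z.
have -> : iter n Qp (fun z => \sum_(k <oo) F k z) =
    (fun z => \sum_(k <oo) iter n Qp (F k) z) by apply/funext => ?; exact: ih.
rewrite {1}/Qp Q_nneseries; last by move=> k; exact: nnm_iter.
case: ifP => z0; first by apply: eq_eseriesr => k _; rewrite /Qp z0.
by rewrite eseries0// => k _ _; rewrite /Qp z0.
Qed.

Lemma H_nneseries n (F : nat -> Z -> \bar R) x : (forall k, nnm (F k)) ->
  H n (fun z => \sum_(k <oo) F k z) x = \sum_(k <oo) H n (F k) x.
Proof.
move=> nF; rewrite /H -integral_nneseries//; last 2 first.
- by move=> k; exact: (nnm_H_integrand mu ma mc n x (nF k)).1.
- by move=> k t _; exact: (nnm_H_integrand mu ma mc n x (nF k)).2.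
apply: eq_integral => t _; rewrite iter_nneseries// nneseriesZl//.
by move=> k _; apply: iter_ge0; exact: (nF k).2.
Qed.

Definition strip (s w : R) z : \bar R := ind ((s <= z.2)%R && (z.2 < s + w)%R).

Lemma nnm_strip s w : nnm (strip s w).
Proof.
apply: nnm_ind; apply: (measurableT_comp (measurable_window s (s + w)%R)).
exact: measurable_snd.
Qed.

Lemma strip_sum (s w : R) (N : nat) z : (0 <= w)%R ->
  \sum_(0 <= j < N) strip (s + j%:R * w) w z = strip s (N%:R * w) z.
Proof.
move=> w0; elim: N => [|N ih].
  by rewrite big_nil /strip /ind mul0r addr0; case: leP.
rewrite big_nat_recr//= ih /strip /ind -natr1 mulrDl mul1r addrA -EFinD.
have sN : (s <= s + N%:R * w)%R by rewrite lerDl mulr_ge0.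
have [h1|h1] := ltP z.2 (s + N%:R * w)%R.
  have -> : (z.2 < s + N%:R * w + w)%R by rewrite (lt_le_trans h1)// lerDl.
  by rewrite /= addr0.
by rewrite (le_trans sN h1)/= add0r.
Qed.

Lemma shift_strip k s w : shift k (strip s w) = strip (s + k) w.
Proof.
apply/funext => z; rewrite /shift /strip/=; congr (ind (_ && _)).
  by rewrite lerBrDr.
by rewrite ltrBlDr addrAC.
Qed.

Lemma le_H_strip n (s s' w : R) x : (s <= s')%R -> H n (strip s w) x <= H n (strip s' w) x.
Proof.
move=> ss'; have k0 : (0 <= s' - s)%R by rewrite subr_ge0.
by have := le_H_shift mu ma mc n x k0 (nnm_strip s w); rewrite shift_strip addrC subrK.
Qed.

Lemma H_strip_ge n (s w : R) (N : nat) x : (0 <= w)%R ->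
  N%:R%:E * H n (strip s w) x <= H n (strip s (N%:R * w)) x.
Proof.
move=> w0; have -> : strip s (N%:R * w) = fun z => \sum_(0 <= j < N) strip (s + j%:R * w) w z.
  by apply/funext => z; rewrite strip_sum.
rewrite H_sum//; last by move=> j; exact: nnm_strip.
apply: (@le_trans _ _ (\sum_(0 <= j < N) H n (strip s w) x)); last first.
  apply: lee_sum => j _.
  have sj : (s <= s + j%:R * w)%R by rewrite lerDl; apply: mulr_ge0.
  by have := le_H_strip n w x sj.
by rewrite sume_const_nat; [exact: lexx|apply: H_ge0; exact: (nnm_strip _ _).2].
Qed.

(** Each of the N thin strips has at most the mass of the next one above the whole block. This moves
    a lower bound for a wide strip to a single window at a nonnegative level. *)
Lemma H_strip_le_top n (s w : R) (N : nat) x : (0 <= w)%R ->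
  H n (strip s (N%:R * w)) x <= N%:R%:E * H n (strip (s + N%:R * w) w) x.
Proof.
move=> w0; have -> : strip s (N%:R * w) = fun z => \sum_(0 <= j < N) strip (s + j%:R * w) w z.
  by apply/funext => z; rewrite strip_sum.
rewrite H_sum//; last by move=> j; exact: nnm_strip.
apply: (@le_trans _ _ (\sum_(0 <= j < N) H n (strip (s + N%:R * w) w) x)).
  rewrite big_nat_cond [leRHS]big_nat_cond; apply: lee_sum => j /andP[/andP[_ jN] _].
  have jN' : (s + j%:R * w <= s + N%:R * w)%R.
    by rewrite lerD2l; apply: ler_wpM2r => //; rewrite ler_nat ltnW.
  by have := le_H_strip n w x jN'.
by rewrite sume_const_nat; [exact: lexx|apply: H_ge0; exact: (nnm_strip _ _).2].
Qed.

Lemma strip_win s : strip s 1 = win s. Proof. by []. Qed.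

Variable rho : {measure set Z -> \bar R}.

(** Convergence of [H n f x] to a finite integral, uniformly in x. *)
Definition converges f := exists2 I : R, \int[rho]_z f z = I%:E &
  forall eps : R, (0 < eps)%R -> exists n0, forall n x, (n0 <= n)%N ->
    (I - eps)%:E <= H n f x <= (I + eps)%:E.

Lemma nnm_trap p q e : nnm (fun z : Z => (trap p q e z.2)%:E).
Proof.
apply: nnm_EFin; last by move=> z; exact: trap_ge0.
exact: (measurableT_comp (measurable_trap p q e) (@measurable_snd _ _ E _)).
Qed.

(** Uniform convergence allows the comparison point x to change with n, and the lag m makes room for
    [H (n + m)] on the right. *)
Lemma converges_le (f h : Z -> \bar R) (I J : R) (m : nat) :
  \int[rho]_z f z = I%:E -> \int[rho]_z h z = J%:E ->
  converges f -> converges h ->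
  (exists n0, forall n, (n0 <= n)%N -> exists x, H n f x <= H (n + m) h x) -> (I <= J)%R.
Proof.
move=> fI hJ [I' fI' cf] [J' hJ' ch] [n0 hn].
have -> : I = I' by apply: EFin_inj; rewrite -fI.
have -> : J = J' by apply: EFin_inj; rewrite -hJ.
apply/ler_addgt0Pr => eps eps0.
have e2 : (0 < eps / 2)%R by rewrite divr_gt0.
have [n1 h1] := cf _ e2; have [n2 h2] := ch _ e2.
pose n := maxn n0 (maxn n1 n2).
have [x hx] := hn n (leq_maxl _ _).
have /andP[a1 _] := h1 n x (leq_trans (leq_maxl _ _) (leq_maxr _ _)).
have n2n : (n2 <= n + m)%N.
  by rewrite (leq_trans _ (leq_addr _ _))// (leq_trans (leq_maxr n1 n2))// leq_maxr.
have /andP[_ a2] := h2 (n + m)%N x n2n.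
have := le_trans a1 (le_trans hx a2); rewrite lee_fin; lra.
Qed.

Hypothesis conv_trap : forall p q e : R, (p <= q)%R -> (0 < e)%R ->
  converges (fun z => (trap p q e z.2)%:E).

Lemma H_strip_bounded (s w : R) : (0 <= w)%R -> exists C n0, forall n x, (n0 <= n)%N ->
  H n (strip s w) x <= C%:E.
Proof.
move=> w0; have sw : (s <= s + w)%R by rewrite lerDl.
have [I _ hI] := conv_trap sw ltr01; have [n0 h] := hI 1%R ltr01.
exists (I + 1)%R, n0 => n x nn; have /andP[_] := h n x nn; apply: le_trans.
apply: le_H => z; first exact: ind_ge0.
rewrite /strip; case: (boolP (_ && _)) => [/andP[h1 h2]|_]; last by rewrite lee_fin trap_ge0.
by rewrite trap1// h1 ltW.
Qed.

(* Disjoint translates of a thin strip fill a unit strip *)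
Lemma rho_level0 : rho [set z | z.2 = 0%R] = 0.
Proof.
have mz : measurable [set z : Z | z.2 = 0%R].
  have -> : [set z : Z | z.2 = 0%R] = [set z : Z | z.2 == 0%R].
    by apply/seteqP; split => z /= /eqP.
  by apply: measurable_boolset; exact: measurable_fun_eqr.
have [C [n0 hC]] := H_strip_bounded 0 (ler0n R 2).
have C0 : (0 <= C)%R.
  rewrite -lee_fin; apply: le_trans (hC n0 point (leqnn _)).
  by apply: H_ge0; exact: (nnm_strip _ _).2.
apply/eqP; rewrite eq_le measure_ge0 andbT; apply/lee_addgt0Pr => eps eps0.
rewrite add0e.
(* The strip [-1/N, 1/N[ has N disjoint upward translates that fill a strip of width 2, of mass at
   most C. Its mass is then at most C / N, and the convergence error 1 / N keeps the total below
   eps. *)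
pose N := (Num.truncn ((C + 1) / eps)).+1.
have hN : ((C + 1) / eps < N%:R)%R by exact: truncnS_gt.
have N0 : (0 < N%:R :> R)%R by rewrite ltr0n.
have NR : (1 <= N%:R :> R)%R by rewrite ler1n.
pose e : R := N%:R^-1%R.
have e0 : (0 < e)%R by rewrite invr_gt0.
have [I rI hI] := conv_trap (lexx 0%R) e0.
have rz : rho [set z | z.2 = 0%R] <= I%:E.
  rewrite -rI -[X in rho X]setIT -integral_indic//.
  apply: le_ge0_integral => z _; first by rewrite lee_fin.
  rewrite indicE; case: (boolP (_ \in _)) => [|_]; last by rewrite lee_fin trap_ge0.
  by rewrite inE/= => ->; rewrite trap1// lexx.
apply: (le_trans rz); rewrite lee_fin.
have eN : (0 < e)%R by [].
have [n1 h1] := hI _ eN.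
pose n := maxn n0 n1.
have /andP[h2 _] := h1 n point (leq_maxr _ _).
have h3 : H n (fun z => (trap 0 0 e z.2)%:E) point <= H n (strip (- e) (2 * e)) point.
  apply: le_H => z; first by rewrite lee_fin trap_ge0.
  rewrite /strip /ind lee_fin; apply: (le_trans (trap_le_ind 0%R 0%R z.2 e0)).
  by rewrite sub0r add0r (_ : (- e + 2 * e = e)%R)//; ring.
have e20 : (0 <= 2 * e)%R by rewrite mulr_ge0// ltW.
have h4 : N%:R%:E * H n (strip (- e) (2 * e)) point <= C%:E.
  apply: (le_trans (H_strip_ge n (- e) N point e20)).
  rewrite (_ : (N%:R * (2 * e) = 2)%R); last by rewrite /e; field; rewrite gt_eqF.
  apply: le_trans (hC n point (leq_maxl _ _)).
  apply: le_H_strip; by rewrite oppr_le0 ltW.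
have h5 : N%:R%:E * (I - e)%:E <= C%:E.
  apply: le_trans h4; apply: lee_wpmul2l; first by rewrite lee_fin.
  exact: le_trans h2 h3.
move: h5; rewrite -EFinM lee_fin => h5.
move: hN; rewrite ltr_pdivrMr// => hN.
have Ne : (N%:R * e = 1)%R by rewrite /e mulfV// gt_eqF.
rewrite -(ler_pM2l N0); rewrite mulrBr Ne in h5; lra.
Qed.

Variables (phi : Z -> R) (M : nat).
Hypotheses (mphi : measurable_fun setT phi) (phi0 : forall z, (0 <= phi z)%R).
Hypothesis phi_le : forall z, (phi z <= M%:R)%R.
Hypothesis phi_supp : forall z, (M%:R <= `|z.2|)%R -> phi z = 0%R.
Local Notation phiE := (fun z => (phi z)%:E).
Hypothesis conv_phi : converges phiE.
Hypothesis conv_Qphi : forall p q e : R, (p <= q)%R -> (0 < e)%R ->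
  converges (fun z => (trap p q e z.2)%:E * Q phiE z).

Let nphi : nnm phiE. Proof. exact: nnm_EFin. Qed.

Let nQphi : nnm (Q phiE). Proof. exact: nnm_Q. Qed.

Let Qphi_le z : Q phiE z <= M%:R%:E.
Proof.
have M0 : 0 <= (M%:R%:E : \bar R) by rewrite lee_fin.
rewrite -(Q_cst mu a c z M0); apply: le_Q => ?; first exact: nphi.2.
by rewrite lee_fin phi_le.
Qed.

Let measurable_level (b : R -> bool) : measurable_fun setT b ->
  measurable [set z : Z | b z.2].
Proof.
move=> mb; apply: measurable_boolset.
exact: (measurableT_comp mb (@measurable_snd _ _ E _)).
Qed.

(** The easy inequality, by exhaustion from inside. On each compact range of positive levels a
    trapezoid times [Q phiE] stays below [Qp phiE], and [H n (Qp phiE)] is [H (n + 1) phiE]. Level 0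
    is negligible by [rho_level0]. *)
Lemma integral_Q_le :
  \int[rho]_(z in [set z | (0 <= z.2)%R]) Q phiE z <= \int[rho]_z phiE z.
Proof.
have [J rJ _] := conv_phi.
have mge : measurable [set z : Z | (0 <= z.2)%R].
  by apply: measurable_level; exact: measurable_fun_ler.
have mgt : measurable [set z : Z | (0 < z.2)%R].
  by apply: measurable_level; exact: measurable_fun_ltr.
have meq : measurable [set z : Z | z.2 == 0%R].
  by apply: (measurable_level (b := fun t => t == 0%R)); exact: measurable_fun_eqr.
have mQ D : measurable_fun D (Q phiE) by apply: measurable_funTS; exact: nQphi.1.
have -> : [set z : Z | (0 <= z.2)%R] = [set z | (0 < z.2)%R] `|` [set z | z.2 == 0%R].
  apply/seteqP; split => z /=; first by rewrite le_eqVlt eq_sym => /orP[->|->]; [right|left].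
  by case=> [/ltW|/eqP ->].
rewrite ge0_integral_setU//; last 2 first.
- by move=> z _; exact: nQphi.2.
- by apply/disj_setPS => z /= [/gt_eqF ->].
rewrite [X in _ + X](_ : _ = 0) ?adde0; last first.
  apply/eqP; rewrite eq_le; apply/andP; split; last first.
    by apply: integral_ge0 => z _; exact: nQphi.2.
  apply: (@le_trans _ _ (\int[rho]_(z in [set z | z.2 == 0%R]) (M%:R)%:E)).
    by apply: le_ge0_integral => z _; [exact: nQphi.2|exact: Qphi_le].
  rewrite integral_cst//= (_ : [set z : Z | z.2 == 0%R] = [set z | z.2 = 0%R]).
    by rewrite rho_level0 mule0.
  by apply/seteqP; split => z /= /eqP.
pose D k := [set z : Z | ((k.+1%:R^-1 <= z.2) && (z.2 <= k%:R))%R].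
have mD k : measurable (D k).
  apply: (measurable_level (b := fun t => (k.+1%:R^-1 <= t)%R && (t <= k%:R)%R)).
  apply: measurable_and; exact: measurable_fun_ler.
have -> : [set z : Z | (0 < z.2)%R] = \bigcup_k D k.
  apply/seteqP; split => z /=; last first.
    by move=> [k _ /andP[h _]]; apply: lt_le_trans h; rewrite invr_gt0.
  move=> z0; pose k := (Num.truncn (Num.max z.2 (z.2^-1))%R).+1.
  have hk : (Num.max z.2 z.2^-1 < k%:R)%R by exact: truncnS_gt.
  move: hk; rewrite gt_max => /andP[k1 k2].
  exists k => //; rewrite /D/= (ltW k1) andbT -[leRHS]invrK lef_pV2 ?posrE ?invr_gt0//.
  by rewrite (le_trans (ltW k2))// ler_nat.
have ndD : nondecreasing_seq D.
  move=> i j ij; apply/subsetPset => z /andP[h1 h2]; rewrite /D/=; apply/andP; split.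
    by apply: le_trans h1; rewrite lef_pV2 ?posrE// ler_nat.
  by apply: (le_trans h2); rewrite ler_nat.
have cv := @ge0_nondecreasing_set_cvg_integral _ _ _ D (Q phiE) rho ndD mD
  (fun k => mQ (D k)) (fun _ z _ => nQphi.2 z).
rewrite -(cvg_lim _ cv)//; apply: lime_le; first by apply/cvg_ex; eexists; exact: cv.
(* The trapezoid with lower corner e and slope width e rises from level 0, so it vanishes at
   negative levels, where [Qp] is zero. *)
apply: nearW => k; pose e : R := k.+1%:R^-1%R.
have e0 : (0 < e)%R by rewrite invr_gt0.
have ek : (e <= e + k%:R)%R by rewrite lerDl.
have ct := conv_Qphi ek e0; have [I rI _] := ct.
apply: (@le_trans _ _ I%:E); last first.
  rewrite rJ lee_fin; apply: (converges_le (m := 1) rI rJ ct conv_phi).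
  exists 0%N => n _; exists point; rewrite H_addn; apply: le_H => z.
    by rewrite mule_ge0 ?lee_fin ?trap_ge0//; exact: nQphi.2.
  rewrite /= /Qp; case: ifPn => z0.
    rewrite -[leRHS]mul1e; apply: lee_wpmul2r; first exact: nQphi.2.
    by rewrite lee_fin trap_le1.
  by rewrite trap0 ?mul0e// subrr ltW// ltNge.
rewrite -rI integral_mkcond; apply: le_ge0_integral => z _.
  by rewrite patchE; case: ifP => // _; exact: nQphi.2.
rewrite patchE; case: ifPn => [|_]; last first.
  by rewrite mule_ge0 ?lee_fin ?trap_ge0//; exact: nQphi.2.
rewrite inE /D/= => /andP[h1 h2].
by rewrite trap1 ?mul1e// h1 (le_trans h2)// lerDr ltW.
Qed.

Variables (r C : R).
Hypothesis (r01 : (0 < r < 1)%R) (C0 : (0 <= C)%R).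
Hypothesis l_tail : forall S : nat,
  mu [set u | (S%:R <= l u)%R] <= (C * (r ^+ 6) ^+ S)%:E.

(** To reach the support of [phi] from level S + M the step has to drop by at least S, which forces
    [l u] >= S. *)
Lemma Qphi_tail z (S : nat) : (S%:R + M%:R <= z.2)%R ->
  Q phiE z <= (M%:R * (C * (r ^+ 6) ^+ S))%:E.
Proof.
move=> hz.
have mA : measurable [set u | (S%:R <= l u)%R].
  by apply: measurable_boolset; exact: measurable_fun_ler.
rewrite EFinM; apply: (@le_trans _ _ (M%:R%:E * mu [set u | (S%:R <= l u)%R])); last first.
  by apply: lee_wpmul2l => //; rewrite lee_fin.
rewrite -integral_cst// integral_mkcond; apply: le_ge0_integral => u _.
  by rewrite lee_fin.
rewrite patchE; case: ifPn => [_|hu]; first by rewrite lee_fin.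
rewrite phi_supp//=; have := cl z.1 u; rewrite ler_norml => /andP[c1 _].
have hl : (l u < S%:R)%R.
  by rewrite ltNge; apply/negP => h; move/negP: hu; apply; rewrite inE.
by apply: le_trans (ler_norm _); lra.
Qed.

Let coef k : R := (M%:R * (C * (r ^+ 6) ^+ k))%R.

Let coef_ge0 k : (0 <= coef k)%R.
Proof.
have /andP[r0 _] := r01.
by rewrite /coef !mulr_ge0// !exprn_ge0// ltW.
Qed.

(** Window by window, the tail r^(6 S) of the steps meets the growth r^-(3 S) of the masses. What is
    left is a geometric series of ratio r^3 starting at A, so the bound vanishes as A grows. *)
Lemma H_tail_le (D : R) (A : nat) n x : (0 <= D)%R ->
  (forall S : nat, H n (win S%:R) x <= (D / (r ^+ 3) ^+ S)%:E) ->
  H n (fun z => ind ((A + M)%:R <= z.2)%R * Q phiE z) x <=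
  (M%:R * C * D / (r ^+ 3) ^+ M * (r ^+ 3) ^+ A / (1 - r ^+ 3))%:E.
Proof.
move=> D0 hD; have /andP[r0 r1] := r01.
pose F k z : \bar R := (coef (A + k))%:E * win (A + M + k)%:R z.
have nF k : nnm (F k) by apply: nnm_mul (nnm_cst _) (nnm_win _); rewrite lee_fin.
apply: (@le_trans _ _ (H n (fun z => \sum_(k <oo) F k z) x)).
  apply: le_H => z; first by rewrite mule_ge0 ?ind_ge0//; exact: nQphi.2.
  have S0 : 0 <= \sum_(k <oo) F k z by apply: nneseries_ge0 => k _ _; exact: (nF k).2.
  rewrite /ind; case: (boolP ((A + M)%:R <= z.2)%R) => hz; last by rewrite mul0e.
  rewrite mul1e; have z0 : (0 <= z.2)%R by apply: le_trans hz.
  have /andP[t1 t2] := truncn_itv z0.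
  pose k := (Num.truncn z.2 - (A + M))%N.
  have AM : (A + M <= Num.truncn z.2)%N by rewrite truncn_ge_nat.
  apply: (@le_trans _ _ (F k z)).
    rewrite /F /win /k subnKC// t1/= natr1 t2 mule1; apply: Qphi_tail.
    apply: le_trans t1; rewrite -natrD ler_nat; lia.
  apply: le_trans (nneseries_lim_ge k.+1 _); last by move=> i _ _; exact: (nF i).2.
  rewrite big_nat_recr//=; apply: lee_paddl => //.
  by apply: sume_ge0 => i _; exact: (nF i).2.
rewrite H_nneseries//.
pose B : R := (M%:R * C * D / (r ^+ 3) ^+ M * (r ^+ 3) ^+ A)%R.
have r30 : (0 < r ^+ 3)%R by rewrite exprn_gt0.
have r31 : (r ^+ 3 < 1)%R by rewrite exprn_ilt1// ltW.
have B0 : (0 <= B)%R by rewrite !mulr_ge0// ?invr_ge0 !exprn_ge0// ltW.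
have HF k : H n (F k) x <= (B * (r ^+ 3) ^+ k)%:E.
  rewrite /F H_scale//; [|by rewrite lee_fin|exact: nnm_win].
  apply: (@le_trans _ _ ((coef (A + k))%:E * (D / (r ^+ 3) ^+ (A + M + k))%:E)).
    by apply: lee_wpmul2l; [rewrite lee_fin|exact: hD].
  rewrite -EFinM lee_fin /coef /B le_eqVlt; apply/orP; left; apply/eqP.
  rewrite (_ : (r ^+ 6 = r ^+ 3 * r ^+ 3)%R); last by rewrite -exprD.
  rewrite exprMn !exprD; field.
  by rewrite !expf_neq0 ?gt_eqF.
apply: lime_le.
  by apply: is_cvg_nneseries => k _ _; apply: H_ge0; exact: (nF k).2.
apply: nearW => N; apply: (@le_trans _ _ (\sum_(0 <= k < N) (B * (r ^+ 3) ^+ k)%:E)).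
  by apply: lee_sum => k _; exact: HF.
rewrite sumEFin lee_fin -/B -mulr_sumr; apply: ler_wpM2l => //.
rewrite -[leRHS]mul1r ler_pdivlMr ?subr_gt0//.
have -> : ((\sum_(0 <= i < N) (r ^+ 3) ^+ i) * (1 - r ^+ 3) = 1 - (r ^+ 3) ^+ N :> R)%R.
  move: (r ^+ 3)%R => q; elim: N => [|N ih]; first by rewrite big_nil mul0r expr0 subrr.
  by rewrite big_nat_recr//= mulrDl ih exprS; ring.
by rewrite gerBl exprn_ge0// ltW.
Qed.

Lemma rho_strip_lty (s w : R) : (0 <= w)%R ->
  rho [set z | (s <= z.2)%R && (z.2 < s + w)%R] < +oo.
Proof.
move=> w0; have sw : (s <= s + w)%R by rewrite lerDl.
have [I rI _] := conv_trap sw ltr01.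
apply: (@le_lt_trans _ _ I%:E); last exact: ltry.
have mS : measurable [set z : Z | (s <= z.2)%R && (z.2 < s + w)%R].
  exact: (measurable_level (measurable_window _ _)).
rewrite -[X in rho X]setIT -integral_indic// -rI.
apply: le_ge0_integral => z _; first by rewrite lee_fin.
rewrite indicE; case: (boolP (_ \in _)) => [|_]; last by rewrite lee_fin trap_ge0.
by rewrite inE/= => /andP[h1 h2]; rewrite trap1// h1 ltW.
Qed.

(** Continuity from above along strips shrinking to the empty set. It controls the edge of a
    trapezoid that extends below level 0. *)
Lemma rho_left_small (eps : R) : (0 < eps)%R -> exists A0 : nat, forall A : nat, (A0 <= A)%N ->
  rho [set z | (- A.+1%:R^-1 <= z.2)%R && (z.2 < 0)%R] <= eps%:E.
Proof.
move=> eps0.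
pose F A := [set z : Z | (- A.+1%:R^-1 <= z.2)%R && (z.2 < 0)%R].
have mF A : measurable (F A).
  exact: (measurable_level (measurable_window _ _)).
have F0 : \bigcap_k F k = set0.
  apply/seteqP; split => z //= h.
  have /andP[_ z0] := h 0%N I.
  pose k := (Num.truncn (- z.2)^-1%R).+1.
  have hk : ((- z.2)^-1 < k%:R)%R by exact: truncnS_gt.
  have /andP[+ _] := h k I; rewrite lerNl leNgt => /negP; apply.
  have nz : (0 < - z.2)%R by rewrite oppr_gt0.
  rewrite -[ltRHS]invrK ltf_pV2 ?posrE ?invr_gt0//.
  by rewrite (lt_le_trans hk)// ler_nat.
have Foo : rho (F 0%N) < +oo.
  have := rho_strip_lty (-1) (ler0n R 1); rewrite addNr /F invr1.
  exact.
have cF : {homo F : n m / (n <= m)%N >-> (m <= n)%O}.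
  move=> n m nm; apply/subsetPset => z /andP[h1 h2]; rewrite /F/= h2 andbT.
  by apply: le_trans h1; rewrite lerN2 lef_pV2 ?posrE// ler_nat.
have := @nonincreasing_cvg_mu _ _ _ rho F Foo mF _ cF.
rewrite F0 measure0 => /(_ (@measurable0 _ _)) cv.
have nb : nbhs (0 : \bar R) [set y | y < eps%:E].
  apply: open_nbhs_nbhs; split; first exact: open_ereal_lt_ereal.
  by rewrite /= lte_fin.
have [A0 _ hA] := cv _ nb.
by exists A0 => A AA; exact/ltW/hA.
Qed.

(** The hard inequality. [Qp phiE] is below a trapezoid times [Q phiE] plus the part of [Q phiE]
    above A + M. The first term converges to at most the wanted integral plus the edge at the left
    of 0; the second is controlled at one x by [H_tail_le]. *)
Lemma le_integral_Q (D : R) (n1 : nat) : (0 <= D)%R ->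
  (forall n, (n1 <= n)%N -> exists x, forall S : nat,
    H n (win S%:R) x <= (D / (r ^+ 3) ^+ S)%:E) ->
  \int[rho]_z phiE z <= \int[rho]_(z in [set z | (0 <= z.2)%R]) Q phiE z.
Proof.
move=> D0 hD; have /andP[r0 r1] := r01.
have [J rJ cJ] := conv_phi.
have IJ : \int[rho]_(z in [set z | (0 <= z.2)%R]) Q phiE z <= J%:E.
  by rewrite -rJ; exact: integral_Q_le.
set I0 := \int[rho]_(z in [set z | (0 <= z.2)%R]) Q phiE z in IJ *.
have I00 : 0 <= I0 by apply: integral_ge0 => z _; exact: nQphi.2.
apply/lee_addgt0Pr => eps eps0.
have e4 : (0 < eps / 4)%R by rewrite divr_gt0.
have eM : (0 < eps / 4 / M.+1%:R)%R by rewrite !divr_gt0.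
have [A0 hA0] := rho_left_small eM.
pose B : R := (M%:R * C * D / (r ^+ 3) ^+ M / (1 - r ^+ 3))%R.
have r30 : (0 < r ^+ 3)%R by rewrite exprn_gt0.
have r31 : (r ^+ 3 < 1)%R by rewrite exprn_ilt1// ltW.
have [A1 hA1] : exists A1 : nat, forall A, (A1 <= A)%N -> (B * (r ^+ 3) ^+ A <= eps / 4)%R.
  have cB : (B * (r ^+ 3) ^+ n)%R @[n --> \oo] --> (B * 0)%R.
    by apply: cvgMr; apply: cvg_expr; rewrite ger0_norm// ltW.
  rewrite mulr0 in cB.
  have [A1 _ h] := cvgr_le _ cB _ e4; exists A1 => A AA; exact: h.
(* One integer fixes both cuts: the edge width 1 / (A + 1) at level 0 and the height A + M at which
   the tail begins. *)
pose A := maxn A0 A1.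
pose e : R := A.+1%:R^-1%R.
have e0 : (0 < e)%R by rewrite invr_gt0.
have ct := conv_Qphi (ler0n R (A + M)) e0; have [IA rIA cIA] := ct.
have hIA : IA%:E <= I0 + (eps / 4)%:E.
  pose F := [set z : Z | (- A.+1%:R^-1 <= z.2)%R && (z.2 < 0)%R].
  have mF : measurable F.
    exact: (measurable_level (measurable_window _ _)).
  pose D0' := [set z : Z | (0 <= z.2)%R].
  have mD0 : measurable D0' by apply: measurable_level; exact: measurable_fun_ler.
  have mQD : measurable_fun setT (Q phiE \_ D0').
    by apply/(measurable_restrictT (Q phiE) mD0); apply: measurable_funTS; exact: nQphi.1.
  have Q0 z : 0 <= (Q phiE \_ D0') z by rewrite patchE; case: ifP => // _; exact: nQphi.2.
  rewrite -rIA; apply: (@le_trans _ _ (\int[rho]_z ((Q phiE \_ D0') z +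
      M%:R%:E * (\1_F z)%:E))).
    apply: le_ge0_integral => z _.
      by rewrite mule_ge0 ?lee_fin ?trap_ge0//; exact: nQphi.2.
    have [z0|z0] := leP 0%R z.2.
      apply: lee_paddr; first by rewrite mule_ge0// lee_fin.
      rewrite patchE mem_set// -[leRHS]mul1e; apply: lee_wpmul2r; first exact: nQphi.2.
      by rewrite lee_fin trap_le1.
    apply: lee_paddl => //; have [ze|ze] := leP (- e)%R z.2.
      rewrite indicE mem_set /F/= ?ze ?z0// mule1 -[leRHS]mul1e.
      by apply: lee_pmul; rewrite ?lee_fin ?trap_ge0 ?trap_le1//; exact: nQphi.2.
    rewrite trap0 ?mul0e//.
    by rewrite sub0r (ltW ze).
  rewrite ge0_integralD//; last by apply: emeasurable_funM => //; exact/measurable_EFinP.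
  rewrite -integral_mkcond leeD2l// ge0_integralZl ?lee_fin//; last exact/measurable_EFinP.
  rewrite integral_indic// setIT; apply: (@le_trans _ _ (M%:R%:E * (eps / 4 / M.+1%:R)%:E)).
    by apply: lee_wpmul2l; [rewrite lee_fin|apply: hA0; exact: leq_maxl].
  rewrite -EFinM lee_fin mulrA ler_pdivrMr// mulrC.
  by apply: ler_wpM2l; [exact: ltW|rewrite ler_nat].
have [n2 h2] := cIA _ e4; have [n3 h3] := cJ _ e4.
pose n := maxn n1 (maxn n2 n3).
(* Both convergences hold at every x, hence at the point for which the tail bound is available. *)
have [x hx] := hD n (leq_maxl _ _).
have /andP[_ u1] := h2 n x (leq_trans (leq_maxl n2 n3) (leq_maxr _ _)).
have n3n : (n3 <= n + 1)%N by rewrite (leq_trans _ (leq_addr _ _))// (leq_trans (leq_maxr n2 n3))// leq_maxr.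
have /andP[u2 _] := h3 (n + 1)%N x n3n.
have u3 := H_tail_le A D0 hx.
have u4 : (M%:R * C * D / (r ^+ 3) ^+ M * (r ^+ 3) ^+ A / (1 - r ^+ 3) <= eps / 4)%R.
  by have := hA1 A (leq_maxr _ _); rewrite /B mulrAC.
rewrite H_addn in u2.
have u5 : H n (iter 1 Qp phiE) x <= H n (fun z => (trap 0 (A + M)%:R e z.2)%:E * Q phiE z) x +
    H n (fun z => ind ((A + M)%:R <= z.2)%R * Q phiE z) x.
  have nT : nnm (fun z => (trap 0 (A + M)%:R e z.2)%:E * Q phiE z).
    by apply: nnm_mul nQphi; exact: nnm_trap.
  have nI : nnm (fun z : Z => ind ((A + M)%:R <= z.2)%R * Q phiE z).
    by apply: nnm_mul nQphi; apply: nnm_ind; exact: measurable_fun_ler.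
  rewrite -(H_add mu ma mc n x nT nI).
  apply: le_H => z; first by apply: Qp_ge0; exact: nphi.2.
  rewrite /= /Qp; case: ifPn => z0; last first.
    by rewrite adde_ge0// mule_ge0 ?lee_fin ?trap_ge0//; exact: nQphi.2.
  have [zA|zA] := leP z.2 (A + M)%:R%R.
    rewrite trap1 ?z0// mul1e leeDl// mule_ge0 ?ind_ge0//; exact: nQphi.2.
  rewrite (ltW zA) mul1e leeDr// mule_ge0 ?lee_fin ?trap_ge0//; exact: nQphi.2.
have : (J - eps / 4)%:E <= (IA + eps / 4)%:E + (eps / 4)%:E.
  apply: (le_trans u2); apply: (le_trans u5); apply: leeD => //.
  by apply: (le_trans u3); rewrite lee_fin.
have If : I0 \is a fin_num by rewrite ge0_fin_numE// (le_lt_trans IJ)// ltry.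
rewrite rJ; move: hIA; rewrite -(fineK If) -!EFinD !lee_fin; lra.
Qed.

(** A nonzero integral forces [rho] to charge a band containing the support of [phi]. The band is
    covered by 2 (M + 1) unit strips, all dominated by the window just above them. *)
Lemma win_lower : \int[rho]_z phiE z != 0 -> exists (T c0 : R) (n0 : nat),
  [/\ (0 <= T)%R, (0 < c0)%R & forall n x, (n0 <= n)%N -> c0%:E <= H n (win T) x].
Proof.
move=> phi_neq0.
have MM : (- M%:R <= M%:R :> R)%R by rewrite (@le_trans _ _ 0%R)// oppr_le0.
have [I rI cI] := conv_trap MM ltr01.
have I0 : (0 < I)%R.
  rewrite lt_neqAle -lee_fin -rI integral_ge0 ?andbT; last by move=> z _; rewrite lee_fin trap_ge0.
  apply: contra phi_neq0 => /eqP I0; rewrite eq_le; apply/andP; split; last first.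
    by apply: integral_ge0 => z _; exact: nphi.2.
  apply: (@le_trans _ _ (\int[rho]_z (M%:R%:E * (trap (- M%:R) M%:R 1 z.2)%:E))).
    apply: le_ge0_integral => z _; first exact: nphi.2.
    have [h|h] := leP M%:R%R `|z.2|%R.
      by rewrite phi_supp// mule_ge0 ?lee_fin ?trap_ge0.
    rewrite trap1 ?mule1 ?lee_fin ?phi_le//.
    by move: h => /ltW; rewrite ler_norml.
  have [mt t0] := nnm_trap (- M%:R) M%:R 1.
  by rewrite ge0_integralZl ?lee_fin// rI -I0 mule0.
have I2 : (0 < I / 2)%R by rewrite divr_gt0.
have [n0 hn0] := cI _ I2.
pose N := (M.+1 + M.+1)%N.
exists M.+1%:R%R, (I / 2 / N%:R)%R, n0; split => //; first by rewrite !divr_gt0.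
move=> n x nn; have /andP[h _] := hn0 n x nn.
have h1 : (I / 2)%:E <= H n (strip (- M.+1%:R) (N%:R * 1)) x.
  apply: le_trans (_ : H n (fun z => (trap (- M%:R) M%:R 1 z.2)%:E) x <= _).
    by apply: le_trans h; rewrite lee_fin; lra.
  apply: le_H => z; first by rewrite lee_fin trap_ge0.
  rewrite /strip /ind lee_fin; apply: (le_trans (trap_le_ind _ _ _ ltr01)).
  rewrite (_ : (- M.+1%:R + N%:R * 1 = M%:R + 1 :> R)%R).
    by rewrite (_ : (- M.+1%:R = - M%:R - 1 :> R)%R)// -natr1 opprD.
  by rewrite /N natrD mulr1 addrA addNr add0r -natr1.
have := le_trans h1 (H_strip_le_top n (- M.+1%:R) N x ler01).
have -> : (- M.+1%:R + N%:R * 1 = M.+1%:R :> R)%R.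
  by rewrite /N natrD mulr1 addrA addNr add0r.
rewrite strip_win muleC -lee_pdivrMr ?ltr0n//.
Qed.

Theorem limit_identity (K : R) : (0 <= K)%R ->
  (forall B : R, (0 < B)%R -> excess mu l B <= (K / B ^+ 3)%:E) ->
  \int[rho]_z phiE z = \int[rho]_(z in [set z | (0 <= z.2)%R]) Q phiE z.
Proof.
move=> K0 hK; apply/eqP; rewrite eq_le integral_Q_le andbT.
(* If the integral of [phi] is zero the missing inequality is trivial; otherwise its positivity
   supplies the lower bound c0 from which the growth estimate starts. *)
have [->|phi_neq0] := eqVneq (\int[rho]_z phiE z) 0.
  by apply: integral_ge0 => z _; exact: nQphi.2.
have [T [c0 [n0 [T0 c00 hT]]]] := win_lower phi_neq0.
have [C1 [n1 hC1]] := H_strip_bounded T ler01.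
have [C2 [n2 hC2]] := H_strip_bounded 0 ler01.
have hT2 n x : (maxn n0 n1 <= n)%N -> c0%:E <= H n (win T) x <= C1%:E.
  by rewrite geq_max => /andP[h1 h2]; rewrite hT//= -strip_win hC1.
have hC3 n x : (n2 <= n)%N -> H n (win 0) x <= C2%:E.
  by move=> h; rewrite -strip_win hC2.
have [D [D0 hD]] := H_win_growth ma mc ml l0 cl K0 hK T0 c00 r01 hT2 hC3.
exact: le_integral_Q D0 hD.
Qed.

End Limit.

(** * Trajectories driven by independent steps *)

Section Independence.
Context {R : realType} {d dG : measure_display}.
Context {Omega : measurableType d} {G : measurableType dG}.
Variables (P : probability Omega R) (mu : probability G R).
Variable g : nat -> Omega -> G.
Hypothesis mg : forall n, measurable_fun setT (g n).
Local Open Scope ereal_scope.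

Definition future (k N : nat) (C : nat -> set G) : set Omega :=
  \bigcap_(i in [set i | (k <= i < k + N)%N]) (g i @^-1` C i).

Hypothesis g_indep : forall (N : nat) (C : nat -> set G),
  (forall i, measurable (C i)) ->
  P (future 0 N C) = \prod_(0 <= i < N) mu (C i).

(** Independence of A from the steps k, k + 1, ... is tested on finite cylinders, whose coordinates
    can be used up one at a time. *)
Definition indep_future (k : nat) (A : set Omega) :=
  forall (N : nat) (C : nat -> set G), (forall i, measurable (C i)) ->
    P (A `&` future k N C) = P A * \prod_(k <= i < k + N) mu (C i).

Lemma measurable_future k N C : (forall i, measurable (C i)) ->
  measurable (future k N C).
Proof.
move=> mC; apply: bigcap_measurableType => i _.
by rewrite -[X in measurable X]setTI; exact: mg.
Qed.

Lemma future0 k C : future k 0 C = setT.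
Proof. by rewrite /future (_ : mkset _ = set0) ?bigcap_set0//; apply/seteqP; split => i //=; lia. Qed.

Lemma futureS k N C : future k N.+1 C = (g k @^-1` C k) `&` future k.+1 N C.
Proof.
apply/seteqP; split => [w h|w [h1 h2] i /= hi].
  by split => [|i /= hi]; apply: h => /=; lia.
by have [->|ik] := eqVneq i k; [exact: h1|apply: h2 => /=; lia].
Qed.

Lemma measure_unique_prod d1 d2 (T1 : measurableType d1) (T2 : measurableType d2)
    (m1 m2 : {measure set (T1 * T2) -> \bar R}) :
  m1 setT < +oo ->
  (forall A B, measurable A -> measurable B -> m1 (A `*` B) = m2 (A `*` B)) ->
  forall X, measurable X -> m1 X = m2 X.
Proof.
move=> m1oo h; pose C := [set A `*` B | A in @measurable _ T1 & B in @measurable _ T2].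
apply: (measure_unique C (fun=> setT)).
- by rewrite measurable_prod_measurableType.
- move=> _ _ [A mA [B mB <-]] [A' mA' [B' mB' <-]].
  by rewrite -setXI; exists (A `&` A'); [exact: measurableI|exists (B `&` B') => //; exact: measurableI].
- by move=> _; exists setT => //; exists setT => //; rewrite setXTT.
- by rewrite bigcup_const.
- by move=> _ [A mA [B mB <-]]; exact: h.
- by [].
Qed.

Definition image_measure d1 d2 (T1 : measurableType d1) (T2 : measurableType d2)
    (m : {measure set T1 -> \bar R}) (f : T1 -> T2) (mf : measurable_fun setT f) :
    {measure set T2 -> \bar R} :=
  measure_function_pushforward__canonical__measure_function_Measure m mf.

(** On rectangles the condition on [g k] joins the future cylinder and the hypothesis at time k
    applies; uniqueness of finite measures extends the identity to all E. *)
Lemma indep_future_next d1 (T : measurableType d1) (Y : Omega -> T) k :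
  measurable_fun setT Y ->
  (forall A, measurable A -> indep_future k (Y @^-1` A)) ->
  forall E : set (T * G), measurable E -> indep_future k.+1 ((fun w => (Y w, g k w)) @^-1` E).
Proof.
move=> mY hY E mE N C mC.
have mYg : measurable_fun setT (fun w => (Y w, g k w)) by exact/measurable_fun_pair.
set B := future k.+1 N C.
have mB : measurable B by exact: measurable_future.
set c := \prod_(k.+1 <= i < k.+1 + N) mu (C i).
have c0 : 0 <= c by apply: prode_ge0 => i _; exact: measure_ge0.
have cfin : c \is a fin_num by apply: prode_fin_num => i _; exact: fin_num_measure.
have c0' : (0 <= fine c)%R by exact: fine_ge0.
pose m1 := image_measure (mrestr P mB) mYg.
pose m2 : {measure set (T * G) -> \bar R} := mscale (NngNum c0') (image_measure P mYg).
transitivity (m2 E); last by rewrite /= /mscale/= fineK// muleC.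
apply: (@measure_unique_prod _ _ _ _ m1 m2) => //.
  rewrite /m1/= /pushforward/= /mrestr; apply: le_lt_trans (ltry 1).
  by apply: probability_le1; apply: measurableI => //; exact: measurableT.
move=> A D mA mD; rewrite /m1 /m2/= /pushforward/= /mrestr /mscale/= fineK//.
rewrite (_ : _ @^-1` (A `*` D) = Y @^-1` A `&` g k @^-1` D)//.
(* With D put at coordinate k, the hypothesis is used twice: with N + 1 steps for the left side, and
   with one step for the factor P (...) on the right. *)
pose C' i := if i == k then D else C i.
have mC' i : measurable (C' i) by rewrite /C'; case: ifP.
have h1 := hY A mA N.+1 C' mC'.
have h2 := hY A mA 1%N (fun=> D) (fun=> mD).
have fE : future k.+1 N C' = B.
  apply: eq_bigcapr => i /= /andP[ki _]; rewrite /C' ifN//.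
  by apply/eqP => ik; rewrite ik ltnn in ki.
rewrite futureS fE {1}/C' eqxx setIA in h1.
rewrite futureS future0 setIT in h2.
have pE : pushforward P (fun w => (Y w, g k w)) (A `*` D) = P (Y @^-1` A `&` g k @^-1` D) by [].
rewrite pE h1 h2 addn1 big_nat1 addnS big_ltn ?ltnS ?leq_addr// {1}/C' eqxx.
rewrite muleA -addSn muleC; congr (_ * _); apply: eq_big_nat => i /andP[ki _].
by rewrite /C' ifN//; apply/eqP => ik; rewrite ik ltnn in ki.
Qed.

Lemma law_pair d1 (T : measurableType d1) (Y : {RV P >-> T}) k :
  (forall A, measurable A -> indep_future k (Y @^-1` A)) ->
  forall E : set (T * G), measurable E ->
    P ((fun w => (Y w, g k w)) @^-1` E) = (distribution P Y \x mu) E.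
Proof.
move=> hY E mE.
have mYg : measurable_fun setT (fun w => (Y w, g k w)) by exact/measurable_fun_pair.
apply/esym/(@product_measure_unique _ _ _ _ _ _ mu (image_measure P mYg)) => //.
move=> A D mA mD; rewrite /= /pushforward/=.
have := hY A mA 1%N (fun=> D) (fun=> mD).
by rewrite futureS future0 setIT addn1 big_nat1.
Qed.

Section Trajectory.
Context {dE : measure_display} {E : measurableType dE}.
Variables (a : E * G -> E) (c : E * G -> R).
Hypothesis (ma : measurable_fun setT a) (mc : measurable_fun setT c).
Local Notation Z := (E * R)%type.

(* The boolean records whether the levels before time n are nonnegative *)
Fixpoint trajectory (z : Z) (n : nat) (w : Omega) : Z * bool :=
  if n is m.+1 then
    let y := trajectory z m w in (step a c y.1 (g m w), y.2 && (0 <= y.1.2)%R)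
  else (z, true).

Let next (y : (Z * bool) * G) : Z * bool :=
  (step a c y.1.1 y.2, y.1.2 && (0 <= y.1.1.2)%R).

Let measurable_next : measurable_fun setT next.
Proof.
have m1 : measurable_fun setT (fun y : (Z * bool) * G => (y.1.1, y.2)).
  apply/measurable_fun_pair => //.
  exact: (measurableT_comp measurable_fst measurable_fst).
have m2 : measurable_fun setT (fun y : (Z * bool) * G => y.1.1.2).
  apply: (measurableT_comp measurable_snd).
  exact: (measurableT_comp measurable_fst measurable_fst).
apply/measurable_fun_pair; first exact: (measurableT_comp (measurable_step2 ma mc) m1).
apply: measurable_and; first exact: (measurableT_comp measurable_snd measurable_fst).
exact: measurable_fun_ler.
Qed.

Lemma measurable_trajectory z n : measurable_fun setT (trajectory z n).
Proof.
elim: n => [|n ih] /=; first exact: measurable_cst.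
have m1 : measurable_fun setT (fun w => (trajectory z n w, g n w)) by exact/measurable_fun_pair.
exact: (measurableT_comp measurable_next m1).
Qed.

Lemma indep_future_trajectory z n A : measurable A ->
  indep_future n (trajectory z n @^-1` A).
Proof.
elim: n A => [|n ih] A mA.
  move=> N C mC; have [zA|zA] := pselect (A (z, true)).
    rewrite (_ : trajectory z 0 @^-1` A = setT); last by apply/seteqP; split.
    by rewrite setTI probability_setT mul1e g_indep.
  rewrite (_ : trajectory z 0 @^-1` A = set0); last by apply/seteqP; split.
  by rewrite set0I measure0 mul0e.
have mE : measurable (next @^-1` A).
  by rewrite -[X in measurable X]setTI; exact: measurable_next.
exact: (indep_future_next (measurable_trajectory z n) ih mE).
Qed.

(** The induction removes the last step: the pair formed by the trajectory at time n and [g n] has a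
    product law, and integrating out [g n] replaces f by [Qp f]. *)
Theorem integral_trajectory n z (f : Z -> \bar R) : nnm f ->
  \int[P]_(w in [set w | (trajectory z n w).2]) f (trajectory z n w).1 =
  iter n (Qp mu a c) f z.
Proof.
move=> nf.
pose F f (y : Z * bool) := if y.2 then f y.1 else 0 : \bar R.
have nF h : nnm h -> nnm (F h).
  by move=> nh; apply: nnm_if => //; exact: (nnm_comp measurable_fst nh).
have FE h m : \int[P]_(w in [set w | (trajectory z m w).2]) h (trajectory z m w).1 =
    \int[P]_w F h (trajectory z m w).
  rewrite integral_mkcond; apply: eq_integral => w _; rewrite patchE /F.
  by case: ifPn => [|/negP h1]; [rewrite inE => ->|case: ifP => // h2; exfalso; apply: h1; rewrite inE].
elim: n f nf => [|n ih] f nf.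
  rewrite FE /F /=; under eq_integral do rewrite /=.
  by rewrite integral_cst// [X in _ * X]probability_setT mule1.
rewrite iterSr -ih ?FE; last exact: nnm_Qp.
pose Y : {RV P >-> (Z * bool)%type} :=
  HB.pack (trajectory z n) (isMeasurableFun.Build _ _ _ _ _ (measurable_trajectory z n)).
have mYg : measurable_fun setT (fun w => (Y w, g n w)).
  by apply/measurable_fun_pair => //; exact: measurable_trajectory.
have [mN N0] := nnm_comp measurable_next (nF f nf).
transitivity (\int[image_measure P mYg]_y (F f \o next) y).
  by rewrite ge0_integral_pushforward.
transitivity (\int[distribution P Y \x mu]_y (F f \o next) y).
  apply: eq_measure_integral => D mD _; apply: law_pair => // A mA.
  exact: indep_future_trajectory.
rewrite fubini_tonelli1//.
transitivity (\int[distribution P Y]_y F (Qp mu a c f) y).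
  apply: eq_integral => y _; rewrite /fubini_F /F /next /Qp /Q/=.
  by case: (y.2) => /=; [case: ifP => // _|]; rewrite integral0.
by rewrite ge0_integral_distribution//; have [] := nF _ (nnm_Qp mu ma mc nf).
Qed.

End Trajectory.

End Independence.

(** * Euclidean norms and the linear group *)

Section EuclideanNorm.
Context {R : realType} {V : euclideanType R}.
Implicit Types (u v w : V) (k : R).

Local Notation dot := (inner (s := V)).

Lemma dotC u v : dot u v = dot v u.
Proof. by rewrite hermC expr0 mul1r. Qed.

Lemma dotDl u v w : dot (u + v) w = dot u w + dot v w.
Proof. by rewrite linearDl. Qed.

Lemma dotZl k u v : dot (k *: u) v = k * dot u v.
Proof. by rewrite linearZl_LR. Qed.

Lemma dotDr u v w : dot w (u + v) = dot w u + dot w v.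
Proof. by rewrite dotC dotDl ![dot _ w]dotC. Qed.

Lemma dotZr k u v : dot v (k *: u) = k * dot v u.
Proof. by rewrite dotC dotZl dotC. Qed.

Lemma dot0l u : dot 0 u = 0. Proof. by rewrite -(scale0r 0) dotZl mul0r. Qed.

Lemma dot_ge0 u : 0 <= dot u u.
Proof.
have [->|u0] := eqVneq u 0; first by rewrite dot0l.
exact/ltW/neq0_dnorm_gt0.
Qed.

Lemma enorm_ge0 v : 0 <= enorm v. Proof. exact: sqrtr_ge0. Qed.

Lemma enorm_sqr v : enorm v ^+ 2 = dot v v.
Proof. by rewrite /enorm sqr_sqrtr// dot_ge0. Qed.

Lemma enorm0 : enorm (0 : V) = 0.
Proof. by rewrite /enorm dot0l sqrtr0. Qed.

Lemma enorm_gt0 v : (0 < enorm v) = (v != 0).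
Proof.
have [->|v0] := eqVneq v 0; first by rewrite enorm0 ltxx.
by rewrite sqrtr_gt0 neq0_dnorm_gt0.
Qed.

Lemma enorm_eq0 v : (enorm v == 0) = (v == 0).
Proof. by apply/negb_inj; rewrite -enorm_gt0 lt_neqAle enorm_ge0 andbT eq_sym. Qed.

Lemma enormN v : enorm (- v) = enorm v.
Proof. by rewrite -scaleN1r enormZ normrN1 mul1r. Qed.

Lemma enormB v w : enorm (v - w) = enorm (w - v).
Proof. by rewrite -enormN opprB. Qed.

Lemma cauchy_schwarz u v : `|dot u v| <= enorm u * enorm v.
Proof.
have [->|v0] := eqVneq v 0; first by rewrite dotC dot0l normr0 enorm0 mulr0.
have p : 0 < dot v v by exact: neq0_dnorm_gt0.
have h := dot_ge0 (dot v v *: u - dot u v *: v).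
have e : dot (dot v v *: u - dot u v *: v) (dot v v *: u - dot u v *: v) =
    dot v v * (dot u u * dot v v - dot u v ^+ 2).
  rewrite -scaleNr dotDl !dotDr !dotZl !dotZr (dotC v u); ring.
rewrite e pmulr_rge0// subr_ge0 in h.
rewrite -(ler_pXn2r (ltn0Sn 1)) ?nnegrE ?mulr_ge0 ?enorm_ge0//.
by rewrite exprMn !enorm_sqr real_normK ?num_real.
Qed.

Lemma enormD u v : enorm (u + v) <= enorm u + enorm v.
Proof.
rewrite -(ler_pXn2r (ltn0Sn 1)) ?nnegrE ?addr_ge0 ?enorm_ge0//.
rewrite sqrrD !enorm_sqr dotDl !dotDr (dotC v u).
have := ler_norm (dot u v); have := cauchy_schwarz u v; rewrite -mulr_natr; lra.
Qed.

Lemma enorm_triangle u v w : enorm (u - w) <= enorm (u - v) + enorm (v - w).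
Proof. by apply: le_trans (enormD _ _); rewrite addrA subrK. Qed.

Lemma enorm_dist u v : `|enorm u - enorm v| <= enorm (u - v).
Proof.
rewrite ler_norml lerBlDr lerNl opprB lerBlDr; apply/andP; split.
  by rewrite enormB -{1}(subrK u v) enormD.
by rewrite -{1}(subrK v u) enormD.
Qed.

Lemma enorm_sum (I : Type) (r : seq I) (F : I -> V) :
  enorm (\sum_(i <- r) F i) <= \sum_(i <- r) enorm (F i).
Proof.
elim: r => [|i r ih]; first by rewrite !big_nil enorm0.
by rewrite !big_cons; apply: le_trans (enormD _ _) _; rewrite lerD2l.
Qed.

Local Notation n := (\dim (@fullv R V)).
Local Notation b := (vbasis (@fullv R V)).

Definition of_coord (c : 'rV[R]_n) : V := \sum_(i < n) c 0 i *: b`_i.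

Definition to_coord v : 'rV[R]_n := \row_i coord b i v.

Lemma to_coordK v : of_coord (to_coord v) = v.
Proof.
rewrite [RHS](coord_vbasis (memvf v)).
by apply: eq_bigr => i _; rewrite mxE.
Qed.

Lemma of_coordK c : to_coord (of_coord c) = c.
Proof.
apply/rowP => i; rewrite mxE /of_coord coord_sum_free//.
exact: basis_free (vbasisP _).
Qed.

Lemma of_coordB c c' : of_coord (c - c') = of_coord c - of_coord c'.
Proof.
rewrite /of_coord -sumrB; apply: eq_bigr => i _.
by rewrite !mxE scalerBl.
Qed.

Lemma of_coord_le : exists2 C : R, 0 < C & forall (c : 'rV[R]_n) (B : R),
  (forall i, `|c 0 i| <= B) -> enorm (of_coord c) <= C * B.
Proof.
exists (1 + \sum_(i < n) enorm b`_i).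
  by rewrite ltr_pwDl// sumr_ge0// => i _; exact: enorm_ge0.
move=> c B cB; apply: le_trans (enorm_sum _ _) _.
have B0 : 0 <= B.
  by apply: le_trans (cB (Ordinal (dimv_gt0 (s := V)))).
rewrite mulrDl mul1r -[leLHS]add0r lerD// mulr_suml ler_sum// => i _.
by rewrite enormZ mulrC; apply: ler_wpM2l; [exact: enorm_ge0|exact: cB].
Qed.

Lemma dot_suml (I : Type) (r : seq I) (F : I -> V) v :
  dot (\sum_(i <- r) F i) v = \sum_(i <- r) dot (F i) v.
Proof. by apply: (big_morph (fun u => dot u v)) => [u w|]; rewrite ?dotDl ?dot0l. Qed.

(* Through the invertible Gram matrix, coordinates are recovered from scalar
   products with the basis. *)
Lemma coord_le : exists2 C : R, 0 < C &
  forall v (i : 'I_n), `|coord b i v| <= C * enorm v.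
Proof.
pose A := \matrix_(i < n, j < n) dot b`_i b`_j.
have dotE v (j : 'I_n) : dot v b`_j = (to_coord v *m A) 0 j.
  rewrite -{1}(to_coordK v) /of_coord mxE dot_suml.
  by apply: eq_bigr => i _; rewrite dotZl !mxE.
have uA : A \in unitmx.
  rewrite -row_free_unit; apply: inj_row_free => c cA.
  rewrite -(of_coordK c); suff -> : of_coord c = 0.
    by apply/rowP => i; rewrite !mxE linear0.
  apply/eqP; rewrite -enorm_eq0 -sqrf_eq0 enorm_sqr {2}/of_coord.
  rewrite dotC dot_suml big1// => i _.
  by rewrite dotZl dotC dotE of_coordK cA mxE mulr0.
exists (1 + \sum_(i < n) \sum_(j < n) enorm b`_j * `|invmx A j i|).
  by rewrite ltr_pwDl// !sumr_ge0// => i _; rewrite sumr_ge0// => j _; rewrite mulr_ge0// enorm_ge0.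
move=> v i.
have -> : coord b i v = (to_coord v *m A *m invmx A) 0 i by rewrite mulmxK// mxE.
rewrite mxE; apply: le_trans (ler_norm_sum _ _ _) _.
have S0 (k : 'I_n) : 0 <= \sum_(j < n) enorm b`_j * `|invmx A j k|.
  by rewrite sumr_ge0// => j _; rewrite mulr_ge0// enorm_ge0.
apply: (@le_trans _ _ ((\sum_(j < n) enorm b`_j * `|invmx A j i|) * enorm v)).
  rewrite mulr_suml ler_sum// => j _; rewrite normrM -dotE mulrAC.
  by apply: ler_wpM2r => //; rewrite mulrC cauchy_schwarz.
apply: ler_wpM2r; first exact: enorm_ge0.
by rewrite [X in _ <= 1 + X](bigD1 i)//= addrCA lerDl addr_ge0// sumr_ge0.
Qed.

Section Operators.
Implicit Types f h : 'End(V).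

Lemma opnorm_bounded f : exists2 C : R, 0 < C & forall v, enorm (f v) <= C * enorm v.
Proof.
have [C C0 hC] := coord_le.
exists (1 + C * \sum_(i < n) enorm (f b`_i)).
  by rewrite ltr_pwDl// mulr_ge0 ?(ltW C0)// sumr_ge0// => i _; exact: enorm_ge0.
move=> v; rewrite {1}(coord_vbasis (memvf v)) linear_sum.
apply: le_trans (enorm_sum _ _) _.
apply: (@le_trans _ _ (C * (\sum_(i < n) enorm (f b`_i)) * enorm v)).
  rewrite mulrAC mulr_sumr ler_sum// => i _; rewrite linearZ enormZ.
  by apply: ler_wpM2r; [exact: enorm_ge0|exact: hC].
by rewrite ler_wpM2r ?enorm_ge0// lerDr.
Qed.

Let opset f : has_sup [set enorm (f v) | v in [set v | enorm v <= 1]].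
Proof.
have [C C0 hC] := opnorm_bounded f; split.
  by exists (enorm (f 0)), 0 => //=; rewrite enorm0.
exists C => _ [v /= v1 <-]; apply: (le_trans (hC v)).
by rewrite -[leRHS]mulr1 ler_wpM2l// ltW.
Qed.

Lemma opnorm_le f v : enorm (f v) <= opnorm f * enorm v.
Proof.
have [->|v0] := eqVneq v 0; first by rewrite linear0 enorm0 mulr0.
have p : 0 < enorm v by rewrite enorm_gt0.
have : enorm (f ((enorm v)^-1 *: v)) <= opnorm f.
  apply: sup_upper_bound; first exact: opset.
  exists ((enorm v)^-1 *: v) => //=.
  by rewrite enormZ ger0_norm ?invr_ge0 ?enorm_ge0// mulVf// gt_eqF.
by rewrite linearZ enormZ ger0_norm ?invr_ge0 ?enorm_ge0// mulrC ler_pdivrMr.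
Qed.

Lemma opnorm_ge0 f : 0 <= opnorm f.
Proof.
apply: (@le_trans _ _ (enorm (f 0))); first exact: enorm_ge0.
by apply: sup_upper_bound; [exact: opset|exists 0 => //=; rewrite enorm0].
Qed.

Lemma opnorm_lub f (B : R) : 0 <= B -> (forall v, enorm (f v) <= B * enorm v) ->
  opnorm f <= B.
Proof.
move=> B0 hB; apply: sup_le_ub; first by have [] := opset f.
move=> _ [v /= v1 <-]; apply: (le_trans (hB v)).
by rewrite -[leRHS]mulr1 ler_wpM2l.
Qed.

Lemma opnormD f h : opnorm (f + h) <= opnorm f + opnorm h.
Proof.
apply: opnorm_lub => [|v]; first by rewrite addr_ge0 ?opnorm_ge0.
rewrite add_lfunE mulrDl; apply: le_trans (enormD _ _) _.
by rewrite lerD ?opnorm_le.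
Qed.

Lemma opnorm_gt_exists f (B : R) : 0 <= B -> B < opnorm f ->
  exists v, B * enorm v < enorm (f v).
Proof.
move=> B0 Bf; apply: contrapT => h.
suff : opnorm f <= B by rewrite leNgt Bf.
by apply: opnorm_lub => // v; rewrite leNgt; apply/negP => hv; apply: h; exists v.
Qed.

End Operators.

Section LinearGroup.
Implicit Types f g : GL V.

Lemma GL_inj g : injective (GLfun g).
Proof. exact/lker0P/GL_ker0. Qed.

Lemma GL_neq0 g v : v != 0 -> GLfun g v != 0.
Proof. by apply: contra => /eqP gv; apply/eqP/(@GL_inj g); rewrite gv linear0. Qed.

Lemma GL_inv_le g v : enorm v <= opnorm (GLfun g)^-1%VF * enorm (GLfun g v).
Proof. by rewrite -{1}(lker0_lfunK (GL_ker0 g) v) opnorm_le. Qed.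

(** The logarithm of the function in the exponential moment; it dominates the cocycle in every
    direction and plays the part of [l]. *)
Definition lognorm g : R := ln (Num.max (opnorm (GLfun g)) (opnorm (GLfun g)^-1%VF)).

(** The product of the two operator norms is at least 1, as seen on any nonzero vector. *)
Lemma maxnorm_ge1 g : 1 <= Num.max (opnorm (GLfun g)) (opnorm (GLfun g)^-1%VF).
Proof.
have v0 : vpick (@fullv R V) != 0 by rewrite vpick0 -dimv_eq0 -lt0n dimv_gt0.
set v := vpick _ in v0.
have p : 0 < enorm v by rewrite enorm_gt0.
rewrite leNgt gt_max; apply/negP => /andP[h1 h2].
have := GL_inv_le g v; have := opnorm_le (GLfun g) v.
have := opnorm_ge0 (GLfun g); have := opnorm_ge0 (GLfun g)^-1%VF.
have := enorm_ge0 (GLfun g v).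
set a := opnorm _ in h1 *; set c := opnorm _ in h2 *; set y := enorm (GLfun g v).
nra.
Qed.

Lemma lognorm_ge0 g : 0 <= lognorm g.
Proof. exact/ln_ge0/maxnorm_ge1. Qed.

Lemma expR_lognorm g : expR (lognorm g) = Num.max (opnorm (GLfun g)) (opnorm (GLfun g)^-1%VF).
Proof. by rewrite /lognorm lnK// posrE (lt_le_trans ltr01)// maxnorm_ge1. Qed.

Lemma opnorm_le_exp g : opnorm (GLfun g) <= expR (lognorm g).
Proof. by rewrite expR_lognorm le_max lexx. Qed.

Lemma opnorm_inv_le_exp g : opnorm (GLfun g)^-1%VF <= expR (lognorm g).
Proof. by rewrite expR_lognorm le_max lexx orbT. Qed.

Lemma line_neq0 (x : projective V) v : line x = <[v]>%VS -> v != 0.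
Proof. by move=> xv; have := dim_line x; rewrite xv dim_vline eqb1. Qed.

Lemma line_act g (x : projective V) v : line x = <[v]>%VS ->
  line (act g x) = <[GLfun g v]>%VS.
Proof. by move=> xv; rewrite /act/= xv limg_line. Qed.

Lemma line_pick (x : projective V) : line x = <[vpick (line x)]>%VS.
Proof.
apply/eqP; rewrite eq_sym eqEdim -memvE memv_pick (eqP (dim_line x)).
by rewrite dim_vline vpick0 -dimv_eq0 (eqP (dim_line x)).
Qed.

Lemma cocycle_mul f g (x : projective V) :
  cocycle (GLmul f g) x = cocycle f (act g x) + cocycle g x.
Proof.
have xv := line_pick x; set v := vpick _ in xv; have v0 := line_neq0 xv.
rewrite (cocycleE _ xv) (cocycleE _ (line_act g xv)) (cocycleE g xv)/= comp_lfunE.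
have p1 : 0 < enorm v by rewrite enorm_gt0.
have p2 : 0 < enorm (GLfun g v) by rewrite enorm_gt0 GL_neq0.
have p3 : 0 < enorm (GLfun f (GLfun g v)) by rewrite enorm_gt0 !GL_neq0.
rewrite -lnM ?posrE ?divr_gt0//; congr ln; field.
by rewrite !gt_eqF.
Qed.

Lemma act_mul f g (x : projective V) : act (GLmul f g) x = act f (act g x).
Proof. by apply: line_inj => /=; rewrite limg_comp. Qed.

Lemma act1 (x : projective V) : act GL1 x = x.
Proof. by apply: line_inj => /=; rewrite lim1g. Qed.

Lemma cocycle1 (x : projective V) : cocycle GL1 x = 0.
Proof.
rewrite (cocycleE _ (line_pick x))/= id_lfunE divff ?ln1//.
by rewrite enorm_eq0; exact: line_neq0 (line_pick x).
Qed.

Lemma cocycle_le g (x : projective V) : `|cocycle g x| <= lognorm g.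
Proof.
have xv := line_pick x; set v := vpick _ in xv; have v0 := line_neq0 xv.
rewrite (cocycleE _ xv).
have p1 : 0 < enorm v by rewrite enorm_gt0.
have p2 : 0 < enorm (GLfun g v) by rewrite enorm_gt0 GL_neq0.
rewrite ler_norml; apply/andP; split.
  rewrite lerNl -lnV ?posrE ?divr_gt0// -(ler_expR) expR_lognorm lnK ?posrE ?invr_gt0 ?divr_gt0//.
  rewrite invf_div le_max ler_pdivrMr//; apply/orP; right; rewrite ler_pdivrMr//.
  exact: GL_inv_le.
rewrite -ler_expR expR_lognorm lnK ?posrE ?divr_gt0// le_max ler_pdivrMr//.
by apply/orP; left; exact: opnorm_le.
Qed.

End LinearGroup.

End EuclideanNorm.

(** * The projective space as a compact metric space *)

Section ProjectiveMetric.
Context {R : realType} {V : euclideanType R}.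
Implicit Types (u v w : V) (x y z : projective V).


Definition unit_vec x : V := (enorm (vpick (line x)))^-1 *: vpick (line x).

Lemma enorm_normalize v : v != 0 -> enorm ((enorm v)^-1 *: v) = 1.
Proof.
by move=> v0; rewrite enormZ ger0_norm ?invr_ge0 ?enorm_ge0// mulVf// enorm_eq0.
Qed.

Lemma enorm_unit x : enorm (unit_vec x) = 1.
Proof. by apply: enorm_normalize; exact: line_neq0 (line_pick x). Qed.

Lemma vlineZ k v : k != 0 -> <[k *: v]>%VS = <[v]>%VS :> {vspace V}.
Proof.
move=> k0; apply/eqP; rewrite eqEsubv -!memvE; apply/andP; split.
  by rewrite memvZ// memv_line.
by rewrite -[X in X \in _](scalerK k0) memvZ// memv_line.
Qed.

Lemma line_unit x : line x = <[unit_vec x]>%VS.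
Proof.
rewrite [LHS]line_pick /unit_vec vlineZ// invr_eq0 enorm_eq0.
exact: line_neq0 (line_pick x).
Qed.

(** The chordal distance between lines: the sign of the unit vectors is immaterial. *)
Definition pdist x y : R :=
  Num.min (enorm (unit_vec x - unit_vec y)) (enorm (unit_vec x + unit_vec y)).

Lemma unit_rep x v : line x = <[v]>%VS -> enorm v = 1 -> v = unit_vec x \/ v = - unit_vec x.
Proof.
move=> xv v1; have : v \in <[unit_vec x]>%VS by rewrite -line_unit xv memv_line.
move=> /vlineP[k kv]; move: v1; rewrite kv enormZ enorm_unit mulr1 => /eqP.
by rewrite eqr_norml => /andP[/orP[/eqP ->|/eqP ->] _]; [left; rewrite scale1r|right; rewrite scaleN1r].
Qed.

Lemma pdist_le_unit x y v w : line x = <[v]>%VS -> line y = <[w]>%VS ->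
  enorm v = 1 -> enorm w = 1 -> pdist x y <= enorm (v - w).
Proof.
move=> xv yw v1 w1; rewrite /pdist ge_min.
case: (unit_rep xv v1) => ->; case: (unit_rep yw w1) => ->.
- by rewrite lexx.
- by rewrite opprK lexx orbT.
- by rewrite -opprD enormN lexx orbT.
- by rewrite -opprD enormN lexx.
Qed.

(** Rescaling w to the norm of v costs at most another |v - w|, whence the factor 2. *)
Lemma pdist_le x y v w : line x = <[v]>%VS -> line y = <[w]>%VS ->
  pdist x y <= 2 * enorm (v - w) / enorm v.
Proof.
move=> xv yw; have v0 := line_neq0 xv; have w0 := line_neq0 yw.
have p : 0 < enorm v by rewrite enorm_gt0.
have q : 0 < enorm w by rewrite enorm_gt0.
have nv : (enorm v)^-1 != 0 by rewrite invr_eq0 gt_eqF.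
have nw : (enorm w)^-1 != 0 by rewrite invr_eq0 gt_eqF.
apply: (@le_trans _ _ (enorm ((enorm v)^-1 *: v - (enorm w)^-1 *: w))).
  by apply: pdist_le_unit; rewrite ?vlineZ// enorm_normalize.
rewrite ler_pdivlMr// (_ : _ * enorm v = enorm (v - (enorm v / enorm w) *: w)); last first.
  by rewrite -{2}(ger0_norm (ltW p)) mulrC -enormZ scalerBr !scalerA divff ?gt_eqF// scale1r.
apply: (le_trans (enorm_triangle _ w _)); rewrite mulr_natl mulr2n lerD2l.
rewrite -{1}[w]scale1r -scalerBl enormZ -[X in _ * X](ger0_norm (ltW q)) -normrM.
by rewrite mulrBl mul1r divfK ?gt_eqF// distrC enorm_dist.
Qed.

Lemma pdist_ge0 x y : 0 <= pdist x y.
Proof. by rewrite le_min !enorm_ge0. Qed.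

Lemma pdistxx x : pdist x x = 0.
Proof. by apply/eqP; rewrite eq_le pdist_ge0 andbT ge_min subrr enorm0 lexx. Qed.

Lemma pdistC x y : pdist x y = pdist y x.
Proof. by rewrite /pdist enormB [unit_vec x + _]addrC. Qed.

(** The minimum is attained by a unit vector of y adapted to any given unit vector of x. Such
    choices can be chained, which yields the triangle inequality and the Lipschitz estimates. *)
Lemma pdist_rep x y v : line x = <[v]>%VS -> enorm v = 1 ->
  exists w, [/\ line y = <[w]>%VS, enorm w = 1 & pdist x y = enorm (v - w)].
Proof.
move=> xv v1.
suff [s s1 h] : exists2 s : R, `|s| = 1 & pdist x y = enorm (unit_vec x - s *: unit_vec y).
  have sn : s != 0 by rewrite -normr_eq0 s1 oner_neq0.
  case: (unit_rep xv v1) => ->.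
    exists (s *: unit_vec y); split => //; first by rewrite vlineZ// line_unit.
    by rewrite enormZ s1 enorm_unit mulr1.
  exists (- s *: unit_vec y); split; first by rewrite vlineZ ?oppr_eq0// line_unit.
    by rewrite enormZ normrN s1 enorm_unit mulr1.
  by rewrite h scaleNr -opprD enormN.
have [h|h] := leP (enorm (unit_vec x - unit_vec y)) (enorm (unit_vec x + unit_vec y)).
  by exists 1; rewrite ?normr1// scale1r /pdist min_l.
by exists (-1); rewrite ?normrN1// scaleN1r opprK /pdist min_r// ltW.
Qed.

Lemma pdist_triangle x y z : pdist x z <= pdist x y + pdist y z.
Proof.
have [w [yw w1 ->]] := pdist_rep y (line_unit x) (enorm_unit x).
have [t [zt t1 ->]] := pdist_rep z yw w1.
apply: le_trans (enorm_triangle _ w _).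
exact: pdist_le_unit (line_unit x) zt (enorm_unit x) t1.
Qed.

Lemma proj_openP (A : set (projective V)) : open A <->
  forall x, A x -> exists2 e : R, 0 < e & forall y, pdist x y < e -> A y.
Proof.
split => [oA x Ax|h].
  have [e e0 he] : exists2 e : R, 0 < e & forall w, enorm (w - unit_vec x) < e -> cone A w.
    have oA' : forall v, cone A v ->
      exists2 e : R, 0 < e & forall w, enorm (w - v) < e -> cone A w := oA.
    by apply: oA'; exists x => //; exact: line_unit.
  exists e => // y xy; have [w [yw w1 xyE]] := pdist_rep y (line_unit x) (enorm_unit x).
  have [y' Ay' y'w] : cone A w by apply: he; rewrite enormB -xyE.
  by rewrite (_ : y = y')//; apply: line_inj; rewrite yw y'w.
suff: vopen (cone A) by [].
move=> v [x Ax xv].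
have v0 := line_neq0 xv; have p : 0 < enorm v by rewrite enorm_gt0.
have [e e0 he] := h x Ax.
(* The first bound keeps w away from 0, the second turns [pdist_le] into a distance below e. *)
exists (Num.min (enorm v) (e * enorm v / 2)); first by rewrite lt_min p divr_gt0 ?mulr_gt0.
move=> w; rewrite lt_min => /andP[h1 h2].
have w0 : w != 0 by apply: contraTneq h1 => ->; rewrite sub0r enormN ltxx.
have wl : \dim <[w]>%VS == 1%N by rewrite dim_vline w0.
exists (MkProj wl) => //; apply: he.
apply: (le_lt_trans (pdist_le xv (erefl : line (MkProj wl) = <[w]>%VS))).
by rewrite ltr_pdivrMr// enormB; lra.
Qed.

End ProjectiveMetric.

Section ProjectiveSpace.
Context {R : realType} {V : euclideanType R}.
Implicit Types (u v w : V) (x y z : projective V) (f g : GL V).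

Lemma open_pdist_ball x (e : R) : open [set y | pdist x y < e].
Proof.
apply/proj_openP => y /= xy; exists (e - pdist x y); first by rewrite subr_gt0.
by move=> z yz; apply: le_lt_trans (pdist_triangle _ y _) _; rewrite -ltrBrDl.
Qed.

Lemma of_coord_near (c : 'rV[R]_(\dim (@fullv R V))) (e : R) : 0 < e ->
  \forall c' \near c, enorm (of_coord c - of_coord c' : V) < e.
Proof.
move=> e0; have [C C0 hC] := @of_coord_le R V.
have d0 : 0 < e / (2 * C) by rewrite divr_gt0 ?mulr_gt0.
apply: filterS (nbhsx_ballx c _ d0) => c' cc'.
rewrite -of_coordB; apply: (@le_lt_trans _ _ (C * (e / (2 * C)))).
  apply: hC => i; rewrite !mxE; apply/ltW.
  by case: cc' => _ /(_ 0 i); rewrite -ball_normE/=.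
by rewrite (_ : C * _ = e / 2); [lra|field; rewrite gt_eqF].
Qed.

(** In coordinates the sphere is closed, and [coord_le] places it in a box. *)
Lemma compact_unit_sphere :
  compact [set c : 'rV[R]_(\dim (@fullv R V)) | enorm (of_coord c : V) = 1].
Proof.
have [C C0 hC] := @coord_le R V.
have cK : compact [set c : 'rV[R]_(\dim (@fullv R V)) | forall i, c ord0 i \in `[- C, C]].
  by apply: (@rV_compact _ _ (fun=> `[- C, C]%classic)) => _; exact: segment_compact.
have cont : continuous (fun c : 'rV[R]_(\dim (@fullv R V)) => enorm (of_coord c : V)).
  move=> c; apply/(@cvgrPdist_lt _ R _ (nbhs c) (nbhs_filter c)) => e e0.
  apply: filterS (of_coord_near c e0) => c'.
  exact: le_lt_trans (enorm_dist _ _).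
apply: (subclosed_compact _ cK).
  apply: (@preimage_closed _ _ (fun c => enorm (of_coord c : V)) [set 1]).
  2: exact/accessible_closed_set1/hausdorff_accessible/Rhausdorff.
  by move=> c _; exact: cont.
move=> c /= c1 i; rewrite in_itv/= -ler_norml.
have := hC (of_coord c) i; rewrite c1 mulr1.
suff -> : coord (vbasis fullv) i (of_coord c : V) = c ord0 i by [].
by rewrite -[in RHS](@of_coordK R V c) mxE.
Qed.

(** The default line is taken only at the zero vector, off the sphere. *)
Definition coord_line (c : 'rV[R]_(\dim (@fullv R V))) : projective V :=
  insubd (point : projective V) <[of_coord c : V]>%VS.

Lemma line_coord c : of_coord c != 0 :> V -> line (coord_line c) = <[of_coord c : V]>%VS.
Proof. by move=> c0; rewrite /coord_line insubdK// unfold_in/= dim_vline c0. Qed.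

Lemma compact_projective : compact [set: projective V].
Proof.
rewrite (_ : setT = coord_line @` [set c | enorm (of_coord c : V) = 1]); last first.
  apply/seteqP; split => // x _; exists (to_coord (unit_vec x)).
    by rewrite /= to_coordK enorm_unit.
  apply: line_inj; rewrite line_coord to_coordK -?line_unit//.
  by rewrite -enorm_gt0 enorm_unit.
apply: continuous_compact; last exact: compact_unit_sphere.
apply/subspace_continuousP => c c1 A; rewrite nbhs_simpl nbhsE => -[B [oB Bc BA]].
have [e e0 he] := (proj_openP B).1 oB _ Bc.
have nz c' : enorm (of_coord c' : V) = 1 -> of_coord c' != 0 :> V.
  by move=> c'1; rewrite -enorm_gt0 c'1.
apply: filterS (of_coord_near c e0) => c' cc' c'1; apply: BA; apply: he.
apply: le_lt_trans (pdist_le_unit (line_coord (nz _ c1)) (line_coord (nz _ c'1)) c1 c'1) _.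
exact: cc'.
Qed.

Lemma projective_dense : exists y : nat -> projective V,
  forall x (e : R), 0 < e -> exists k, pdist (y k) x < e.
Proof.
have net (n : nat) : exists s : seq (projective V),
    forall x, exists2 y, y \in s & pdist y x < n.+1%:R^-1.
  have := compact_projective; rewrite compact_cover => /(_ _ setT
    (fun y => [set x | pdist y x < n.+1%:R^-1])).
  case=> [y _|x _|D _ hD]; first exact: open_pdist_ball.
    by exists x => //=; rewrite pdistxx.
  exists (finmap.enum_fset D) => x; have [y /= yD xy] := hD x I.
  by exists y.
have [s hs] := choice net.
(* The finite nets for all radii 1 / (n + 1) are listed in one sequence through the encoding of the
   pairs (n, i). *)
pose y k := if unpickle k is Some (n, i) then nth point (s n) i else point.
exists y => x e e0.
pose n := Num.truncn e^-1.
have [z zs xz] := hs n x; exists (pickle (n, index z (s n))).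
rewrite /y pickleK nth_index//; apply: lt_le_trans xz _.
rewrite -[leRHS]invrK lef_pV2 ?posrE ?invr_gt0//.
by apply/ltW; exact: truncnS_gt.
Qed.

Lemma act_pdist g x y :
  pdist (act g x) (act g y) <= 2 * expR (lognorm g) ^+ 2 * pdist x y.
Proof.
have [w [yw w1 ->]] := pdist_rep y (line_unit x) (enorm_unit x).
set v := unit_vec x.
have xv : line x = <[v]>%VS by exact: line_unit.
have v1 : enorm v = 1 by exact: enorm_unit.
apply: le_trans (pdist_le (line_act g xv) (line_act g yw)) _.
have p : 0 < enorm (GLfun g v) by rewrite enorm_gt0 GL_neq0// -enorm_gt0 v1.
rewrite ler_pdivrMr// -linearB/=.
have h1 := le_trans (opnorm_le (GLfun g) (v - w)) (ler_wpM2r (enorm_ge0 _) (opnorm_le_exp g)).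
have := le_trans (GL_inv_le g v) (ler_wpM2r (enorm_ge0 _) (opnorm_inv_le_exp g)).
rewrite v1 => h2; have E := expR_gt0 (lognorm g).
have := ler_wpM2l (mulr_ge0 (ltW E) (enorm_ge0 (v - w))) h2.
rewrite mulr1 expr2; nra.
Qed.

Lemma ln_enorm_le v w (C : R) : w != 0 -> v != 0 -> 0 <= C -> 1 <= C * enorm w -> 
  ln (enorm v) - ln (enorm w) <= C * enorm (v - w).
Proof.
move=> w0 v0 C0 Cw.
have p : 0 < enorm w by rewrite enorm_gt0.
have q : 0 < enorm v by rewrite enorm_gt0.
rewrite -ln_div ?posrE//.
apply: (@le_trans _ _ ((enorm v - enorm w) / enorm w)).
  have -> : enorm v / enorm w = 1 + (enorm v - enorm w) / enorm w.
    by field; rewrite gt_eqF.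
  apply: le_ln1Dx; rewrite mulrBl divff ?gt_eqF// ltrBrDl subrr divr_gt0//.
rewrite ler_pdivrMr// mulrAC; apply: (@le_trans _ _ (1 * enorm (v - w))).
  by rewrite mul1r (le_trans (ler_norm _))// enorm_dist.
by rewrite ler_wpM2r ?enorm_ge0.
Qed.

Lemma cocycle_unit g x v : line x = <[v]>%VS -> enorm v = 1 ->
  cocycle g x = ln (enorm (GLfun g v)).
Proof. by move=> xv v1; rewrite (cocycleE g xv) v1 divr1. Qed.

Lemma cocycle_pdist g x y :
  `|cocycle g x - cocycle g y| <= expR (lognorm g) ^+ 2 * pdist x y.
Proof.
suff le x' y' : cocycle g x' - cocycle g y' <= expR (lognorm g) ^+ 2 * pdist x' y'.
  by rewrite ler_norml lerNl opprB [pdist x y]pdistC le [pdist y x]pdistC le.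
have [w [yw w1 ->]] := pdist_rep y' (line_unit x') (enorm_unit x').
set v := unit_vec x'; have xv : line x' = <[v]>%VS by exact: line_unit.
have v1 : enorm v = 1 by exact: enorm_unit.
rewrite (cocycle_unit g xv v1) (cocycle_unit g yw w1).
have h2 := le_trans (GL_inv_le g w) (ler_wpM2r (enorm_ge0 _) (opnorm_inv_le_exp g)).
rewrite w1 in h2.
apply: le_trans (ln_enorm_le _ _ (expR_ge0 _) h2) _; rewrite ?GL_neq0 -?enorm_gt0 ?v1 ?w1//.
rewrite expr2 -mulrA; apply: ler_wpM2l; first exact: expR_ge0.
rewrite -linearB; apply: le_trans (opnorm_le _ _) _.
by rewrite ler_wpM2r ?enorm_ge0// opnorm_le_exp.
Qed.

Lemma act_opnorm f g x :
  pdist (act f x) (act g x) <= 2 * expR (lognorm f) * opnorm (GLfun f - GLfun g).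
Proof.
set v := unit_vec x; have xv : line x = <[v]>%VS by exact: line_unit.
have v1 : enorm v = 1 by exact: enorm_unit.
apply: le_trans (pdist_le (line_act f xv) (line_act g xv)) _.
have p : 0 < enorm (GLfun f v) by rewrite enorm_gt0 GL_neq0// -enorm_gt0 v1.
rewrite ler_pdivrMr//.
have h2 := le_trans (GL_inv_le f v) (ler_wpM2r (enorm_ge0 _) (opnorm_inv_le_exp f)).
have h1 := opnorm_le (GLfun f - GLfun g) v.
rewrite add_lfunE opp_lfunE v1 mulr1 in h1; rewrite v1 in h2.
have := ler_wpM2l (opnorm_ge0 (GLfun f - GLfun g)) h2; rewrite mulr1; nra.
Qed.

Lemma opnormN (f : 'End(V)) : opnorm (- f) = opnorm f.
Proof.
by rewrite /opnorm; congr sup; apply: eq_imagel => v _; rewrite opp_lfunE enormN.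
Qed.

Lemma cocycle_opnorm f g x : 2 * expR (lognorm f) * opnorm (GLfun f - GLfun g) <= 1 ->
  `|cocycle f x - cocycle g x| <= 2 * expR (lognorm f) * opnorm (GLfun f - GLfun g).
Proof.
move=> fg.
set v := unit_vec x; have xv : line x = <[v]>%VS by exact: line_unit.
have v1 : enorm v = 1 by exact: enorm_unit.
have v0 : v != 0 by rewrite -enorm_gt0 v1.
rewrite !(cocycle_unit _ xv v1).
have hf := le_trans (GL_inv_le f v) (ler_wpM2r (enorm_ge0 _) (opnorm_inv_le_exp f)).
have hd : enorm (GLfun f v - GLfun g v) <= opnorm (GLfun f - GLfun g).
  by have := opnorm_le (GLfun f - GLfun g) v; rewrite add_lfunE opp_lfunE v1 mulr1.
(* The smallness hypothesis costs at most half of the lower bound for |f v|, so |g v| stays away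
   from 0. *)
have hg : 1 <= 2 * expR (lognorm f) * enorm (GLfun g v).
  have := le_trans (ler_norm _) (enorm_dist (GLfun f v) (GLfun g v)).
  by rewrite v1 in hf; have := expR_gt0 (lognorm f); nra.
have E0 : 0 <= 2 * expR (lognorm f) by rewrite mulr_ge0 ?expR_ge0.
rewrite ler_norml lerNl opprB; apply/andP; split.
  apply: le_trans (ln_enorm_le (C := 2 * expR (lognorm f)) _ _ _ _) _; rewrite ?GL_neq0//.
    by rewrite v1 in hf; have := enorm_ge0 (GLfun f v); have := expR_gt0 (lognorm f); nra.
  by rewrite enormB ler_wpM2l.
apply: le_trans (ln_enorm_le (C := 2 * expR (lognorm f)) _ _ _ hg) _; rewrite ?GL_neq0//.
by rewrite ler_wpM2l.
Qed.

End ProjectiveSpace.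

(** * Measurability of the action *)

Section Measurability.
Context {R : realType} {V : euclideanType R}.
Implicit Types (u v w : V) (x y z : projective V) (f g : GL V).

Lemma borel_open (T : ptopologicalType) (A : set (borel T)) :
  open (A : set T) -> measurable A.
Proof. exact: sub_sigma_algebra. Qed.

Lemma measurable_to_borel d (X : measurableType d) (T : ptopologicalType)
    (f : X -> borel T) :
  (forall A : set T, open A -> measurable (f @^-1` A)) -> measurable_fun setT f.
Proof.
move=> h; apply: (@measurability _ _ X (borel T) setT f (@open T) erefl).
by move=> _ [A oA <-]; rewrite setTI; exact: h.
Qed.

Lemma measurable_borel_real (T : ptopologicalType) (f : borel T -> R) :
  (forall (A : set R), open A -> open (f @^-1` A : set T)) -> measurable_fun setT f.
Proof.
move=> h mD; apply: (measurability _ (RGenOpens.measurableE R)) => //.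
move=> _ [_ [a [b ->] <-]]; rewrite setTI.
by apply: (@borel_open T); apply: h; exact: interval_open.
Qed.

(** Lower semicontinuity is enough: the sets where [lognorm] exceeds r are open. *)
Lemma measurable_lognorm : measurable_fun setT (lognorm : borel (GL V) -> R).
Proof.
move=> mD; apply: (measurability _ (RGenOInfty.measurableE R)) => //.
move=> _ [_ [r ->] <-]; rewrite setTI; apply: borel_open.
suff: GLopen [set g : GL V | r < lognorm g].
  by rewrite /= preimage_itvoy.
move=> g /=; rewrite -ltr_expR expR_lognorm lt_max => /orP[gr|gr].
  exists (opnorm (GLfun g) - expR r); first by rewrite subr_gt0.
  move=> h gh; rewrite -ltr_expR expR_lognorm lt_max; apply/orP; left.
  have := opnormD (GLfun g - GLfun h) (GLfun h).
  by rewrite subrK -(opnormN (_ - _)) opprB; lra.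
have [v hv] := opnorm_gt_exists (expR_ge0 r) gr.
(* The condition on the inverse is rewritten for g itself as |u| > e^r |g u| with u fixed, which
   persists under small perturbations of g. *)
set u := (GLfun g)^-1%VF v in hv.
have vE : v = GLfun g u by rewrite /u lker0_lfunVK// GL_ker0.
have E := expR_gt0 r; have p : 0 < enorm u.
  by apply: le_lt_trans hv; rewrite mulr_ge0 ?enorm_ge0// ltW.
exists ((enorm u - expR r * enorm v) / (expR r * enorm u)).
  by rewrite divr_gt0 ?subr_gt0// mulr_gt0.
move=> h; rewrite ltr_pdivlMr ?mulr_gt0// => gh.
rewrite -ltr_expR expR_lognorm lt_max; apply/orP; right.
have hp : 0 < enorm (GLfun h u) by rewrite enorm_gt0 GL_neq0// -enorm_gt0.
have h1 := GL_inv_le h u.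
have h2 : enorm (GLfun h u) <= enorm v + opnorm (GLfun h - GLfun g) * enorm u.
  have := enormD (GLfun g u) ((GLfun h - GLfun g) u).
  rewrite add_lfunE opp_lfunE addrC subrK -vE => /le_trans; apply.
  by have := opnorm_le (GLfun h - GLfun g) u; rewrite add_lfunE opp_lfunE -vE lerD2l.
rewrite -(ltr_pM2r hp); apply: lt_le_trans h1; nra.
Qed.

(** Countability comes from the dense sequence in the projective factor: over each ball [B k], [W k]
    gathers the t that are admissible, with a margin, for the whole ball. *)
Lemma open_rectangles (T : Type) (D : T -> T -> R) (O : set (projective V * T)) :
  (forall t, D t t = 0) -> (forall s t r, D s r <= D s t + D t r) ->
  (forall x t, O (x, t) -> exists2 e : R, 0 < e &
    forall x' t', pdist x x' < e -> D t t' < e -> O (x', t')) ->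
  exists (B : nat * nat -> set (projective V)) (W : nat * nat -> set T),
    [/\ O = \bigcup_k (B k `*` W k), forall k, open (B k) &
      forall k t, W k t -> exists2 e : R, 0 < e & forall t', D t t' < e -> W k t'].
Proof.
move=> D0 Dtri hO; have [y hy] := @projective_dense R V.
pose B (k : nat * nat) := [set x | pdist (y k.1) x < k.2.+1%:R^-1].
pose W k := [set t | exists2 e : R, 0 < e & forall t', D t t' < e ->
  forall x, B k x -> O (x, t')].
exists B, W; split.
- apply/seteqP; split => [[x t] Oxt|[x t] [k _ [/= Bx [e e0 he]]]]; last first.
    by apply: he => //; rewrite D0.
  have [e e0 he] := hO _ _ Oxt.
  pose n := Num.truncn (2 / e); have n0 : 0 < n.+1%:R :> R by [].
  have [j hj] := hy x n.+1%:R^-1 ltac:(by rewrite invr_gt0).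
  exists (j, n) => //; split => //=; exists e => // t' tt' x' /= hx'; apply: he => //.
  apply: le_lt_trans (pdist_triangle _ (y j) _) _; rewrite pdistC.
  apply: lt_le_trans (ltrD hj (hx' : pdist (y j) x' < n.+1%:R^-1)) _.
  rewrite -mulr2n -(mulr_natl _ 2) ler_pdivrMr//.
  rewrite mulrC -ler_pdivrMr//; exact/ltW/truncnS_gt.
- by move=> k; exact: open_pdist_ball.
- move=> k t [e e0 he]; exists (e / 2) => [|t' tt']; first by rewrite divr_gt0.
  exists (e / 2) => [|t'' tt'']; first by rewrite divr_gt0.
  by apply: he; apply: le_lt_trans (Dtri _ t' _) _; lra.
Qed.

Let countable_pairs : countable [set: nat * nat].
Proof. exact: countableP. Qed.

Lemma GL_rectangles_measurable (O : set (borel (projective V) * borel (GL V))) :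
  (forall x f, O (x, f) -> exists2 e : R, 0 < e &
    forall x' f', pdist x x' < e -> opnorm (GLfun f' - GLfun f) < e -> O (x', f')) ->
  measurable O.
Proof.
move=> hO.
have [|s t r|B [W [-> oB oW]]] := @open_rectangles (GL V)
    (fun f g => opnorm (GLfun g - GLfun f)) O _ _ hO.
- move=> f; rewrite subrr; apply/eqP; rewrite eq_le opnorm_ge0 andbT.
  by apply: opnorm_lub => // v; rewrite zero_lfunE enorm0 mul0r.
- have := opnormD (GLfun r - GLfun t) (GLfun t - GLfun s).
  by rewrite addrA subrK [X in _ <= X]addrC.
apply: countable_bigcupT_measurable => // k.
by apply: measurableX; apply: borel_open; [exact: oB|exact: oW].
Qed.

Lemma measurable_act : measurable_fun setT
  (fun z : borel (projective V) * borel (GL V) => act z.2 z.1 : borel (projective V)).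
Proof.
apply: measurable_to_borel => A oA; apply: GL_rectangles_measurable => x f /= Axf.
have [e e0 he] := (proj_openP A).1 oA _ Axf.
have E := expR_gt0 (lognorm f); have E2 : 0 < expR (lognorm f) ^+ 2 by rewrite exprn_gt0.
pose K := 2 * expR (lognorm f) ^+ 2 + 2 * expR (lognorm f).
have K0 : 0 < K by rewrite addr_gt0 ?mulr_gt0.
exists (e / (2 * K)) => [|x' f']; first by rewrite divr_gt0 ?mulr_gt0.
rewrite !ltr_pdivlMr ?mulr_gt0// => h1 h2; apply: he.
apply: le_lt_trans (pdist_triangle _ (act f x') _) _.
apply: le_lt_trans (lerD (act_pdist _ _ _) (act_opnorm _ _ _)) _.
rewrite -opnormN opprB; have := pdist_ge0 x x'; have := opnorm_ge0 (GLfun f' - GLfun f).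
rewrite /K in h1 h2; nra.
Qed.

Lemma measurable_cocycle : measurable_fun setT
  (fun z : borel (projective V) * borel (GL V) => cocycle z.2 z.1).
Proof.
move=> mD; apply: (measurability _ (RGenOpens.measurableE R)) => //.
move=> _ [_ [a [b ->] <-]]; rewrite setTI.
apply: GL_rectangles_measurable => x f /=; rewrite in_itv/= => /andP[ha hb].
pose d := Num.min (Num.min 1 (cocycle f x - a)) (b - cocycle f x).
have d0 : 0 < d by rewrite !lt_min ltr01 !subr_gt0 ha hb.
have E := expR_gt0 (lognorm f); have E2 : 0 < expR (lognorm f) ^+ 2 by rewrite exprn_gt0.
pose K := expR (lognorm f) ^+ 2 + 2 * expR (lognorm f).
have K0 : 0 < K by rewrite addr_gt0 ?mulr_gt0.
exists (d / (2 * K)) => [|x' f']; first by rewrite divr_gt0 ?mulr_gt0.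
rewrite !ltr_pdivlMr ?mulr_gt0//= -(opnormN (GLfun f' - _)) opprB => h1 h2.
have h3 := cocycle_pdist f x x'.
have o0 := opnorm_ge0 (GLfun f - GLfun f'); have p0 := pdist_ge0 x x'.
have d1 : d <= 1 by rewrite !ge_min lexx.
have h4 := @cocycle_opnorm _ _ f f' x' ltac:(by rewrite /K in h2; nra).
have : `|cocycle f x - cocycle f' x'| < d.
  rewrite -(subrK (cocycle f x') (cocycle f x)) -addrA.
  apply: le_lt_trans (ler_normD _ _) _; apply: le_lt_trans (lerD h3 h4) _.
  rewrite /K in h1 h2; nra.
rewrite /d !lt_min => /andP[/andP[_]]; rewrite !ltr_norml => /andP[? ?] /andP[? ?].
by rewrite in_itv/=; apply/andP; split; lra.
Qed.

Lemma nbhs_pdist x (t e : R) : 0 < e ->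
  nbhs (x, t) [set z : projective V * R | pdist x z.1 < e /\ `|z.2 - t| < e].
Proof.
move=> e0; exists ([set y | pdist x y < e], [set s | `|s - t| < e]) => /=.
  split; last by apply/nbhs_ballP; exists e => //= s; rewrite /ball/= distrC.
  apply: open_nbhs_nbhs; split; first exact: open_pdist_ball.
  by rewrite /= pdistxx.
by move=> [y s] [].
Qed.

Lemma open_productP (O : set (projective V * R)) : open O <->
  forall x t, O (x, t) -> exists2 e : R, 0 < e &
    forall x' t', pdist x x' < e -> `|t' - t| < e -> O (x', t').
Proof.
split=> [|h].
  rewrite openE => oO x t /oO [[A B] [/= nA nB] AB].
  move: nA; rewrite nbhsE => -[A' [oA' A'x] A'A].
  have [e1 e10 he1] := (proj_openP A').1 oA' _ A'x.
  move: nB => /nbhs_ballP[e2 /= e20 he2].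
  exists (Num.min e1 e2); first by rewrite lt_min e10.
  move=> x' t'; rewrite !lt_min => /andP[h1 _] /andP[_ h2].
  by apply: AB; split => /=; [exact/A'A/he1|apply: he2; rewrite /ball/= distrC].
rewrite openE => -[x t] /h[e e0 he].
by apply: filterS (nbhs_pdist x t e0) => -[x' t'] [/= ? ?]; exact: he.
Qed.

Lemma open_measurable_prod (O : set (projective V * R)) : open O ->
  measurable (O : set (borel (projective V) * R)).
Proof.
move=> /open_productP hO.
have [|s t r|B [W [-> oB oW]]] := @open_rectangles R (fun s t => `|t - s|) O _ _ hO.
- by move=> t; rewrite subrr normr0.
- by rewrite [X in _ <= X]addrC; exact: ler_distD.
apply: countable_bigcupT_measurable => // k.
apply: measurableX; first by apply: borel_open; exact: oB.
apply: open_measurable; rewrite openE => t /oW[e e0 he].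
by apply/nbhs_ballP; exists e => //= s; rewrite /ball/= distrC; exact: he.
Qed.

(** Harmonic measures live on the Borel sets of the product space, the kernels on the product of the
    two sigma-algebras; this identifies the two. *)
Lemma measurable_prod_borel (A : set (projective V * R)) :
  measurable (A : set (borel (projective V) * R)) <->
  measurable (A : set (borel (projective V * R)%type)).
Proof.
split => mA; last first.
  have : measurable_fun setT (fun z : borel (projective V) * R => z : borel (projective V * R)%type).
    by apply: measurable_to_borel => O; exact: open_measurable_prod.
  by move=> /(_ measurableT _ mA); rewrite setTI.
have m1 : measurable_fun setT (fun z : borel (projective V * R)%type => z.1 : borel (projective V)).
  apply: measurable_to_borel => O oO; apply: borel_open.
  apply/open_productP => x t Ox; have [e e0 he] := (proj_openP O).1 oO _ Ox.
  by exists e => // x' t' h _; exact: he.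
have m2 : measurable_fun setT (fun z : borel (projective V * R)%type => z.2 : R).
  apply: measurable_borel_real => O; rewrite openE => oO.
  apply/open_productP => x t /oO/nbhs_ballP[e e0 he].
  by exists e => // x' t' _ h; apply: he; rewrite /ball/= distrC.
have := measurable_fun_pair m1 m2 measurableT mA; rewrite setTI.
by congr measurable; apply/seteqP; split => -[].
Qed.

End Measurability.

(** * Test functions *)

Lemma le_min_add (R : realDomainType) (a b a' b' x : R) :
  a <= a' + x -> b <= b' + x -> Num.min a b <= Num.min a' b' + x.
Proof. by move=> h1 h2; rewrite addr_minl le_min !ge_min h1 h2 orbT. Qed.

Lemma le_max_add (R : realDomainType) (a b a' b' x : R) :
  a <= a' + x -> b <= b' + x -> Num.max a b <= Num.max a' b' + x.
Proof. by move=> h1 h2; rewrite addr_maxl ge_max !le_max h1 h2 orbT. Qed.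

Lemma trap_lipschitz (R : realType) (p q e t t' : R) : 0 < e ->
  `|trap p q e t - trap p q e t'| <= `|t - t'| / e.
Proof.
move=> e0.
suff le s s' : trap p q e s - trap p q e s' <= `|s - s'| / e.
  by rewrite ler_norml lerNl opprB le [X in _ <= X / _]distrC le.
have x0 : 0 <= `|s - s'| / e by rewrite divr_ge0// ltW.
rewrite lerBlDr /trap [X in _ <= X]addrC.
have h1 := ler_norm (s - s'); have h2 : s' - s <= `|s - s'| by rewrite distrC ler_norm.
by apply: le_max_add; [|apply: le_min_add; [|apply: le_min_add]];
  rewrite ?lerDl//= [X in _ <= X]addrAC lerD2r -mulrDl ler_pM2r ?invr_gt0//; lra.
Qed.

Section TestFunctions.
Context {R : realType} {V : euclideanType R}.
Implicit Types (x y : projective V) (z w : projective V * R).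

Definition dist z w : R := pdist z.1 w.1 + `|z.2 - w.2|.

Lemma dist_ge0 z w : 0 <= dist z w.
Proof. by rewrite addr_ge0// pdist_ge0. Qed.

Lemma distxx z : dist z z = 0.
Proof. by rewrite /dist pdistxx subrr normr0 addr0. Qed.

Lemma distC z w : dist z w = dist w z.
Proof. by rewrite /dist pdistC distrC. Qed.

Lemma dist_triangle v z w : dist z w <= dist z v + dist v w.
Proof.
by rewrite addrACA lerD ?pdist_triangle ?ler_distD.
Qed.

Lemma continuous_dist (f : projective V * R -> R) :
  (forall z (eps : R), 0 < eps -> exists2 e : R, 0 < e &
    forall w, dist z w < e -> `|f z - f w| < eps) -> continuous f.
Proof.
move=> h [x t]; apply/cvgrPdist_lt => eps eps0; have [e e0 he] := h (x, t) _ eps0.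
have e20 : 0 < e / 2 by rewrite divr_gt0.
apply: filterS (nbhs_pdist x t e20) => w [/= h1 h2]; apply: he.
by rewrite /dist/= distrC; lra.
Qed.

Lemma lipschitz_continuous_dist (f : projective V * R -> R) (L : R) :
  (forall z w, `|f z - f w| <= L * dist z w) -> continuous f.
Proof.
move=> h; apply: continuous_dist => z eps eps0.
exists (eps / (`|L| + 1)); first by rewrite divr_gt0// ltr_wpDl.
move=> w; rewrite ltr_pdivlMr ?ltr_wpDl// => zw; apply: (le_lt_trans (h z w)).
by have := dist_ge0 z w; have := ler_norm L; nra.
Qed.

Lemma compact_support (f : projective V * R -> R) (M : R) :
  (forall z, M <= `|z.2| -> f z = 0) -> compact (closure [set z | f z != 0]).
Proof.
move=> fM; pose K := [set: projective V] `*` `[(- M), M]%classic.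
have cK : compact K by apply: compact_setX; [exact: compact_projective|exact: segment_compact].
have clK : closed K.
  rewrite -openC; apply/open_productP => x t.
  rewrite /K/= in_itv/= -ler_norml => h.
  have {h} : M < `|t| by rewrite ltNge; apply/negP => h'; apply: h.
  move=> h; exists (`|t| - M); first by rewrite subr_gt0.
  move=> x' t' _ tt' [_ /=]; rewrite in_itv/= -ler_norml.
  have := ler_normD (t - t') t'; rewrite subrK distrC; lra.
apply: (subclosed_compact _ cK); first exact: closed_closure.
rewrite [X in _ `<=` X](closure_id K).1//; apply: closure_subset => -[x t] /= h.
split => //=; rewrite in_itv/= -ler_norml leNgt; apply/negP => h'.
by move/eqP: h; apply; apply: fM; exact: ltW.
Qed.

Lemma continuous_measurable_prod (f : projective V * R -> R) : continuous f ->
  measurable_fun setT (f : borel (projective V) * R -> R).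
Proof.
move=> /continuousP cf mD; apply: (measurability _ (RGenOpens.measurableE R)) => //.
move=> _ [_ [a [b ->] <-]]; rewrite setTI; apply: open_measurable_prod.
by apply: cf; exact: interval_open.
Qed.

Section Cutoff.
Variables (O : set (projective V * R)) (n : nat).

(** The condition on the level gives the cutoff a bounded support and makes the set nonempty, so
    that the infimum below is over a nonempty set. *)
Definition cutoff_zeros : set (projective V * R) := [set w | ~ O w \/ n.+1%:R <= `|w.2|].

(** This is min(1, (n + 1) d(z, zeros)): a Lipschitz function that increases with n to the indicator
    of O when O is open. *)
Definition cutoff z : R := inf [set Num.min 1 (n.+1%:R * dist z w) | w in cutoff_zeros].

Let cutoffset z : has_inf [set Num.min 1 (n.+1%:R * dist z w) | w in cutoff_zeros].
Proof.
split; last first.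
  by exists 0 => _ [w _ <-]; rewrite le_min ler01 mulr_ge0// dist_ge0.
by exists (Num.min 1 (n.+1%:R * dist z (point, n.+1%:R))), (point, n.+1%:R) => //; right; rewrite /= ger0_norm.
Qed.

Lemma cutoff_le z w : cutoff_zeros w -> cutoff z <= Num.min 1 (n.+1%:R * dist z w).
Proof. by move=> hw; apply: ge_inf; [have [] := cutoffset z|exists w]. Qed.

Lemma le_cutoff z (b : R) :
  (forall w, cutoff_zeros w -> b <= Num.min 1 (n.+1%:R * dist z w)) -> b <= cutoff z.
Proof.
move=> h; apply: lb_le_inf; first by have [] := cutoffset z.
by move=> _ [w hw <-]; exact: h.
Qed.

Lemma cutoff_ge0 z : 0 <= cutoff z.
Proof. by apply: le_cutoff => w _; rewrite le_min ler01 mulr_ge0// dist_ge0. Qed.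

Lemma cutoff_le1 z : cutoff z <= 1.
Proof.
have h : cutoff_zeros (point, n.+1%:R) by right; rewrite /= ger0_norm.
by apply: le_trans (cutoff_le _ h) _; rewrite ge_min lexx.
Qed.

Lemma cutoff_eq0 z : cutoff_zeros z -> cutoff z = 0.
Proof.
move=> hz; apply/eqP; rewrite eq_le cutoff_ge0 andbT.
by apply: le_trans (cutoff_le _ hz) _; rewrite distxx mulr0 ge_min lexx orbT.
Qed.

Lemma cutoff_lipschitz z z' : `|cutoff z - cutoff z'| <= n.+1%:R * dist z z'.
Proof.
suff le a b : cutoff a - cutoff b <= n.+1%:R * dist a b.
  by rewrite ler_norml lerNl opprB le distC le.
rewrite lerBlDl -lerBlDr; apply: le_cutoff => w hw; rewrite lerBlDr.
apply: le_trans (cutoff_le _ hw) _; apply: le_min_add.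
  by rewrite lerDl mulr_ge0// dist_ge0.
by rewrite -mulrDr ler_wpM2l// addrC dist_triangle.
Qed.

End Cutoff.

Lemma cutoff_homo (O : set (projective V * R)) z m n : (m <= n)%N -> cutoff O m z <= cutoff O n z.
Proof.
move=> mn; apply: le_cutoff => w hw.
have mnR : m.+1%:R <= n.+1%:R :> R by rewrite ler_nat ltnS.
apply: le_trans (@cutoff_le O m z w _) _.
  by case: hw => [|h]; [left|right; exact: le_trans h].
by rewrite le_min !ge_min lexx/= ler_wpM2r ?orbT ?dist_ge0.
Qed.

Lemma cutoff_eq1 (O : set (projective V * R)) z : open O -> O z ->
  exists n0, forall n, (n0 <= n)%N -> cutoff O n z = 1.
Proof.
move=> /open_productP oO; case: z => x t Oz; have [e e0 he] := oO _ _ Oz.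
pose a := e^-1; exists (Num.truncn (a + `|t| + 1)) => n hn.
have a0 : 0 < a by rewrite invr_gt0.
have hn' : a + `|t| + 1 <= n.+1%:R.
  apply/ltW; apply: lt_le_trans (truncnS_gt _) _; by rewrite ler_nat ltnS.
apply/eqP; rewrite eq_le cutoff_le1/=; apply: le_cutoff => -[y s] hw; rewrite le_min lexx/=.
case: hw => [nO|/= h].
  have : e <= dist (x, t) (y, s).
    rewrite leNgt; apply/negP => h; apply: nO; have := pdist_ge0 x y.
    move: h; rewrite /dist/= => h p; apply: he; first by apply: le_lt_trans h; rewrite lerDl.
    by rewrite distrC; apply: le_lt_trans h; rewrite lerDr.
  move=> h; apply: (@le_trans _ _ (a * e)); first by rewrite mulVf ?gt_eqF.
  by apply: ler_pM => //; [exact: ltW|exact: ltW|have := normr_ge0 t; lra].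
have := ler_normD (s - t) t; rewrite subrK => h'.
have p := pdist_ge0 x y; rewrite /dist/= [`|t - s|]distrC.
have : 1 <= pdist x y + `|s - t| by lra.
by have := normr_ge0 t; nra.
Qed.

End TestFunctions.

(** * Feller property of the transition operator *)

Section Feller.
Context {R : realType} {V : euclideanType R}.
Variable mu : probability (borel (GL V)) R.
Variable s : R.
Hypothesis s1 : `|s| <= 1.

Local Notation E := (borel (projective V)).
Local Notation G := (borel (GL V)).
Implicit Types (z w : E * R).

Definition pact (xg : E * G) : E := act xg.2 xg.1.

(** The factor s treats [rho] (s = 1) and [rho_check] (s = -1) at once. *)
Definition pcocycle (xg : E * G) : R := s * cocycle xg.2 xg.1.

Lemma measurable_pact : measurable_fun setT pact.
Proof. exact: measurable_act. Qed.

Lemma measurable_pcocycle : measurable_fun setT pcocycle.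
Proof. by apply: measurable_funM => //; exact: measurable_cocycle. Qed.

Lemma pcocycle_le x (u : G) : `|pcocycle (x, u)| <= lognorm u.
Proof.
rewrite normrM; apply: le_trans (cocycle_le u x).
by rewrite ler_piMl.
Qed.

Lemma step_dist (B : R) (u : G) z w : lognorm u <= B ->
  dist (step pact pcocycle z u) (step pact pcocycle w u) <=
  (3 * expR B ^+ 2 + 1) * dist z w.
Proof.
move=> uB; rewrite /dist/=.
have Eu : expR (lognorm u) ^+ 2 <= expR B ^+ 2.
  by rewrite lerXn2r ?nnegrE ?expR_ge0// ler_expR.
have p0 := pdist_ge0 z.1 w.1.
have h1 := act_pdist u z.1 w.1.
have h2 : `|pcocycle (z.1, u) - pcocycle (w.1, u)| <= expR (lognorm u) ^+ 2 * pdist z.1 w.1.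
  rewrite /pcocycle/= -mulrBr normrM; apply: le_trans (cocycle_pdist _ _ _).
  by rewrite ler_piMl.
have h3 : `|z.2 + pcocycle (z.1, u) - (w.2 + pcocycle (w.1, u))| <=
    `|z.2 - w.2| + `|pcocycle (z.1, u) - pcocycle (w.1, u)|.
  by apply: le_trans (ler_normD _ _); rewrite opprD addrACA.
have E0 : 0 <= expR (lognorm u) ^+ 2 by rewrite exprn_ge0 ?expR_ge0.
have t0 := normr_ge0 (z.2 - w.2).
rewrite /pact/=; nra.
Qed.

Hypothesis mu_tail : forall eps : R, 0 < eps ->
  exists B : R, (mu [set u | (B < lognorm u)%R] <= eps%:E)%E.

Variable phi : projective V * R -> R.
Variable L : R.
Hypotheses (phi0 : forall z, 0 <= phi z) (phi1 : forall z, phi z <= 1).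
Hypothesis phiL : forall z w, `|phi z - phi w| <= L * dist z w.

Local Notation phiE := (fun z : E * R => (phi z)%:E).
Local Notation Qphi := (Q mu pact pcocycle phiE).

Lemma continuous_phi : continuous phi.
Proof. exact: lipschitz_continuous_dist phiL. Qed.

Lemma nnm_phi : nnm phiE.
Proof. by apply: nnm_EFin => //; exact: continuous_measurable_prod continuous_phi. Qed.

Lemma Qphi_ge0 z : (0 <= Qphi z)%E.
Proof. by apply: Q_ge0 => w; rewrite lee_fin. Qed.

Lemma Qphi_le1 z : (Qphi z <= 1)%E.
Proof.
rewrite -[leRHS](Q_cst mu pact pcocycle z lee01); apply: le_Q => w /=; rewrite lee_fin//.
Qed.

Lemma Qphi_fin z : Qphi z \is a fin_num.
Proof.
rewrite ge0_fin_numE ?Qphi_ge0//; apply: le_lt_trans (Qphi_le1 z) _.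
exact: ltry.
Qed.

Let L0 : 0 <= L.
Proof.
have := phiL (point, 0) (point, 1); rewrite /dist/= pdistxx add0r sub0r normrN normr1 mulr1.
exact: le_trans.
Qed.

(** Where [lognorm] is at most B the step is Lipschitz with a constant depending on B; elsewhere phi
    <= 1 and only the measure of the exceptional set counts. *)
Lemma Qphi_near (B : R) z w : (Qphi z <= Qphi w +
  ((L * ((3 * expR B ^+ 2 + 1) * dist z w))%:E + mu [set u | (B < lognorm u)%R]))%E.
Proof.
have ma := measurable_pact; have mc := measurable_pcocycle.
have mB : measurable_fun setT (fun u : G => B < lognorm u).
  by apply: measurable_fun_ltr => //; exact: measurable_lognorm.
have K0 : 0 <= L * ((3 * expR B ^+ 2 + 1) * dist z w).
  by rewrite !mulr_ge0 ?dist_ge0// addr_ge0 ?mulr_ge0 ?exprn_ge0 ?expR_ge0.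
set K := L * _ in K0 *.
have nw : nnm (fun u : G => phiE (step pact pcocycle w u)) by exact: (nnm_step ma mc w nnm_phi).
have nK : nnm (fun u : G => (K%:E + ind (B < lognorm u)%R)%E).
  by apply: nnm_add; [exact: nnm_cst|exact: nnm_ind].
have -> : (K%:E + mu [set u | (B < lognorm u)%R] = \int[mu]_u (K%:E + ind (B < lognorm u)%R))%E.
  rewrite ge0_integralD//; last 2 first.
  - by move=> u _; exact: ind_ge0.
  - exact: (nnm_ind mB).1.
  rewrite integral_cst// [X in (_ * X)%E]probability_setT mule1; congr (_ + _)%E.
  have := @integral_indic _ _ _ mu setT measurableT [set u | B < lognorm u] (measurable_boolset mB).
  rewrite setIT => <-.
  by apply: eq_integral => u _; rewrite /ind indicE; congr ((nat_of_bool _)%:R%:E); apply/idP/idP; rewrite inE.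
rewrite /Q -ge0_integralD//; [|by move=> u _; exact: nw.2|exact: nw.1|by move=> u _; exact: nK.2|exact: nK.1].
apply: le_ge0_integral => u; first by rewrite lee_fin.
move=> _; have [uB|uB] := leP (lognorm u) B.
  rewrite /ind/= adde0 -EFinD lee_fin.
  rewrite -lerBlDl; apply: le_trans (ler_norm _) _; apply: le_trans (phiL _ _) _.
  by rewrite /K ler_wpM2l// step_dist.
rewrite /ind/= -!EFinD lee_fin; apply: le_trans (phi1 _) _.
by rewrite addrA lerDr addr_ge0.
Qed.

Lemma continuous_Qphi : continuous (fun z : projective V * R => fine (Qphi z)).
Proof.
apply: continuous_dist => z eps eps0.
have eps20 : 0 < eps / 2 by rewrite divr_gt0.
have [B hB] := mu_tail eps20.
pose K := L * (3 * expR B ^+ 2 + 1) + 1.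
have K0 : 0 < K by rewrite ltr_wpDl// mulr_ge0// addr_ge0// mulr_ge0// exprn_ge0// expR_ge0.
exists (eps / (2 * K)) => [|w]; first by rewrite divr_gt0// mulr_gt0.
rewrite ltr_pdivlMr ?mulr_gt0// => zw.
have d0 := dist_ge0 z w.
suff le a b : dist a b = dist z w -> fine (Qphi a) - fine (Qphi b) < eps.
  rewrite ltr_norml ltrNl opprB; apply/andP; split; apply: le => //; exact: distC.
move=> ab; rewrite ltrBlDl -lte_fin fineK ?Qphi_fin//.
apply: le_lt_trans (Qphi_near B a b) _; rewrite ab.
apply: le_lt_trans (leeD2l _ (leeD2l _ hB)) _.
rewrite -[X in (X + _ < _)%E]fineK ?Qphi_fin// -!EFinD lte_fin ltrD2l mulrA.
rewrite /K in zw; nra.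
Qed.

Lemma continuous_trap_Qphi (p q e : R) : 0 < e ->
  continuous (fun z : projective V * R => trap p q e z.2 * fine (Qphi z)).
Proof.
move=> e0 z; apply: cvgM; last exact: continuous_Qphi.
apply: (@lipschitz_continuous_dist _ _ (fun z => trap p q e z.2) e^-1) => {}z w.
apply: le_trans (trap_lipschitz _ _ _ _ e0) _; rewrite mulrC ler_wpM2l ?invr_ge0 ?(ltW e0)//.
by rewrite /dist lerDr pdist_ge0.
Qed.

End Feller.

(** * Image of a measure under one step *)

Lemma integral_mrestr d (T : measurableType d) (R : realType)
    (m : {measure set T -> \bar R}) (D : set T) (mD : measurable D) (f : T -> \bar R) :
  nnm f -> (\int[mrestr m mD]_x f x = \int[m]_(x in D) f x)%E.
Proof.
move=> [mf f0].
rewrite (@ge0_negligible_integral _ _ _ (mrestr m mD) setT (~` D))//; last 2 first.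
- exact: measurableC.
- by rewrite /= /mrestr setICl measure0.
rewrite setTD setCK; apply: eq_measure_integral => A mA AD.
by rewrite /= /mrestr (setIidl AD).
Qed.

Section NextMeasure.
Context {R : realType} {dE dG : measure_display}.
Context {E : measurableType dE} {G : measurableType dG}.
Variable mu : probability G R.
Variables (a : E * G -> E) (c : E * G -> R).
Hypothesis (ma : measurable_fun setT a) (mc : measurable_fun setT c).
Local Notation Z := (E * R)%type.
Variable rho : {sigma_finite_measure set Z -> \bar R}.
Local Open Scope ereal_scope.

Let D : set Z := [set z | (0 <= z.2)%R].

Let mDG : measurable (D `*` [set: G]).
Proof.
by apply: measurableX => //; apply: measurable_boolset; exact: measurable_ge0_snd.
Qed.

Definition next_measure : {measure set Z -> \bar R} :=
  measure_function_pushforward__canonical__measure_function_Measure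
    (mrestr (rho \x mu) mDG) (measurable_step2 ma mc).

Lemma integral_next_measure f : nnm f ->
  \int[next_measure]_z f z = \int[rho]_(z in D) Q mu a c f z.
Proof.
move=> nf; have nf2 := nnm_comp (measurable_step2 ma mc) nf.
rewrite ge0_integral_pushforward//; last 3 first.
- exact: measurable_step2.
- exact: nf.1.
- by move=> z _; exact: nf.2.
rewrite preimage_setT integral_mrestr// integral_mkcond.
have mDb : measurable_fun setT (fun zu : Z * G => (0 <= zu.1.2)%R).
  exact: (measurableT_comp (measurable_ge0_snd (E := E)) measurable_fst).
have pE : ((f \o (fun zu : Z * G => step a c zu.1 zu.2)) \_ (D `*` [set: G])) =
    (fun zu => if (0 <= zu.1.2)%R then f (step a c zu.1 zu.2) else 0).
  apply/funext => -[z u]; rewrite patchE /=; case: ifPn => [|/negP h].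
    by rewrite inE => -[/= ->].
  by case: ifPn => // h'; exfalso; apply: h; rewrite inE; split.
have nif : nnm (fun zu : Z * G => if (0 <= zu.1.2)%R then f (step a c zu.1 zu.2) else 0).
  by apply: nnm_if => //; exact: nnm_cst.
rewrite pE (fubini_tonelli1 _ nif.1 nif.2).
rewrite [RHS]integral_mkcond; apply: eq_integral => z _.
rewrite /fubini_F patchE /Q/=; case: ifPn => [|/negP h]; first by rewrite inE => /= ->.
have -> : (0 <= z.2)%R = false by apply/negP => h'; apply: h; rewrite inE.
by rewrite integral0.
Qed.

End NextMeasure.

(** * Exponential moments *)

Section ExponentialMoment.
Context {R : realType} {V : euclideanType R}.
Variable mu : probability (borel (GL V)) R.
Hypothesis mom : finite_exponential_moment mu.
Local Notation l := (lognorm : borel (GL V) -> R).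

Lemma exp_moment : exists alpha C : R, [/\ 0 < alpha, 0 <= C &
  (\int[mu]_u (expR (alpha * l u))%:E)%E = C%:E].
Proof.
have [alpha alpha0 I] := mom.
have e : (\int[mu]_u (expR (alpha * l u))%:E)%E =
    (\int[mu]_g ((Num.max (opnorm (GLfun g)) (opnorm (GLfun g)^-1%VF)) `^ alpha)%:E)%E.
  by apply: eq_integral => u _; rewrite mulrC expRM expR_lognorm.
have I0 : (0 <= \int[mu]_u (expR (alpha * l u))%:E)%E.
  by apply: integral_ge0 => u _; rewrite lee_fin expR_ge0.
exists alpha, (fine (\int[mu]_u (expR (alpha * l u))%:E)%E); split => //; first exact: fine_ge0.
by rewrite fineK// ge0_fin_numE// e.
Qed.

Lemma nnm_exp_lognorm (alpha : R) : nnm (fun u => (expR (alpha * l u))%:E : \bar R).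
Proof.
apply: nnm_EFin => [|u]; last exact: expR_ge0.
apply: measurableT_comp; first exact: measurable_expR.
by apply: measurable_funM => //; exact: measurable_lognorm.
Qed.

Lemma lognorm_tail : exists r C : R, [/\ 0 < r < 1, 0 <= C &
  forall S : nat, (mu [set u | (S%:R <= l u)%R] <= (C * r ^+ 6 ^+ S)%:E)%E].
Proof.
have [alpha [C [alpha0 C0 IC]]] := exp_moment.
(* With this r one has r^6 = e^(-alpha), so the tail estimate is Markov's inequality for e^(alpha
   l). *)
exists (expR (- alpha / 6)), C; split => //.
  by rewrite expR_gt0 expR_lt1 mulNr oppr_lt0 divr_gt0.
move=> S.
have mS : measurable_fun setT (fun u => S%:R <= l u).
  by apply: measurable_fun_ler => //; exact: measurable_lognorm.
have -> : expR (- alpha / 6) ^+ 6 ^+ S = (expR (alpha * S%:R))^-1.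
  rewrite -exprM -expRM_natl -expRN; congr expR.
  by rewrite natrM; field.
rewrite EFinM lee_pdivlMr ?expR_gt0//.
have <- : (\int[mu]_u ((expR (alpha * S%:R))%:E * ind (S%:R <= l u)%R) =
    mu [set u | (S%:R <= l u)%R] * (expR (alpha * S%:R))%:E)%E.
  rewrite ge0_integralZl//; [|exact: (nnm_ind mS).1|by move=> u _; exact: ind_ge0].
  rewrite muleC; congr (_ * _)%E.
  have := @integral_indic _ _ _ mu setT measurableT [set u | (S%:R <= l u)%R] (measurable_boolset mS).
  rewrite setIT => <-.
  by apply: eq_integral => u _; rewrite /ind indicE; congr ((nat_of_bool _)%:R%:E); apply/idP/idP; rewrite inE.
rewrite -IC; apply: le_ge0_integral => u.
  by rewrite mule_ge0 ?lee_fin ?expR_ge0// ind_ge0.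
move=> _; have [Su|_] := leP S%:R (l u); last by rewrite /ind/= mule0 lee_fin expR_ge0.
by rewrite /ind/= mule1 lee_fin ler_expR ler_pM2l.
Qed.

Lemma lognorm_vanishing_tail (eps : R) : 0 < eps ->
  exists B : R, (mu [set u | (B < l u)%R] <= eps%:E)%E.
Proof.
move=> eps0; have [r [C [/andP[r0 r1] C0 tail]]] := lognorm_tail.
have r6 : 0 <= r ^+ 6 by rewrite exprn_ge0// ltW.
have r61 : r ^+ 6 < 1 by rewrite exprn_ilt1// (ltW r0).
have cv : (fun S : nat => C * r ^+ 6 ^+ S) @ \oo --> (C * 0 : R).
  by apply: cvgMr; apply: cvg_expr; rewrite ger0_norm.
rewrite mulr0 in cv; move/cvgrPdist_le: cv => /(_ _ eps0)[S _ /(_ S (leqnn S))/=].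
rewrite sub0r normrN ger0_norm => [h|]; last by rewrite mulr_ge0// exprn_ge0.
exists S%:R; apply: le_trans (le_trans (tail S) _); last by rewrite lee_fin.
apply: le_measure; rewrite ?inE.
- by apply: measurable_boolset; apply: measurable_fun_ltr => //; exact: measurable_lognorm.
- by apply: measurable_boolset; apply: measurable_fun_ler => //; exact: measurable_lognorm.
- by move=> u /= /ltW.
Qed.

(** On l > B one has l <= l^4 / B^3, and l^4 <= (4 / alpha)^4 e^(alpha l) because x <= e^x. *)
Lemma lognorm_excess : exists2 K : R, 0 <= K &
  forall B : R, 0 < B -> (excess mu l B <= (K / B ^+ 3)%:E)%E.
Proof.
have [alpha [C [alpha0 C0 IC]]] := exp_moment.
exists ((4 / alpha) ^+ 4 * C) => [|B B0].
  by rewrite mulr_ge0// exprn_ge0// divr_ge0// ltW.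
have k0 : 0 <= (4 / alpha) ^+ 4 / B ^+ 3.
  by rewrite divr_ge0// exprn_ge0// ?divr_ge0// ltW.
rewrite mulrAC EFinM -IC -ge0_integralZl//; last exact: (nnm_exp_lognorm alpha).1.
apply: le_ge0_integral => u.
  by rewrite mule_ge0 ?ind_ge0// lee_fin lognorm_ge0.
move=> _; have [_|Bu] := leP (l u) B; rewrite /ind/= ?mule0 ?mule1 -?EFinM lee_fin.
  by rewrite mulr_ge0// expR_ge0.
have l0 := lognorm_ge0 u.
rewrite mulrAC ler_pdivlMr ?exprn_gt0//.
have h1 : l u * B ^+ 3 <= l u ^+ 4.
  by rewrite [leRHS]exprS ler_wpM2l// lerXn2r ?nnegrE// ltW.
apply: (le_trans h1).
have -> : expR (alpha * l u) = expR (alpha * l u / 4) ^+ 4.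
  by rewrite -expRM_natl; congr expR; field.
rewrite -exprMn lerXn2r ?nnegrE ?mulr_ge0 ?expR_ge0 ?invr_ge0 ?(ltW alpha0)//.
rewrite mulrAC ler_pdivlMr//.
have := expR_ge1Dx (alpha * l u / 4); rewrite -/l; lra.
Qed.

End ExponentialMoment.

(** * Random walks *)

Section RandomWalk.
Context {R : realType} {V : euclideanType R}.
Variable mu : probability (borel (GL V)) R.
Context {d : measure_display} {Omega : measurableType d}.
Variable P : probability Omega R.
Variable g : nat -> {RV P >-> borel (GL V)}.
Hypothesis g_iid : iid mu g.
Variable s : R.

Local Notation E := (borel (projective V)).

Lemma iid_future (N : nat) (C : nat -> set (borel (GL V))) :
  (forall i, measurable (C i)) ->
  P (future g 0 N C) = (\prod_(0 <= i < N) mu (C i))%E.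
Proof.
move=> mC; have [indep law] := g_iid.
have key : unit by exact: tt.
have := indep (finmap.seq_fset key (iota 0 N)) C mC.
rewrite (_ : \bigcap_(i in _) _ = future g 0 N C); last first.
  rewrite /future; congr bigcap; apply/seteqP; split => i /=.
    by rewrite finmap.seq_fsetE mem_iota add0n.
  by rewrite finmap.seq_fsetE mem_iota add0n.
move=> ->; rewrite (perm_big _ (finmap.seq_fset_perm _ _))/= undup_id ?iota_uniq//.
rewrite /index_iota subn0; apply: eq_bigr => i _.
exact: law.
Qed.

(** [harmonic_approx] for s = 1 and [harmonic_approx_check] for s = -1. *)
Definition signed_approx (h : projective V * R -> R) (n : nat) (x : projective V) : \bar R :=
  (\int[lebesgue_measure]_(t in `[0%R, +oo[)
    (t%:E * \int[P]_(w in [set w | ((n%:R - 1)%:E <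
        first_negative (fun k => t + s * cocycle (walk g k w) x)%R)%E])
      (h (act (walk g n w) x, t + s * cocycle (walk g n w) x)%R)%:E))%E.

Lemma trajectory_walk (x : projective V) (t : R) (n : nat) (w : Omega) :
  trajectory g pact (pcocycle s) (x, t) n w =
  ((act (walk g n w) x, t + s * cocycle (walk g n w) x),
   [forall k : 'I_n, 0 <= t + s * cocycle (walk g k w) x]).
Proof.
elim: n => [|n ih] /=.
  rewrite act1 cocycle1 mulr0 addr0; congr (_, _).
  by apply/esym/forallP => -[].
rewrite ih /step /pact /pcocycle/= act_mul cocycle_mul mulrDr.
rewrite -addrA [s * cocycle (g n w) _ + _]addrC; congr (_, _).
apply/andP/forallP => [[/forallP h1 h2] [k kn]/=|h].
  have [kn'|kn'] := ltnP k n; first exact: (h1 (Ordinal kn')).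
  by have -> : k = n by apply/eqP; rewrite eqn_leq kn' -ltnS kn.
split; last exact: (h ord_max).
by apply/forallP => k; exact: (h (widen_ord (leqnSn n) k)).
Qed.

(** [first_negative] inspects k >= 1 only; the hypothesis on [u 0] accounts for time 0, which the
    killed trajectory also tests. *)
Lemma first_negative_gt (u : nat -> R) (n : nat) : 0 <= u 0%N ->
  ((n%:R - 1)%:E < first_negative u)%E <-> [forall k : 'I_n, 0 <= u k].
Proof.
move=> u0; split => [h|/forallP h].
  apply/forallP => -[k kn] /=; case: k kn => [//|k] kn.
  rewrite leNgt; apply/negP => uk.
  have : (first_negative u <= k.+1%:R%:E)%E by apply: ereal_inf_lbound; exists k.+1.
  move=> /(lt_le_trans h); rewrite lte_fin ltrBlDr natr1 ltr_nat ltnS => nk.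
  by move: kn; rewrite ltnNge nk.
apply: (@lt_le_trans _ _ n%:R%:E); first by rewrite lte_fin ltrBlDr ltrDl.
apply: le_ereal_inf_tmp => _ [k [k1 uk] <-]; rewrite lee_fin ler_nat leqNgt; apply/negP => kn.
by have := h (Ordinal kn); rewrite /= leNgt uk.
Qed.

Lemma signed_approxE (h : projective V * R -> R) (n : nat) (x : projective V) :
  nnm (fun z : E * R => (h z)%:E) ->
  signed_approx h n x = H mu pact (pcocycle s) n (fun z : E * R => (h z)%:E) x.
Proof.
move=> nh; rewrite /signed_approx /H integral_mkcond; apply: eq_integral => t _.
rewrite patchE; case: ifPn => [|ht]; last first.
  rewrite max_r ?mul0e//; move: ht; apply: contraNT; rewrite -ltNge inE/= in_itv/= andbT.
  exact: ltW.
rewrite inE/= in_itv/= andbT => t0; rewrite max_l//; congr (_ * _)%E.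
rewrite -(@integral_trajectory _ _ _ _ _ P mu g _ iid_future _ _ pact (pcocycle s)
  measurable_pact (measurable_pcocycle s) n (x, t) _ nh); last by move=> k; exact: measurable_funP.
have -> : [set w | (trajectory g pact (pcocycle s) (x, t) n w).2] =
    [set w | ((n%:R - 1)%:E < first_negative (fun k => t + s * cocycle (walk g k w) x)%R)%E].
  apply/seteqP; split => w /=; rewrite trajectory_walk/=.
    by move=> hw; apply/first_negative_gt => //; rewrite cocycle1 mulr0 addr0.
  by move/first_negative_gt; apply; rewrite /= cocycle1 mulr0 addr0.
by apply: eq_integral => w _; rewrite trajectory_walk.
Qed.

End RandomWalk.

(** * Harmonic measures *)

Section CutoffLimit.
Context {R : realType} {V : euclideanType R}.
Local Notation Z := (borel (projective V) * R)%type.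

Lemma measurable_cutoff (O : set (projective V * R)) n :
  measurable_fun setT (cutoff O n : Z -> R).
Proof.
apply: continuous_measurable_prod; apply: lipschitz_continuous_dist.
exact: cutoff_lipschitz.
Qed.

Lemma integral_cutoff_cvg (m : {measure set Z -> \bar R}) (O : set (projective V * R)) :
  open O -> (\int[m]_z (cutoff O n z)%:E)%E @[n --> \oo] --> m O.
Proof.
move=> oO; have mO := open_measurable_prod oO.
have <- : (\int[m]_z (limn (fun n => (cutoff O n z)%:E)) = m O)%E.
  have := @integral_indic _ _ _ m setT measurableT O mO; rewrite setIT => <-.
  apply: eq_integral => z _; apply/cvg_lim => //.
  have [zO|zO] := pselect (O z).
    rewrite indicE mem_set//; have [n0 h] := cutoff_eq1 oO zO.
    apply: cvg_near_cst; exists n0 => // n /= hn.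
    by apply/eqP; rewrite h.
  rewrite indicE memNset//; apply: cvg_near_cst; exists 0%N => // n _.
  by apply/eqP; rewrite cutoff_eq0//; left.
apply: cvg_monotone_convergence => //.
- by move=> n; apply/measurable_EFinP; exact: measurable_cutoff.
- by move=> n z _; rewrite lee_fin cutoff_ge0.
- by move=> z _ p q pq; rewrite lee_fin cutoff_homo.
Qed.

Definition band (k : nat) : set (projective V * R) := [set z | `|z.2| < k%:R].

Lemma open_band k : open (band k).
Proof.
apply/open_productP => x t /= tk; exists (k%:R - `|t|); first by rewrite subr_gt0.
by move=> x' t' _ tt'; rewrite /band/=; have := ler_normD (t' - t) t; rewrite subrK; lra.
Qed.

Lemma bigcup_band : \bigcup_k band k = setT.
Proof.
by apply/seteqP; split => // z _; exists (Num.truncn `|z.2|).+1 => //=; exact: truncnS_gt.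
Qed.

Lemma eq_measure_open (m1 m2 : {measure set Z -> \bar R}) :
  (forall k, (m1 (band k) < +oo)%E) ->
  (forall O : set (projective V * R), open O -> m1 O = m2 O) ->
  forall A, measurable A -> m1 A = m2 A.
Proof.
move=> fin h; apply: (@measure_unique _ R Z (@open (projective V * R)%type) band) => //.
- by apply/seteqP; split => A /measurable_prod_borel.
- by move=> A B; exact: openI.
- exact: open_band.
- exact: bigcup_band.
Qed.

End CutoffLimit.

Lemma lee_abs_dist (R : realType) (y : \bar R) (I e : R) :
  (`|y - I%:E| <= e%:E)%E -> ((I - e)%:E <= y <= (I + e)%:E)%E.
Proof.
case: y => [y| |]//=; rewrite !lee_fin ler_norml => /andP[h1 h2].
by apply/andP; split; lra.
Qed.

Section HarmonicMeasure.
Context {R : realType} {V : euclideanType R}.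
Variable mu : probability (borel (GL V)) R.
Hypothesis mom : finite_exponential_moment mu.
Context {d : measure_display} {Omega : measurableType d}.
Variable P : probability Omega R.
Variable g : nat -> {RV P >-> borel (GL V)}.
Hypothesis g_iid : iid mu g.
Variable s : R.
Hypothesis s1 : `|s| <= 1.
Variable rho : {measure set (borel (projective V * R)%type) -> \bar R}.
Hypothesis limit_rho : is_uniform_vague_limit (signed_approx g s) rho.

Local Notation E := (borel (projective V)).
Local Notation Z := (E * R)%type.

(** The identity map, used to carry [rho] over to the product sigma-algebra. *)
Let regroup (z : borel (projective V * R)%type) : Z := z.

Let measurable_regroup : measurable_fun setT regroup.
Proof. by move=> _ A mA; rewrite setTI; apply/measurable_prod_borel. Qed.

Let rhoE : {measure set Z -> \bar R} :=
  measure_function_pushforward__canonical__measure_function_Measure rho measurable_regroup.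

Let integral_rhoE (D : set Z) f : measurable D -> nnm f ->
  (\int[rhoE]_(z in D) f z = \int[rho]_(z in (D : set (borel (projective V * R)%type))) f z)%E.
Proof.
move=> mD [mf f0]; rewrite ge0_integral_pushforward//.
exact: measurable_funTS.
Qed.

Let rhoE_band_lty k : (rhoE (band k) < +oo)%E.
Proof.
have cK : compact ([set: projective V] `*` `[(- k%:R : R), k%:R]%classic).
  by apply: compact_setX; [exact: compact_projective|exact: segment_compact].
pose K : set (projective V * R) := [set: projective V] `*` `[(- k%:R : R), k%:R]%classic.
suff le : (rho (band k) <= rho K)%E.
  exact: le_lt_trans le (limit_rho.1 _ cK).
apply: le_measure.
- by rewrite inE; apply: borel_open; exact: open_band.
- by rewrite inE; apply/measurable_prod_borel; exact: measurableX.
- by move=> [x t] /= h; split => //=; rewrite in_itv/= -ler_norml ltW.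
Qed.

Let converges_continuous (h : projective V * R -> R) (M : R) :
  continuous h -> (forall z, 0 <= h z) -> (forall z, M <= `|z.2| -> h z = 0) ->
  converges mu pact (pcocycle s) rhoE (fun z : Z => (h z)%:E).
Proof.
move=> ch h0 hM; have csh := compact_support hM.
have nh : nnm (fun z : Z => (h z)%:E).
  by apply: nnm_EFin => //; exact: continuous_measurable_prod.
have lim := limit_rho.2 h ch csh.
have I0 : (0 <= \int[rho]_z (h z)%:E)%E by apply: integral_ge0 => z _; rewrite lee_fin.
have fin : (\int[rho]_z (h z)%:E)%E \is a fin_num.
  (* Were the integral infinite, its distance to any approximation would be infinite, against the
     bound with eps = 1. *)
  rewrite ge0_fin_numE// ltNge leye_eq; apply/negP => /eqP Ioo.
  have [n0 _ /(_ n0 (leqnn _) point)] := lim 1 ltr01.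
  rewrite Ioo; set y := signed_approx _ _ _ _ _.
  by case: y => [y| |]; rewrite /= leye_eq.
exists (fine (\int[rho]_z (h z)%:E)%E); first by rewrite fineK// integral_rhoE.
move=> eps eps0; have [n0 _ hn] := lim eps eps0.
exists n0 => n x n0n; apply: lee_abs_dist; rewrite fineK//.
by have := hn n n0n x; rewrite (signed_approxE g_iid).
Qed.

Let integral_cutoff (O : set (projective V * R)) (n : nat) :
  (\int[rhoE]_z (cutoff O n z)%:E =
   \int[rhoE]_(z in [set z | (0 <= z.2)%R])
     Q mu pact (pcocycle s) (fun z : Z => (cutoff O n z)%:E) z)%E.
Proof.
have [r [C [r01 C0 tail]]] := lognorm_tail mom.
have [K K0 hK] := lognorm_excess mom.
have bn0 z : n.+1%:R <= `|z.2| -> cutoff O n z = 0 by move=> h; apply: cutoff_eq0; right.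
have trapC p q e : 0 < e -> continuous (fun z : projective V * R => trap p q e z.2).
  move=> e0; apply: (@lipschitz_continuous_dist _ _ _ e^-1) => z w.
  apply: le_trans (trap_lipschitz _ _ _ _ e0) _; rewrite mulrC ler_wpM2l ?invr_ge0 ?(ltW e0)//.
  by rewrite /dist lerDr pdist_ge0.
have trapM p q e (z : projective V * R) : 0 < e ->
    Num.max `|p - e| `|q + e| <= `|z.2| -> trap p q e z.2 = 0.
  move=> e0; rewrite ge_max => /andP[h1 h2]; apply: trap0 => //.
  have := ler_norm (q + e); have := ler_norm (- (p - e)); rewrite normrN.
  by case: (ger0P z.2) h1 h2 => z0 h1 h2 h3 h4; apply/orP; [right|left]; lra.
apply: (limit_identity (@measurable_pact _ V) (measurable_pcocycle s)
  (@measurable_lognorm _ V) (@lognorm_ge0 _ V) (pcocycle_le s1)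
  (M := n.+1) _ _ _ _ _ _ _ r01 C0 tail K0 hK).
- move=> p q e pq e0; apply: (converges_continuous (M := Num.max `|p - e| `|q + e|)).
  + exact: trapC.
  + by move=> z; exact: trap_ge0.
  + by move=> z; exact: trapM.
- exact: measurable_cutoff.
- by move=> z; exact: cutoff_ge0.
- by move=> z; apply: le_trans (cutoff_le1 _ _ _) _; rewrite ler1n.
- exact: bn0.
- apply: (converges_continuous (M := n.+1%:R)) => //; last by move=> z; exact: cutoff_ge0.
  exact: lipschitz_continuous_dist (@cutoff_lipschitz _ _ O n).
- move=> p q e pq e0.
  have -> : (fun z : Z => (trap p q e z.2)%:E *
        Q mu pact (pcocycle s) (fun z => (cutoff O n z)%:E) z)%E =
      (fun z : Z => (trap p q e z.2 *
        fine (Q mu pact (pcocycle s) (fun z => (cutoff O n z)%:E) z))%:E).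
    apply/funext => z; rewrite EFinM fineK//.
    by apply: Qphi_fin => w; [exact: cutoff_ge0|exact: cutoff_le1].
  apply: (converges_continuous (M := Num.max `|p - e| `|q + e|)).
  + apply: (continuous_trap_Qphi s1 (lognorm_vanishing_tail mom) _ _ (@cutoff_lipschitz _ _ O n)) => //.
    * by move=> z; exact: cutoff_ge0.
    * by move=> z; exact: cutoff_le1.
  + move=> z; rewrite mulr_ge0 ?trap_ge0// fine_ge0// Qphi_ge0// => w; exact: cutoff_ge0.
  + by move=> z h; rewrite trapM// mul0r.
Qed.

(** The cutoffs of an open set have equal integrals against [rho] and its image under one killed
    step. Monotone convergence gives equality on open sets, hence of the measures, since bands have
    finite mass. *)
Theorem harmonic_identity (f : borel (projective V * R)%type -> \bar R) :
  measurable_fun setT f -> (forall z, (0 <= f z)%E) ->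
  (\int[rho]_z f z =
   \int[rho]_(z in [set: projective V] `*` `[0%R, +oo[)
     \int[P]_w f (act (g 0%N w) z.1, z.2 + s * cocycle (g 0%N w) z.1)%R)%E.
Proof.
move=> mf f0.
have nf : nnm (f : Z -> \bar R).
  split => // _ A mA; rewrite setTI; apply/measurable_prod_borel.
  by have := mf measurableT A mA; rewrite setTI.
have sf : sigma_finite setT rhoE.
  exists band; first exact/esym/bigcup_band.
  by move=> k; split; [apply: open_measurable_prod; exact: open_band|exact: rhoE_band_lty].
(* The product with [mu] in [next_measure] takes a sigma-finite first factor; the bands witness
   this. *)
pose rhoS := HB.pack_for (SigmaFiniteMeasure.type Z R) (Measure.sort rhoE)
  (isSFinite.Build _ _ _ _ (sfinite_measure_sigma_finite sf)) (isSigmaFinite.Build _ _ _ _ sf).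
have eqm A : measurable A ->
    rhoE A = next_measure mu (@measurable_pact _ V) (measurable_pcocycle s) rhoS A.
  apply: eq_measure_open => // O oO.
  have := integral_cutoff_cvg (m := rhoE) oO.
  under eq_fun do rewrite integral_cutoff.
  under eq_fun => n.
    rewrite -(@integral_next_measure _ _ _ _ _ mu _ _ (@measurable_pact _ V) (measurable_pcocycle s) rhoS); last first.
      by apply: nnm_EFin; [exact: measurable_cutoff|move=> z; exact: cutoff_ge0].
    over.
  move=> h; apply: (cvg_unique _ h); first exact: ereal_hausdorff.
  exact: integral_cutoff_cvg.
have mD : measurable ([set z : Z | (0 <= z.2)%R]).
  by apply: measurable_boolset; exact: measurable_ge0_snd.
transitivity (\int[rhoE]_z f z)%E; first by rewrite integral_rhoE.
transitivity (\int[next_measure mu (@measurable_pact _ V) (measurable_pcocycle s) rhoS]_z f z)%E.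
  by apply: eq_measure_integral => A mA _; exact: eqm.
rewrite integral_next_measure//.
have nQ := nnm_Q mu (@measurable_pact _ V) (measurable_pcocycle s) nf.
have -> : (\int[rhoS]_(z in [set z | (0 <= z.2)%R]) Q mu pact (pcocycle s) f z =
  \int[rhoE]_(z in [set z : Z | (0 <= z.2)%R]) Q mu pact (pcocycle s) f z)%E by [].
rewrite integral_rhoE//.
have -> : [set: projective V] `*` `[0%R, +oo[ = [set z : projective V * R | (0 <= z.2)%R].
  by apply/seteqP; split => -[x t] /=; [move=> [_]; rewrite /= in_itv/= andbT|move=> t0; split => //=; rewrite in_itv/= andbT].
apply: eq_integral => z _; rewrite /Q.
have nu := nnm_step (@measurable_pact _ V) (measurable_pcocycle s) (z : Z) nf.
transitivity (\int[distribution P (g 0%N)]_u f (step pact (pcocycle s) (z : Z) u))%E.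
  by apply: eq_measure_integral => A mA _; exact/esym/(g_iid.2 0%N A mA).
by rewrite ge0_integral_distribution//; exact: nu.1.
Qed.

End HarmonicMeasure.

Theorem corollary1p4 (R : realType) (V : euclideanType R)
    (mu : probability (borel (GL V)) R)
    (d : measure_display) (Omega : measurableType d)
    (P : probability Omega R) (g : nat -> {RV P >-> borel (GL V)})
    (rho rho_check : {measure set (borel (projective V * R)%type) -> \bar R})
    (Hprox : proximal (Gamma mu))
    (Hirr : strongly_irreducible (Gamma mu))
    (Hmom : finite_exponential_moment mu)
    (Hiid : iid mu g)
    (Hlyap : is_first_lyapunov_exponent g 0)
    (Hrho : is_target_harmonic_measure g rho)
    (Hrho_check : is_target_harmonic_measure_check g rho_check)
    (h : borel (projective V * R)%type -> R)
    (Hmeas : measurable_fun setT h)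
    (Hpos : forall z, 0 <= h z) :
  (\int[rho]_z (h z)%:E =
   \int[rho]_(z in [set: projective V] `*` `[0%R, +oo[)
     \int[P]_w (h (act (g 0%N w) z.1, z.2 + cocycle (g 0%N w) z.1)%R)%:E)%E /\
  (\int[rho_check]_z (h z)%:E =
   \int[rho_check]_(z in [set: projective V] `*` `[0%R, +oo[)
     \int[P]_w (h (act (g 0%N w) z.1, z.2 - cocycle (g 0%N w) z.1)%R)%:E)%E.
Proof.
have mh : measurable_fun setT (EFin \o h) by exact/measurable_EFinP.
have h0 z : (0 <= (EFin \o h) z)%E by rewrite lee_fin.
split.
  have e : harmonic_approx g = signed_approx g 1.
    apply/funext => f; apply/funext => n; apply/funext => x.
    rewrite /harmonic_approx /signed_approx /tau.
    apply: eq_integral => t _; congr (_ * _)%E.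
    under [in RHS]eq_set do under eq_fun do rewrite mul1r.
    by apply: eq_integral => w _; rewrite mul1r.
  have lim : is_uniform_vague_limit (signed_approx g 1) rho by rewrite -e.
  have s1 : `|1 : R| <= 1 by rewrite normr1.
  apply: etrans (harmonic_identity Hmom Hiid s1 lim mh h0) _.
  by apply: eq_integral => z _; apply: eq_integral => w _; rewrite mul1r.
have e : harmonic_approx_check g = signed_approx g (-1).
  apply/funext => f; apply/funext => n; apply/funext => x.
  rewrite /harmonic_approx_check /signed_approx /tau_check.
  apply: eq_integral => t _; congr (_ * _)%E.
  under [in RHS]eq_set do under eq_fun do rewrite mulN1r.
  by apply: eq_integral => w _; rewrite mulN1r.
have lim : is_uniform_vague_limit (signed_approx g (-1)) rho_check by rewrite -e.
have s1 : `|- 1 : R| <= 1 by rewrite normrN1.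
apply: etrans (harmonic_identity Hmom Hiid s1 lim mh h0) _.
by apply: eq_integral => z _; apply: eq_integral => w _; rewrite mulN1r.
Qed.
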